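(* Let $S\subset\mathbb{C}$ be a finitely generated $\mathbb{Z}$-algebra with fraction field $K$ such that $S\cap\overline{\mathbb{Q}}=\mathcal{O}$ is a (localized) ring of integers of a number field. Let $\mathcal{X}$ be the closed rigid annulus over $K((q))$ in the coordinate $t$ with inner and outer radii $1$, and let $(V,\nabla)$ be a vector bundle with connection on $\mathcal{X}$. Suppose there is a cyclic vector with respect to which all data can be reduced modulo $\mathfrak{p}$ for almost all primes $\mathfrak{p}\subset\mathcal{O}$, and that the $p$-curvatures vanish for almost all $p$. Then: (1) the coefficient matrix of the connection (of $\nabla(t\frac{d}{dt})$) with respect to the cyclic basis has entries in $\mathcal{O}^{\mathrm{rig}}_{\le1}(\mathcal{X})=K[[q]]\langle t,t^{-1}\rangle$; (2) after finite pullback, there exists a basis of solutions of $\nabla$ over $\mathcal{O}^{\mathrm{rig}}_{\le1}(\mathcal{X})$.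
   Context: For almost all primes $\mathfrak{p}\subset\mathcal{O}$, $S/\mathfrak{p}$ is a domain with fraction field $K_\mathfrak{p}$; an element of $K$ can be reduced mod $\mathfrak{p}$ if its $\mathfrak{p}$-adic valuation is nonnegative. $\mathcal{O}^{\mathrm{rig}}(\mathcal{X})=K((q))\langle t,t^{-1}\rangle$ is the ring of series $\sum_{k\in\mathbb{Z}}a_kt^k$, $a_k\in K((q))$, with $a_k\to0$ $q$-adically as $|k|\to\infty$; $\mathcal{O}^{\mathrm{rig}}_{\le1}(\mathcal{X})=K[[q]]\langle t,t^{-1}\rangle$ is the subring of functions bounded by $1$ (all $a_k\in K[[q]]$). Let $D=t\frac{d}{dt}$. A cyclic vector is a section $v$ such that $v,\nabla(D)v,\dots,\nabla(D)^{n-1}v$ is a basis; ''all data can be reduced mod $\mathfrak{p}$'' means all coefficients in $K$ of the entries of the matrix of $\nabla(D)$ in this basis have nonnegative $\mathfrak{p}$-adic valuation, giving a connection on the corresponding annulus over $K_\mathfrak{p}((q))$, whose $p$-curvature is $\nabla(D)^p-\nabla(D^p)$. Finite pullback means pullback along a finite cover (e.g. $t=s^m$, with finite extension of scalars). *)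

(* Defs.v *)
From HB Require Import structures.
From mathcomp Require Import all_boot all_order all_algebra all_field.
From mathcomp Require Import zify ring.
From mathcomp Require Import finmap complex.
From mathcomp Require Import all_classical reals.

Set Implicit Arguments.
Unset Strict Implicit.
Unset Printing Implicit Defensive.

Import Order.TTheory GRing.Theory Num.Theory.
Local Open Scope classical_set_scope.
Local Open Scope ring_scope.

(* An element of F((q))<t,t^-1> is the array (a k j) of the coefficients of    *)
(*   \sum_k (\sum_j a k j q^j) t^k.                                            *)
Section RigidAnnulus.
Variable F : fieldType.
Implicit Types a b : int -> int -> F.

Definition is_laurent (c : int -> F) : Prop :=
  exists N : int, forall j, j < N -> c j = 0.

Definition qadic_null a : Prop :=
  forall N : int, exists M : nat, forall k : int,
    (M < `|k|)%N -> forall j, j < N -> a k j = 0.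

Record rig_annulus : Type := RigAnnulus {
  coef : int -> int -> F;
  coef_laurent : forall k, is_laurent (coef k);
  coef_null : qadic_null coef
}.

Lemma rig_annulusP (f g : rig_annulus) :
  (forall k j, coef f k j = coef g k j) -> f = g.
Proof.
case: f g => [a la na] [b lb nb] /= ab.
have {}ab : a = b by apply/funext => k; apply/funext => j.
by case: _ / ab in lb nb *; congr RigAnnulus; apply: Prop_irrelevance.
Qed.

HB.instance Definition _ := gen_eqMixin rig_annulus.
HB.instance Definition _ := gen_choiceMixin rig_annulus.

Definition low_support a (M : int) : set (int * int) :=
  [set x | x.2 < M /\ a x.1 x.2 != 0].

(* The two growth conditions together say that every truncation in q has       *)
(* finite support.                                                              *)
Definition lowfin a := forall M, finite_set (low_support a M).

Definition box (N : nat) : set (int * int) :=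
  [set x | (`|x.1| <= N)%N /\ (`|x.2| <= N)%N].

Fact bounded_ints (N : nat) :
  exists s : seq int, forall i : int, (`|i| <= N)%N -> i \in s.
Proof.
exists ([seq i%:Z | i <- iota 0 N.+1] ++ [seq - i%:Z | i <- iota 0 N.+1]).
move=> i iN; rewrite mem_cat; apply/orP.
case: (lerP 0 i) => i0; [left|right]; apply/mapP; exists `|i|%N;
  rewrite ?mem_iota; lia.
Qed.

Fact finite_box N : finite_set (box N).
Proof.
have [s sP] := bounded_ints N.
apply: (@sub_finite_set _ _ [set` [seq (i, j) | i <- s, j <- s]]) => [[i j]|].
  by move=> [/= /sP si /sP sj]; apply/allpairsPdep; exists i, j.
exact: finite_seq.
Qed.

Fact finite_in_box (A : set (int * int)) :
  finite_set A -> exists N, A `<=` box N.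
Proof.
move=> /finite_seqP[s ->].
exists (\sum_(x <- s) (`|x.1|%N + `|x.2|%N))%N => x /= xs.
by rewrite (big_rem x xs) /=; split; rewrite /=; lia.
Qed.

Fact lowfinP a : (forall k, is_laurent (a k)) /\ qadic_null a <-> lowfin a.
Proof.
split=> [[la na] M|fa].
  have [m hm] := na M; have [/= l hl] := choice la.
  have [s sP] := bounded_ints m.
  pose N := (m + `|M| + \sum_(k <- s) `|l k|)%N.
  apply: (@sub_finite_set _ _ (box N)) (finite_box N) => -[k j] [/= jM akj].
  have km : (`|k| <= m)%N.
    by rewrite leqNgt; apply: contra akj => km; rewrite hm.
  have lj : l k <= j.
    by rewrite leNgt; apply: contra akj => kj; rewrite hl.
  by rewrite /box /N (big_rem k (sP k km)) /=; split; lia.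
split=> [k|N].
  have [N hN] := finite_in_box (fa 0).
  exists (- N%:Z) => j jN; apply/eqP; apply: contraT => akj.
  have [/= ? ?] : box N (k, j) by apply: hN; split=> //=; lia.
  lia.
have [M hM] := finite_in_box (fa N).
exists M => k kM j jN; apply/eqP; apply: contraT => akj.
have [/= ? ?] : box M (k, j) by apply: hM; split.
lia.
Qed.

Fact rig_lowfin (f : rig_annulus) : lowfin (coef f).
Proof. by apply/lowfinP; case: f. Qed.

Definition rig_mk a (h : lowfin a) : rig_annulus :=
  RigAnnulus (proj1 (proj2 (lowfinP a) h)) (proj2 (proj2 (lowfinP a) h)).

Fact lowfin_lb a : lowfin a ->
  exists N : int, forall k j, a k j != 0 -> N <= j.
Proof.
move=> /(_ 0) /finite_in_box[N hN]; exists (- N%:Z) => k j akj.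
case: (lerP 0 j) => [|j0]; first lia.
have [/= ? ?] : box N (k, j) by apply: hN.
lia.
Qed.

Fact lowfin0 : lowfin (fun _ _ => 0).
Proof.
move=> M; apply: (@sub_finite_set _ _ set0) => [x [_ /=]|].
  by rewrite eqxx.
exact: finite_set0.
Qed.

Fact lowfinD a b : lowfin a -> lowfin b -> lowfin (fun k j => a k j + b k j).
Proof.
move=> fa fb M; apply: (@sub_finite_set _ _
  (low_support a M `|` low_support b M)).
  move=> x [xM ab]; have [a0|a0] := eqVneq (a x.1 x.2) 0; last by left.
  by right; split=> //; rewrite a0 add0r in ab.
by rewrite finite_setU.
Qed.

Fact lowfinN a : lowfin a -> lowfin (fun k j => - a k j).
Proof.
move=> fa M; apply: sub_finite_set (fa M) => x [xM].
by rewrite oppr_eq0.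
Qed.

Definition conv a b (k j : int) : F :=
  \sum_(x \in [set: int * int]) a x.1 x.2 * b (k - x.1) (j - x.2).

Fact conv_neq0 a b (k j : int) : conv a b k j != 0 ->
  exists x : int * int, a x.1 x.2 != 0 /\ b (k - x.1) (j - x.2) != 0.
Proof.
move=> c0; apply: contrapT => h; move/negP: c0; apply; apply/eqP.
apply: fsbig1 => x _; apply/eqP; apply: contraT; rewrite mulf_eq0 negb_or.
by move=> /andP[? ?]; case: h; exists x.
Qed.

Fact lowfin_conv a b : lowfin a -> lowfin b -> lowfin (conv a b).
Proof.
move=> fa fb M; have [A hA] := lowfin_lb fa; have [B hB] := lowfin_lb fb.
have [N hN] := finite_in_box (fa (M - B)).
have [N' hN'] := finite_in_box (fb (M - A)).
apply: (@sub_finite_set _ _ (box (N + N'))) (finite_box _).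
move=> [k j] [/= jM /conv_neq0[[x1 x2] /= [ax bx]]].
have := hA _ _ ax; have := hB _ _ bx => ? ?.
have [/= ? ?] : box N (x1, x2) by apply: hN; split=> //=; lia.
have [/= ? ?] : box N' (k - x1, j - x2) by apply: hN'; split=> //=; lia.
by split=> /=; lia.
Qed.

Fact fsumE (A : set (int * int)) (G : int * int -> F) : finite_set A ->
  (forall x, G x != 0 -> A x) ->
  \sum_(x \in [set: int * int]) G x = \sum_(x <- fset_set A) G x.
Proof.
move=> fA GA; apply: fsbigTE => x; rewrite in_fset_set // notin_setE => nA.
by apply/eqP; apply: contraT => /GA.
Qed.

Fact conv_finite a b (k j : int) : lowfin a -> lowfin b ->
  finite_set [set x : int * int | a x.1 x.2 * b (k - x.1) (j - x.2) != 0].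
Proof.
move=> fa fb; have [B hB] := lowfin_lb fb.
apply: sub_finite_set (fa (j - B + 1)) => -[x1 x2] /=.
by rewrite mulf_eq0 negb_or => /andP[? /hB ?]; split=> //=; lia.
Qed.

Fact convC a b : conv a b = conv b a.
Proof.
apply/funext => k; apply/funext => j; rewrite /conv.
rewrite (@reindex_fsbigT _ _ _ _ _ (fun x : int * int => (k - x.1, j - x.2))).
  apply: eq_fsbigr => -[x1 x2] _ /=; rewrite mulrC.
  by congr (b _ _ * a _ _); ring.
exists (fun x : int * int => (k - x.1, j - x.2)) => -[x1 x2] /=;
  by congr pair; ring.
Qed.

Fact convDl a b c : lowfin a -> lowfin b -> lowfin c ->
  conv (fun k j => a k j + b k j) c = fun k j => conv a c k j + conv b c k j.
Proof.
move=> fa fb fc; apply/funext => k; apply/funext => j; rewrite /conv.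
pose A := [set x : int * int | a x.1 x.2 * c (k - x.1) (j - x.2) != 0] `|`
          [set x : int * int | b x.1 x.2 * c (k - x.1) (j - x.2) != 0].
have fA : finite_set A by rewrite finite_setU; split; apply: conv_finite.
rewrite !(@fsumE A) //; first by rewrite -big_split; apply: eq_bigr => x _;
  rewrite mulrDl.
- by move=> x ?; right.
- by move=> x ?; left.
move=> x; rewrite mulrDl => ac; have [h|h] := eqVneq (a x.1 x.2 * c (k - x.1) (j - x.2)) 0; last by left.
by right; rewrite /= -[X in X != 0]add0r -[X in X + _]h.
Qed.

Fact convA a b c : lowfin a -> lowfin b -> lowfin c ->
  conv a (conv b c) = conv (conv a b) c.
Proof.
move=> fa fb fc; apply/funext => k; apply/funext => j.
have [A hA] := lowfin_lb fa; have [B hB] := lowfin_lb fb.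
have [C hC] := lowfin_lb fc.
have fX := fa (j - B - C + 1).
pose Y := [set y : int * int | low_support c (j - A - B + 1) (k - y.1, j - y.2)].
have fY : finite_set Y.
  have [N hN] := finite_in_box (fc (j - A - B + 1)).
  apply: (@sub_finite_set _ _ (box (N + `|k| + `|j|))) (finite_box _).
  by move=> [y1 y2] /hN[/= ? ?]; split=> /=; lia.
pose G (x y : int * int) :=
  a x.1 x.2 * b (y.1 - x.1) (y.2 - x.2) * c (k - y.1) (j - y.2).
have GP x y : G x y != 0 -> low_support a (j - B - C + 1) x /\ Y y.
  case: x y => [x1 x2] [y1 y2].
  rewrite /G /Y /low_support !mulf_eq0 !negb_or => /andP[/andP[/= ax bx] cx].
  have := hA _ _ ax; have := hB _ _ bx; have := hC _ _ cx => ? ? ?.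
  by split; split=> //=; lia.
transitivity (\sum_(x <- fset_set (low_support a (j - B - C + 1)))
              \sum_(y <- fset_set Y) G x y).
  rewrite /conv -(@fsumE _ (fun x => \sum_(y <- fset_set Y) G x y)) //.
    apply: eq_fsbigr => x _.
    rewrite mulr_fsumr.
    rewrite (@reindex_fsbigT _ _ _ _ _
      (fun y : int * int => (y.1 - x.1, y.2 - x.2))) /=.
      rewrite -fsumE //; last by move=> y /GP[].
      apply: eq_fsbigr => y _; rewrite /G mulrA.
      by congr (_ * _ * c _ _); ring.
    exists (fun y : int * int => (y.1 + x.1, y.2 + x.2)) => -[y1 y2] /=;
      by congr pair; ring.
  move=> x; apply: contraNP => nX; apply/eqP; apply: big1 => y _.
  by apply/eqP; apply: contraT => /GP[].
rewrite exchange_big /= /conv -(@fsumE _ (fun y => \sum_(x <- fset_set (low_support a (j - B - C + 1))) G x y)) //.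
  apply: eq_fsbigr => y _; rewrite mulr_fsuml.
  by rewrite -fsumE // => x /GP[].
move=> y; apply: contraNP => nY; apply/eqP; apply: big1 => x _.
by apply/eqP; apply: contraT => /GP[].
Qed.

Definition delta (m l : int) : int -> int -> F :=
  fun k j => ((k == m) && (j == l))%:R.

Fact lowfin_delta m l : lowfin (delta m l).
Proof.
move=> M; apply: (@sub_finite_set _ _ [set (m, l)]) => [[k j] [_ /=]|].
  rewrite /delta; have [->|_] := eqVneq k m; have [->|_] := eqVneq j l => //=;
    by rewrite eqxx.
exact: finite_set1.
Qed.

Fact conv1 a : conv (delta 0 0) a = a.
Proof.
apply/funext => k; apply/funext => j; rewrite /conv.
rewrite (@fsumE [set (0, 0)]) //; last first.
  move=> [x1 x2] /=; rewrite /delta.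
  have [->|_] := eqVneq x1 0; have [->|_] := eqVneq x2 0 => //=;
    by rewrite mul0r eqxx.
by rewrite fset_set1 big_seq_fset1 /= /delta !eqxx mul1r !subr0.
Qed.

Definition rig_add f g := rig_mk (lowfinD (rig_lowfin f) (rig_lowfin g)).
Definition rig_opp f := rig_mk (lowfinN (rig_lowfin f)).
Definition rig_mul f g := rig_mk (lowfin_conv (rig_lowfin f) (rig_lowfin g)).
Definition rig_zero := rig_mk lowfin0.
Definition rig_monomial (m l : int) := rig_mk (lowfin_delta m l).

Fact rig_addA : associative rig_add.
Proof. by move=> f g h; apply: rig_annulusP => k j /=; rewrite addrA. Qed.
Fact rig_addC : commutative rig_add.
Proof. by move=> f g; apply: rig_annulusP => k j /=; rewrite addrC. Qed.
Fact rig_add0 : left_id rig_zero rig_add.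
Proof. by move=> f; apply: rig_annulusP => k j /=; rewrite add0r. Qed.
Fact rig_addN : left_inverse rig_zero rig_opp rig_add.
Proof. by move=> f; apply: rig_annulusP => k j /=; rewrite addNr. Qed.

HB.instance Definition _ :=
  GRing.isZmodule.Build rig_annulus rig_addA rig_addC rig_add0 rig_addN.

Fact rig_mulA : associative rig_mul.
Proof.
move=> f g h; apply: rig_annulusP => k j /=.
by rewrite (convA (rig_lowfin f) (rig_lowfin g) (rig_lowfin h)).
Qed.
Fact rig_mulC : commutative rig_mul.
Proof. by move=> f g; apply: rig_annulusP => k j /=; rewrite convC. Qed.
Fact rig_mul1 : left_id (rig_monomial 0 0) rig_mul.
Proof. by move=> f; apply: rig_annulusP => k j /=; rewrite conv1. Qed.
Fact rig_mulDl : left_distributive rig_mul +%R.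
Proof.
move=> f g h; apply: rig_annulusP => k j /=.
by rewrite (convDl (rig_lowfin f) (rig_lowfin g) (rig_lowfin h)).
Qed.
Fact rig_oneN0 : rig_monomial 0 0 != 0.
Proof.
apply/eqP => /(congr1 (fun f => coef f 0 0)) /= /eqP.
by rewrite /delta !eqxx oner_eq0.
Qed.

HB.instance Definition _ := GRing.Zmodule_isComNzRing.Build rig_annulus
  rig_mulA rig_mulC rig_mul1 rig_mulDl rig_oneN0.

Lemma coefD (f g : rig_annulus) k j :
  coef (f + g) k j = coef f k j + coef g k j.
Proof. by []. Qed.

Lemma coefM (f g : rig_annulus) k j :
  coef (f * g) k j =
  \sum_(x \in [set: int * int])
    coef f x.1 x.2 * coef g (k - x.1) (j - x.2).
Proof. by []. Qed.

Lemma coef_monomial m l k j :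
  coef (rig_monomial m l) k j = ((k == m) && (j == l))%:R.
Proof. by []. Qed.

Fact lowfinT a : lowfin a -> lowfin (fun k j => k%:~R * a k j).
Proof.
move=> fa M; apply: sub_finite_set (fa M) => x [xM].
by rewrite mulf_eq0 negb_or => /andP[].
Qed.

(* t d/dt *)
Definition Dt f := rig_mk (lowfinT (rig_lowfin f)).

Lemma coef_Dt f k j : coef (Dt f) k j = k%:~R * coef f k j.
Proof. by []. Qed.

Lemma rig_monomialM m l m' l' :
  rig_monomial m l * rig_monomial m' l' = rig_monomial (m + m') (l + l').
Proof.
apply: rig_annulusP => k j; rewrite coefM /=.
rewrite (@fsumE [set (m, l)]) //; last first.
  move=> [x1 x2] /=; rewrite /delta.
  have [->|_] := eqVneq x1 m; have [->|_] := eqVneq x2 l => //=;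
    by rewrite mul0r eqxx.
rewrite fset_set1 big_seq_fset1 /= /delta !eqxx mul1r.
by rewrite !subr_eq (addrC m') (addrC l').
Qed.

Definition rig_le1 : set rig_annulus :=
  [set f | forall k j, j < 0 -> coef f k j = 0].

End RigidAnnulus.

Arguments rig_monomial {F}.
Arguments Dt {F}.
Arguments rig_le1 {F}.

(* Pullback of functions along the finite cover t = s^m of annuli, with scalars *)
(* extended from K((q)) to L((u)), where q = u^e and L/K is finite.  In         *)
(* characteristic 0 every finite extension of K((q)) lies in some such L((u)).  *)
Section Pullback.
Variables (K : fieldType) (L : fieldExtType K) (m e : nat).

Definition pullback_coef (f : rig_annulus K) (k j : int) : L :=
  if (m%:Z %| k)%Z && (e%:Z %| j)%Z
  then (coef f (k %/ m%:Z)%Z (j %/ e%:Z)%Z)%:A else 0.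

Fact lowfin_pullback f : lowfin (pullback_coef f).
Proof.
move=> M; have ff : lowfin (coef f) by apply/lowfinP; case: f.
have [N hN] := finite_in_box (ff (`|M| + 1)).
apply: (@sub_finite_set _ _ (box (N * (m + e)))) (finite_box _).
move=> [k j]; rewrite /low_support /pullback_coef /= => -[jM].
case: ifP; last by rewrite eqxx.
move=> /andP[mk ej]; have := divzK mk; have := divzK ej.
have : e = 0 -> (j %/ e%:Z)%Z = 0 by move=> ->; rewrite divz0.
move: (k %/ _)%Z (j %/ _)%Z => k' j' j'0 ejE mkE fkj.
have fkj' : coef f k' j' != 0.
  by apply: contraNN fkj => /eqP ->; rewrite scale0r.
have [/= ? ?] : box N (k', j').
  apply: hN; split=> //=; case: (posnP e) => [/j'0 -> |e0]; nia.
by rewrite /box /= -mkE -ejE !abszM /=; split; nia.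
Qed.

Definition pullback f : rig_annulus L := rig_mk (lowfin_pullback f).

End Pullback.

Section Arithmetic.
Variables (K : fieldType) (S : {pred K}).

Definition fingen_Zalgebra : Prop :=
  GRing.subring_closed S /\
  exists g : seq K, {subset g <= S} /\
    forall T : {pred K}, GRing.subring_closed T -> {subset g <= T} ->
      {subset S <= T}.

Definition has_fraction_field : Prop :=
  forall x : K, exists a b, [/\ a \in S, b \in S, b != 0 & x = a / b].

Definition algebraic_part : set K :=
  [set x | x \in S /\ algebraicOver (ratr : rat -> K) x].

Definition number_field (E : {pred K}) : Prop :=
  GRing.divring_closed E /\
  exists b : seq K, forall x, x \in E ->
    exists c : nat -> rat, x = \sum_(i < size b) ratr (c i) * b`_i.

Definition ring_of_integers (E : {pred K}) : set K :=
  [set x | x \in E /\ integralOver (intmul 1 : int -> K) x].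

Definition localized_ring_of_integers (O : set K) : Prop :=
  exists (E : {pred K}) (M : set K),
    [/\ number_field E, M `<=` ring_of_integers E,
        M 1 /\ (forall x y, M x -> M y -> M (x * y)), ~ M 0 &
        O = [set x | exists a s, [/\ ring_of_integers E a, M s & x = a / s]]].

Record nonzero_prime (O P : set K) : Prop := NonzeroPrime {
  prime_sub : P `<=` O;
  prime_subr : forall x y, P x -> P y -> P (x - y);
  prime_mull : forall a x, O a -> P x -> P (a * x);
  prime_proper : ~ P 1;
  prime_mul : forall a b, O a -> O b -> P (a * b) -> P a \/ P b;
  prime_nonzero : exists2 x, P x & x != 0
}.

Definition almost_all_primes (Q : set K -> Prop) : Prop :=
  finite_set [set P | nonzero_prime algebraic_part P /\ ~ Q P].

(* the ideal P^n S of S *)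
Fixpoint extended_power (P : set K) (n : nat) : set K :=
  if n is n'.+1 then
    [set x | exists s : seq (K * K),
       (forall u, u \in s -> P u.1 /\ extended_power P n' u.2) /\
       x = \sum_(u <- s) u.1 * u.2]
  else [set x | x \in S].

(* When S/PS is a domain, the localization of S at PS is a discrete valuation  *)
(* ring with maximal ideal generated by P, and PS^n contracts to P^n S; its     *)
(* valuation is the P-adic valuation of K.                                      *)
Definition has_order (P : set K) (x : K) (n : nat) : Prop :=
  extended_power P n x /\ ~ extended_power P n.+1 x.

Definition has_valuation (P : set K) (a : K) (z : int) : Prop :=
  exists x y m n,
    [/\ has_order P x m, has_order P y n, a = x / y & z = m%:Z - n%:Z].

Definition nonneg_valuation (P : set K) (a : K) : Prop :=
  a = 0 \/ exists2 z, has_valuation P a z & 0 <= z.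

(* F is the fraction field of S/PS; r is only meaningful on S *)
Record residue_field (P : set K) (F : fieldType) (r : K -> F) : Prop :=
  ResidueField {
  residue1 : r 1 = 1;
  residueB : {in S &, forall x y, r (x - y) = r x - r y};
  residueM : {in S &, forall x y, r (x * y) = r x * r y};
  residue_ker : {in S, forall x, r x = 0 <-> extended_power P 1 x};
  residue_frac : forall b, exists x y,
    [/\ x \in S, y \in S, r y != 0 & b = r x / r y]
}.

Definition reduces_to (F : fieldType) (r : K -> F) (a : K) (b : F) : Prop :=
  exists x y, [/\ x \in S, y \in S, r y != 0, a = x / y & b = r x / r y].

Definition reduces_to_mx (F : fieldType) (r : K -> F) (n : nat)
    (A : 'M[rig_annulus K]_n) (B : 'M[rig_annulus F]_n) : Prop :=
  forall i j k l, reduces_to r (coef (A i j) k l) (coef (B i j) k l).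

Definition reducible_mx (P : set K) (n : nat) (A : 'M[rig_annulus K]_n) :
    Prop :=
  forall i j k l, nonneg_valuation P (coef (A i j) k l).

End Arithmetic.

Section Connections.
Variable F : fieldType.
Local Notation O := (rig_annulus F).

(* Over the affinoid algebra O, vector bundles are finite projective modules,  *)
(* and Omega^1 is free on dt/t, so that a connection amounts to nabla(D).  A    *)
(* bundle with a cyclic vector is free.                                         *)
Record is_connection (V : lmodType O) (nabla : V -> V) : Prop :=
  IsConnection {
  connD : forall x y, nabla (x + y) = nabla x + nabla y;
  connL : forall (f : O) x, nabla (f *: x) = Dt f *: x + f *: nabla x
}.

Definition cyclic_vector (V : lmodType O) (nabla : V -> V) (n : nat) (v : V) :
    Prop :=
  forall x : V, exists! c : 'rV[O]_n,
    x = \sum_(i < n) c 0 i *: iter i nabla v.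

Definition connection_matrix (V : lmodType O) (nabla : V -> V) (n : nat) (v : V)
    (A : 'M[O]_n) : Prop :=
  forall i : 'I_n,
    nabla (iter i nabla v) = \sum_(j < n) A i j *: iter j nabla v.

(* nabla(E) on O^n, in coordinates on the row vectors, for a derivation E and   *)
(* the connection whose form is A dt/t: the contraction of dt/t with E is       *)
(* t^-1 E(t).                                                                   *)
Definition nabla_along (n : nat) (A : 'M[O]_n) (E : O -> O) (x : 'rV[O]_n) :
    'rV[O]_n :=
  map_mx E x + (rig_monomial (-1) 0 * E (rig_monomial 1 0)) *: (x *m A).

Fact nabla_along_Dt n (A : 'M[O]_n) x : nabla_along A Dt x = map_mx Dt x + x *m A.
Proof.
have Dt1 : Dt (rig_monomial 1 0) = rig_monomial 1 0 :> O.
  apply: rig_annulusP => k j; rewrite coef_Dt coef_monomial.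
  by have [->|_] := eqVneq k 1; rewrite ?mul1r ?mulr0.
by rewrite /nabla_along Dt1 rig_monomialM addNr scale1r.
Qed.

Definition p_curvature (p : nat) (n : nat) (A : 'M[O]_n) (x : 'rV[O]_n) :
    'rV[O]_n :=
  iter p (nabla_along A Dt) x - nabla_along A (iter p Dt) x.

Definition le1_mx (m n : nat) (Y : 'M[O]_(m, n)) : Prop :=
  forall i j, rig_le1 (Y i j).

(* the rows of Y are horizontal and form a basis of the bounded-by-1 lattice *)
Definition solution_basis_le1 (n : nat) (A Y : 'M[O]_n) : Prop :=
  [/\ forall i, nabla_along A Dt (row i Y) = 0, le1_mx Y &
      exists Z : 'M[O]_n, [/\ le1_mx Z, Y *m Z = 1%:M & Z *m Y = 1%:M]].

End Connections.

(* On the cover t = s^m one has dt/t = m ds/s. *)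
Definition pullback_mx (K : fieldType) (L : fieldExtType K) (m e n : nat)
    (A : 'M[rig_annulus K]_n) : 'M[rig_annulus L]_n :=
  map_mx (fun f => m%:R * pullback L m e f) A.

(* Main.v *)
(* Let [r] be the reduction modulo a prime [P] of large residue characteristic   *)
(* [p], and [nabla] the reduced connection; as [D^p = D], vanishing p-curvature   *)
(* means [nabla^p = nabla].  By Chevalley's theorem finitely many nonzero         *)
(* elements of [K] are units modulo [P] for some such [P], so an algebraic        *)
(* obstruction over [K] is zero as soon as it dies modulo those [P].              *)
(*                                                                              *)
(* 1. If [L] is the operator killing the cyclic vector, [D^p - D = Q L].  Gauss's *)
(*    lemma for the lexicographic valuations in [(q, t)] and [(q, t^-1)] bounds   *)
(*    the coefficients of [L] by 1 and makes them constant in [t] modulo [q].     *)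
(* 2. The constant term [C] satisfies [C^p = C] modulo [P], so its eigenvalues    *)
(*    reduce into the prime field.  By Kronecker's theorem they are rational: if  *)
(*    an irreducible [g] of degree at least 2 split modulo almost all [p], there  *)
(*    would be too many small elements of [Z[x]/(g)] of small norm (pigeonhole    *)
(*    against the divergence of the harmonic series).  Moreover [C] is semisimple.*)
(* 3. For an eigenvector of [C], horizontality is solved one power of [q] at a    *)
(*    time; the obstruction at each step is killed modulo [P] by                  *)
(*    [nabla^p = nabla].  Clearing the denominators of the eigenvalues by         *)
(*    [t = s^m] turns the solutions into honest functions.                        *)

Require Import Defs.
From HB Require Import structures.
From mathcomp Require Import all_boot all_order all_algebra all_field.
From mathcomp Require Import perm complex.
From mathcomp Require Import all_classical reals.
From mathcomp Require Import zify ring.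

Set Implicit Arguments.
Unset Strict Implicit.
Unset Printing Implicit Defensive.

Import Order.TTheory GRing.Theory Num.Theory.
Local Open Scope classical_set_scope.
Local Open Scope ring_scope.

(** * Norms from [Z[x]/(g)] *)

(** Let [P] be a prime of residue characteristic [p] at which the reduced connection has vanishing
    p-curvature. There [D^p = D], hence [nabla^p = nabla]. The operator [D^p - D] therefore kills
    the cyclic vector and factors as [Q L], where [L] is the minimal operator of that vector. Since
    [D^p - D] has constant coefficients and leading exponents add up in a product, [L] is bounded by
    1 and constant in [t] modulo [q] ([companion_coef_p_curvature]). A coefficient of [A] violating
    this would stay nonzero at some good [P], by Chevalley's theorem ([avoid_good_reduction]). So
    [A] has the same shape ([generic_coef]), which gives (1).

    Modulo [q] the connection is now [D + C] with [C] constant, and [C^p = C] modulo each good [P].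
    Almost all specializations of an eigenvalue of [C] to characteristic [p] thus lie in the prime
    field, and [kronecker] makes the eigenvalue rational. That theorem is proved by counting. If an
    irreducible [g] of degree at least 2 had two distinct simple roots modulo almost every prime,
    each factorization [a * b] of a suitable integer would give a polynomial with small coefficients
    whose norm is a bounded multiple of [a * b]. There are more factorizations than such polynomials
    ([two_roots_absurd]). The nilpotent part of [C] dies modulo [P] because a nilpotent [W] with
    [W^p = W] is zero ([rational_semisimple]), so [C] is diagonalizable over the rationals.

    For a left eigenvector of [C] with eigenvalue [d], the equation [nabla z = d z] is solved one
    power of [q] at a time. The obstruction at each step is a linear functional of the error; it
    vanishes modulo the good [P], hence vanishes ([unobstructed], [solution_exists]). If [m] clears
    the denominators of the eigenvalues, then on the cover [t = s^m] each [z] times [s^(-m d)] is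
    horizontal. These sections form a basis over the functions bounded by 1, because their matrix
    modulo [q] is invertible ([pullback_solution]). *)

Section Companion.
Variables (R : comNzRingType) (d : nat).
Implicit Types (g h : {poly R}) (b : R).

Definition companion g : 'M[R]_d.+1 :=
  \matrix_(i, j) if i == d :> nat then - g`_j else (i.+1 == j)%:R.

Definition powers b : 'cV[R]_d.+1 := \col_i b ^+ i.

(** For [g] monic of degree [d.+1], [companion g] is multiplication by [x] on [R[x]/(g)] in the
    basis of powers of [x]. This determinant is then the norm of [h] from [R[x]/(g)] to [R]. *)
Definition poly_norm g h : R := \det (horner_mx (companion g) h).

Lemma companion_powers g b : g \is monic -> size g = d.+2 ->
  companion g *m powers b = b *: powers b - g.[b] *: delta_mx ord_max 0.
Proof.
move=> gm sg; apply/colP => i; rewrite !mxE.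
have [id|id] := eqVneq (i : nat) d.
  rewrite (_ : i == ord_max); last by apply/eqP/val_inj.
  rewrite mulr1 horner_coef sg [in RHS]big_ord_recr /=.
  rewrite (_ : g`_d.+1 = 1); last by move: gm; rewrite monicE lead_coefE sg => /eqP.
  rewrite mul1r id exprS opprD addrC addrNK -sumrN.
  by apply: eq_bigr => j _; rewrite !mxE id eqxx mulNr.
have id' : (i.+1 < d.+1)%N by have := ltn_ord i; lia.
rewrite (_ : i == ord_max = false); last by apply: contra_neqF id => /eqP ->.
rewrite mulr0 subr0 (bigD1 (Ordinal id')) //= big1 ?addr0.
  by rewrite !mxE (negPf id) eqxx mul1r -exprS.
move=> j jN; rewrite !mxE (negPf id); case: eqP => [ij|_]; last by rewrite mul0r.
by case/eqP: jN; apply/val_inj.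
Qed.

(** The error term [g.[b] *: u] is kept so that the identity can also be used when [b] is only a
    root of [g] modulo some integer. *)
Lemma horner_companion_powers g h b : g \is monic -> size g = d.+2 ->
  exists u, horner_mx (companion g) h *m powers b = h.[b] *: powers b + g.[b] *: u.
Proof.
move=> gm sg; have /factor_theorem[q hq] : root (h - h.[b]%:P) b.
  by rewrite rootE !hornerE subrr.
exists (- (horner_mx (companion g) q *m delta_mx ord_max 0)).
have -> : h = q * ('X - b%:P) + h.[b]%:P by rewrite -hq subrK.
rewrite rmorphD rmorphM rmorphB /= horner_mx_X !horner_mx_C.
rewrite mulmxDl -[X in X *m _ + _]/(horner_mx _ q *m (companion g - b%:M)) -mulmxA.
rewrite mulmxBl companion_powers // !mul_scalar_mx addrAC subrr add0r.
rewrite mulmxN -scalemxAr scalerN.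
by rewrite addrC !hornerE subrr mulr0 add0r.
Qed.

Lemma poly_norm_root g h b : g \is monic -> size g = d.+2 ->
  g.[b] = 0 -> h.[b] = 0 -> poly_norm g h = 0.
Proof.
move=> gm sg gb hb; have [u] := horner_companion_powers h b gm sg.
rewrite gb hb !scale0r addr0 => /(congr1 (mulmx (\adj (horner_mx (companion g) h)))).
rewrite mulmxA mul_adj_mx mul_scalar_mx mulmx0 => /colP/(_ 0).
by rewrite !mxE expr0 mulr1.
Qed.

End Companion.

Lemma map_companion (R R' : comNzRingType) (f : {rmorphism R -> R'}) d g :
  map_mx f (companion d g) = companion d (map_poly f g).
Proof.
apply/matrixP => i j; rewrite !mxE; case: ifP => _; first by rewrite rmorphN coef_map.
by rewrite rmorph_nat.
Qed.

Lemma poly_norm_map (R R' : comNzRingType) (f : {rmorphism R -> R'}) d g h :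
  f (poly_norm d g h) = poly_norm d (map_poly f g) (map_poly f h).
Proof. by rewrite /poly_norm -det_map_mx map_horner_mx map_companion. Qed.

Section IntegralNorm.
Variables (d : nat) (g : {poly int}).
Hypotheses (g_monic : g \is monic) (g_size : size g = d.+2).
Local Notation zmap E := (map_poly (intmul 1 : int -> E)).

(** A row vector [v] killed by [h(companion g)], read as a polynomial of degree at most [d] and
    paired with the powers of [x], gives [h(x) v(x) = 0]. Minimality of the degree of [x] then
    forces [v = 0]. *)
Lemma poly_norm_neq0 (E : fieldType) (x : E) (h : {poly int}) :
    (forall v : {poly int}, v != 0 -> (size v <= d.+1)%N -> (zmap E v).[x] != 0) ->
    (zmap E g).[x] = 0 -> (zmap E h).[x] != 0 -> poly_norm d g h != 0.
Proof.
move=> xmin gx hx; apply/negP => /det0P[v vN0 vM].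
have gm : zmap E g \is monic by exact: (monic_map _ g_monic).
have sg : size (zmap E g) = d.+2.
  by rewrite size_map_poly_id0 ?g_size // (monicP g_monic) oner_eq0.
have [u] := horner_companion_powers (zmap E h) x gm sg.
rewrite gx scale0r addr0 => Mw.
have := congr1 (map_mx (intmul 1 : int -> E)) vM.
rewrite map_mxM map_mx0 map_horner_mx map_companion => /(congr1 (mulmx^~ (powers d x))).
rewrite -mulmxA Mw mul0mx -scalemxAr => /matrixP/(_ 0 0).
rewrite [RHS]mxE [LHS]mxE => /eqP; rewrite mulf_eq0 (negPf hx) /=.
have -> : (map_mx (intmul 1 : int -> E) v *m powers d x) 0 0 = (zmap E (rVpoly v)).[x].
  rewrite (horner_coef_wide _ (leq_trans (size_poly _ _) (size_poly _ _))) mxE.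
  by apply: eq_bigr => i _; rewrite !mxE coef_map coef_rVpoly_ord.
apply/negP/xmin; last exact: size_poly.
by apply: contra vN0 => /eqP /(congr1 (@poly_rV _ d.+1)); rewrite rVpolyK linear0 => ->.
Qed.

Lemma poly_norm_pchar (k : comNzRingType) p (b : k) (h : {poly int}) :
    p \in [pchar k] -> (zmap k g).[b] = 0 -> (zmap k h).[b] = 0 ->
  (p %| poly_norm d g h)%Z.
Proof.
move=> pk gb hb; rewrite (dvdz_pcharf pk) -[_%:~R]/((intmul 1 : {rmorphism int -> k}) _).
rewrite poly_norm_map; apply/eqP; apply: poly_norm_root gb hb; first exact: (monic_map _ g_monic).
by rewrite size_map_poly_id0 ?g_size // (monicP g_monic) oner_eq0.
Qed.

(** The norm is homogeneous of degree [d.+1] in the coefficients of [h]. *)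
Lemma poly_norm_bound : exists C : nat, forall (H : nat) (h : {poly int}),
  (size h <= d.+1)%N -> (forall i, `|h`_i| <= H%:Z) ->
  `|poly_norm d g h| <= (C * H ^ d.+1)%N%:Z.
Proof.
pose G := (\sum_(i < d.+1) \sum_a \sum_b `|((companion d g) ^+ i) a b|%N)%N.
exists (#|'S_d.+1| * (d.+1 * G) ^ d.+1)%N => H h sh hH.
rewrite /poly_norm /determinant; apply: le_trans (ler_norm_sum _ _ _) _.
have : forall s : 'S_d.+1, true ->
    `|(-1) ^+ s * \prod_i horner_mx (companion d g) h i (s i)| <=
    ((d.+1 * G * H) ^ d.+1)%N%:Z.
  move=> s _; rewrite normrM normrX normrN1 expr1n mul1r normr_prod.
  rewrite -[X in _ <= X]natz natrX -[X in _ ^+ X]card_ord -prodr_const.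
  apply: ler_prod => a _; rewrite normr_ge0 /=.
  rewrite -(poly_rV_K sh) horner_rVpoly 2!mxE.
  apply: le_trans (ler_norm_sum _ _ _) _.
  have -> : (d.+1 * G * H)%N%:R = \sum_(i < d.+1) (G * H)%N%:R :> int.
    by rewrite -mulnA natrM mulr_natl sumr_const card_ord.
  apply: ler_sum => i _.
  rewrite [poly_rV _ _ _]mxE [powers_mx _ _ _ _]mxE mxvecE normrM natrM mulrC.
  apply: ler_pM; rewrite ?normr_ge0 //; last by rewrite natz.
  rewrite natz /G (bigD1 i) //= (bigD1 a) //= (bigD1 (s a)) //=.
  by rewrite -abszE lez_nat -!addnA leq_addr.
move=> /ler_sum/le_trans; apply.
by rewrite sumr_const -mulr_natl expnMn natz -PoszM mulnA cardT.
Qed.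

End IntegralNorm.

(* The matrix with first columns [powers r] and [powers r'], completed by basis *)
(* vectors, has determinant [r' - r].                                          *)
Lemma poly_norm_dvd d (g h : {poly int}) (r r' a b n : int) :
    g \is monic -> size g = d.+3 -> (a %| n)%Z -> (b %| n)%Z ->
    (n %| g.[r])%Z -> (n %| g.[r'])%Z -> (a %| h.[r])%Z -> (b %| h.[r'])%Z ->
    coprimez (a * b) (r' - r) ->
  (a * b %| poly_norm d.+1 g h)%Z.
Proof.
move=> gm sg an bn gr gr' ha hb cop.
have vec s c : (c %| n)%Z -> (n %| g.[s])%Z -> (c %| h.[s])%Z ->
    exists u : 'cV[int]_d.+2, horner_mx (companion d.+1 g) h *m powers d.+1 s = c *: u.
  move=> cn ns hs; have [u ->] := horner_companion_powers h s gm sg.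
  have /dvdzP[x ->] := hs; have /dvdzP[y ->] := dvdz_trans cn ns.
  exists (x *: powers d.+1 s + y *: u).
  by rewrite scalerDr !scalerA ![c * _]mulrC.
have [u hu] := vec _ _ an gr ha; have [u' hu'] := vec _ _ bn gr' hb.
pose W : 'M[int]_(2 + d, 1 + 1) := row_mx (powers d.+1 r) (powers d.+1 r').
pose U := block_mx (usubmx W) 0 (dsubmx W) (1%:M : 'M_d).
have WE i j : W i j = (if j == 0 :> nat then r else r') ^+ i.
  by rewrite mxE; case: splitP => k; rewrite !mxE ord1 => ->.
have detU : \det U = r' - r.
  have -> : U = block_mx (\matrix_(i, j) (if j == 0 :> nat then r else r') ^+ i)
                 0 (dsubmx W) 1%:M.
    by congr block_mx; apply/matrixP => i j; rewrite [LHS]mxE WE [RHS]mxE.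
  rewrite det_lblock det1 mulr1 (expand_det_row _ ord0) !big_ord_recl big_ord0.
  by rewrite /cofactor !det_mx11 !mxE /= /bump /=; ring.
pose X := horner_mx (companion d.+1 g) h *m (col_mx 0 1%:M : 'M_(2 + d, d)).
(* The first two columns of the product are divisible by [a] and by [b], so [a * b] divides the norm
   times [\det U = r' - r]. *)
have MU : horner_mx (companion d.+1 g) h *m U =
    row_mx (row_mx u u') X *m block_mx (block_mx a%:M 0 0 b%:M) 0 0 1%:M.
  rewrite mul_row_block !mulmx0 addr0 add0r mulmx1 mul_row_block !mulmx0 addr0 add0r.
  by rewrite /U block_mxEh vsubmxK mul_mx_row /W mul_mx_row hu hu' !mul_mx_scalar.
have := congr1 (fun A => \det (A : 'M_(1 + 1 + d))) MU.
rewrite !det_mulmx detU !det_lblock det1 mulr1 !det_scalar1 => e.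
by rewrite -(Gauss_dvdzl _ cop) e dvdz_mull.
Qed.

(** * Roots modulo n *)

Lemma Fp_algebraic_closure (p : nat) : prime p ->
  exists k : closedFieldType, p \in [pchar k].
Proof.
move=> pp; have [k [f _]] := countable_algebraic_closure 'F_p.
exists (k : closedFieldType).
by have := pchar_Fp pp; rewrite -(fmorph_pchar f).
Qed.

Lemma expf_pchar_eq_nat (k : fieldType) p (b : k) : p \in [pchar k] ->
  b ^+ p = b -> exists i : nat, b = i%:R.
Proof.
move=> pk bp; have p_gt1 := prime_gt1 (pcharf_prime pk).
have ubn m : (m < p)%N -> m%:R = 0 :> k -> m = 0%N.
  move=> mp /eqP; rewrite -(dvdn_pcharf pk); case: m mp => // m mp /dvdn_leq; lia.
pose P : {poly k} := 'X^p - 'X.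
have sP : size P = p.+1 by rewrite size_polyDl size_polyXn // size_polyN size_polyX.
pose s := [seq i%:R : k | i <- iota 0 p].
have us : uniq s.
  rewrite map_inj_in_uniq ?iota_uniq // => i j; rewrite !mem_iota !add0n /= => ip jp.
  wlog ij : i j ip jp / (i <= j)%N => [W e|].
    by case: (leqP i j) => [/W->//|/ltnW/W<-].
  move/eqP; rewrite eq_sym -subr_eq0 -natrB // => /eqP/ubn; lia.
have [|bs] := boolP (b \in s); first by case/mapP => i _ ->; exists i.
have /max_poly_roots : P != 0 by rewrite -size_poly_gt0 sP.
move=> /(_ (b :: s)); rewrite /= bs us sP size_map size_iota ltnn.
have rP x : x ^+ p = x -> root P x by move=> xp; rewrite rootE !hornerE xp subrr.
rewrite rP //= => H; suff: false by []; apply: H => //; apply/allP => _ /mapP[i _ ->].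
by apply: rP; rewrite -(pFrobenius_autE pk) pFrobenius_aut_nat.
Qed.

Definition simple_root_mod (g : {poly int}) (n r : int) : bool :=
  (n %| g.[r])%Z && coprimez g^`().[r] n.

Lemma coprimez_dvd (m n x y : int) : (m %| n)%Z -> (n %| y - x)%Z ->
  coprimez x n -> coprimez y m.
Proof.
case/dvdzP=> c -> /dvdzP[e yx] /coprimezP[[u v] /= uv].
apply/coprimezP; exists (u, v * c - u * e * c) => /=.
have -> : y = x + e * (c * m) by rewrite -yx addrC subrK.
by apply: (etrans _ uv); ring.
Qed.

Lemma horner_taylor1 (g : {poly int}) (r x n : int) : (n %| x)%Z ->
  (n * x %| g.[r + x] - (g.[r] + g^`().[r] * x))%Z.
Proof.
case/dvdzP=> c ->; elim/poly_ind: g => [|g e IH].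
  by rewrite deriv0 !horner0 mul0r !(addr0, subr0) dvdz0.
rewrite derivD derivM derivX derivC mulr1 addr0 !(hornerD, hornerM, hornerX, hornerC).
have /dvdzP[q hq] := IH; apply/dvdzP.
exists (q * (r + c * n) + g^`().[r] * c).
have -> : g.[r + c * n] = q * (n * (c * n)) + (g.[r] + g^`().[r] * (c * n)) by rewrite -hq subrK.
by ring.
Qed.

Lemma dvdz_horner_sub (g : {poly int}) (x y n : int) : (n %| y - x)%Z ->
  (n %| g.[y] - g.[x])%Z.
Proof.
move=> h; have /factor_theorem[q hq] : root (g - g.[x]%:P) x by rewrite rootE !hornerE subrr.
have -> : g.[y] - g.[x] = q.[y] * (y - x).
  by have := congr1 (horner^~ y) hq; rewrite !hornerE.
exact: dvdz_mull.
Qed.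

(** If [p] divides [n] this is a Hensel step starting from [r]; otherwise [r] and [s] are glued by
    the Chinese remainder theorem. *)
Lemma lift_root (g : {poly int}) (n p : nat) (r s : int) :
    prime p -> simple_root_mod g n r -> simple_root_mod g p s ->
  exists t : int, [/\ simple_root_mod g (n * p)%N t, (n %| t - r)%Z &
    ~~ (p %| n)%N -> (p %| t - s)%Z].
Proof.
move=> pp /andP[nr cr] /andP[ps cs].
have conc t : (n %| t - r)%Z -> (p %| g^`().[t] - g^`().[s])%Z \/ (p %| n)%N ->
    coprimez g^`().[t] (n * p)%N.
  move=> tr h; rewrite PoszM coprimezMr; apply/andP; split.
    by apply: coprimez_dvd cr; rewrite // dvdz_horner_sub.
  case: h => [h|pn]; first exact: coprimez_dvd cs.
  by apply: coprimez_dvd cr; rewrite ?dvdz_horner_sub // dvdzE.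
have [pn|pn] := boolP (p %| n)%N.
  have /dvdzP[c hc] := nr.
  have cp : coprimez g^`().[r] p.
    by apply: coprimez_dvd cr; rewrite ?subrr ?dvdz0 // dvdzE.
  have /coprimezP[[u v] /= uv] := cp.
  have nx : (n %| - (c * u * n%:Z))%Z by rewrite rpredN dvdz_mull.
  exists (r - c * u * n%:Z).
  have tr : (n %| r - c * u * n%:Z - r)%Z by rewrite addrAC subrr add0r.
  split=> //; rewrite /simple_root_mod conc ?andbT; auto.
  have := horner_taylor1 g r nx; rewrite hc => /dvdzP[q].
  have /dvdzP[w hw] : (p%:Z %| n%:Z)%Z by rewrite dvdzE.
  set y := g.[_] => /eqP; rewrite subr_eq => /eqP ->; rewrite PoszM.
  apply/dvdzP; exists (- q * c * u * w + c * v).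
  transitivity (- q * c * u * n%:Z * n%:Z + c * n%:Z * (1 - u * g^`().[r])); first by ring.
  by rewrite -uv {2}hw; ring.
have cnp : coprimez n p by rewrite coprimezE /= coprime_sym prime_coprime.
have /coprimezP[[u v] /= uv] := cnp.
(* As [u * n + v * p = 1], the point [r + u * n * (s - r)] is [r] modulo [n] and [s] modulo [p]. *)
have tr : (n %| r + u * n%:Z * (s - r) - r)%Z.
  by rewrite addrAC subrr add0r mulrAC dvdz_mull.
have ts : (p %| r + u * n%:Z * (s - r) - s)%Z.
  have -> : r + u * n%:Z * (s - r) - s = v * (r - s) * p.
    have -> : r + u * n%:Z * (s - r) - s = (r - s) * (1 - u * n%:Z) by ring.
    by rewrite -uv; ring.
  exact: dvdz_mull.
exists (r + u * n%:Z * (s - r)); split=> //; rewrite /simple_root_mod.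
rewrite conc ?andbT //; last by left; apply: dvdz_horner_sub.
rewrite PoszM Gauss_dvdz //; apply/andP; split.
  by rewrite -(subrK g.[r] g.[_]) rpredD // dvdz_horner_sub.
by rewrite -(subrK g.[s] g.[_]) rpredD // dvdz_horner_sub.
Qed.

(** Induction on [n], removing one prime factor at a time. Simplicity of the roots is carried along
    because [lift_root] requires it. *)
Lemma simple_roots_mod (g : {poly int}) (p1 : nat) :
    (forall p, prime p -> (p1 <= p)%N -> exists r s : int,
      [/\ simple_root_mod g p r, simple_root_mod g p s & coprimez (s - r) p]) ->
  forall n, (0 < n)%N -> (forall p, prime p -> (p %| n)%N -> (p1 <= p)%N) ->
    exists r s : int, [/\ simple_root_mod g n r, simple_root_mod g n s &
      coprimez (s - r) n].
Proof.
move=> hp; elim/ltn_ind=> n IH n0 hn.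
have [n1|n1] := leqP n 1.
  have -> : n = 1%N by lia.
  by exists 0, 0; rewrite /simple_root_mod !dvd1z !coprimezE /= !coprimen1.
have pp := pdiv_prime n1; have pn := pdiv_dvd n; move: (pdiv n) pp pn => p pp pn.
have /dvdnP[m nm] := pn; have p_gt1 := prime_gt1 pp.
have m0 : (0 < m)%N by move: n0; rewrite nm muln_gt0 => /andP[].
have [||r [s [hr hs rs]]] := IH m _ m0; first by nia.
  by move=> q qq qm; apply: hn => //; rewrite nm dvdn_mulr.
have [r1 [s1 [hr1 hs1 rs1]]] := hp p pp (hn p pp pn).
have [r2 [hr2 rm2 rp2]] := lift_root pp hr hr1.
have [s2 [hs2 sm2 sp2]] := lift_root pp hs hs1.
exists r2, s2; rewrite nm; split=> //.
have sub k a b c d : (k %| a - b)%Z -> (k %| c - d)%Z -> (k %| (a - c) - (b - d))%Z.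
  move=> ab cd; have -> : (a - c) - (b - d) = (a - b) - (c - d) by ring.
  exact: rpredB.
have c1 : coprimez (s2 - r2) m by apply: coprimez_dvd rs; [|apply: sub].
rewrite PoszM coprimezMr c1 /=; have [pm|pm] := boolP (p %| m)%N.
  by apply: coprimez_dvd c1; rewrite ?subrr ?dvdz0 // dvdzE.
by apply: coprimez_dvd rs1 => //; apply: sub; auto.
Qed.

(** All roots of [g] in characteristic [p] lie in the prime field. They are simple, since a common
    root with [g^]()[would make]p[divide the norm of]g^[()]. As [g] has degree at least 2, there are
    two of them. *)
Lemma simple_roots_mod_prime d (g : {poly int}) p : g \is monic -> size g = d.+3 ->
    prime p -> ~~ (p %| poly_norm d.+1 g g^`())%Z ->
    (forall (k : closedFieldType) (b : k), p \in [pchar k] ->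
       (map_poly intr g).[b] = 0 -> b ^+ p = b) ->
  exists r s : int, [/\ simple_root_mod g p r, simple_root_mod g p s & coprimez (s - r) p].
Proof.
move=> gm sg pp pN hk; have [k pk] := Fp_algebraic_closure pp.
have gkm : (map_poly intr g : {poly k}) \is monic by apply: (monic_map _ gm).
have sgk : size (map_poly intr g : {poly k}) = d.+3.
  by rewrite size_map_poly_id0 ?sg // (monicP gm) oner_eq0.
have [rs] := closed_field_poly_normal (map_poly intr g : {poly k}).
rewrite (monicP gkm) scale1r => grs.
have : size rs = d.+2 by move: sgk; rewrite grs size_prod_XsubC => -[].
case: rs grs => [|b1 [|b2 rs]] // grs _.
have gb b : b \in [:: b1, b2 & rs] -> (map_poly intr g : {poly k}).[b] = 0.
  by move=> hb; apply/eqP; rewrite -rootE grs root_prod_XsubC.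
have g1 : (map_poly intr g : {poly k}).[b1] = 0 by rewrite gb ?inE ?eqxx.
have g2 : (map_poly intr g : {poly k}).[b2] = 0 by rewrite gb ?inE ?eqxx ?orbT.
have dg b : (map_poly intr g : {poly k}).[b] = 0 -> (map_poly intr g^`() : {poly k}).[b] != 0.
  by move=> gb0; apply: contra pN => /eqP; apply: (poly_norm_pchar gm sg pk gb0).
have b12 : b1 != b2.
  apply/eqP => b12; have := dg b1 g1.
  rewrite -deriv_map grs -b12 !big_cons !derivM !(hornerD, hornerM, hornerN, hornerX, hornerC).
  by rewrite subrr !(mul0r, mulr0, addr0) eqxx.
have [i hi] := expf_pchar_eq_nat pk (hk k b1 pk g1).
have [j hj] := expf_pchar_eq_nat pk (hk k b2 pk g2).
have red h (l : nat) : (map_poly intr h : {poly k}).[l%:R] = (h.[l%:Z])%:~R.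
  by rewrite -[RHS]horner_map.
have cop (z : int) : (z%:~R != 0 :> k) -> coprimez z p.
  move=> z0; rewrite coprimezE /= coprime_sym prime_coprime //.
  by apply: contra z0; rewrite -(dvdz_pcharf pk) dvdzE.
have root (l : nat) : (map_poly intr g : {poly k}).[l%:R] = 0 -> simple_root_mod g p l.
  move=> gl; rewrite /simple_root_mod (dvdz_pcharf pk) -red gl eqxx /=.
  by apply: cop; rewrite -red dg.
exists i, j; split; first by apply: root; rewrite -hi.
  by apply: root; rewrite -hj.
by apply: cop; rewrite rmorphB /= -!pmulrn -hi -hj subr_eq0 eq_sym.
Qed.

(** * Kronecker's theorem *)

Lemma harmonic_ge (t : nat) : t%:R / 2 <= \sum_(i < 2 ^ t) (i.+1%:R)^-1 :> rat.
Proof.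
elim: t => [|t IH]; first by rewrite mul0r sumr_ge0 // => i _; rewrite invr_ge0.
have -> : \sum_(i < 2 ^ t.+1) (i.+1%:R)^-1 = \sum_(i < 2 ^ t) (i.+1%:R)^-1 +
    \sum_(i < 2 ^ t) ((2 ^ t + i).+1%:R)^-1 :> rat.
  by rewrite expnS mul2n -addnn big_split_ord.
rewrite -addn1 natrD mulrDl lerD //.
have -> : 1 / 2 = \sum_(i < 2 ^ t) ((2 ^ t.+1)%N%:R)^-1 :> rat.
  rewrite sumr_const card_ord -[RHS]mulr_natl expnS natrM invfM mulrCA divff ?mulr1 ?mul1r //.
  by rewrite pnatr_eq0 expn_eq0.
apply: ler_sum => i _; rewrite lef_pV2 ?posrE ?ltr0n ?expn_gt0 // ler_nat expnS.
by have := ltn_ord i; lia.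
Qed.

(** Pigeonhole: there are [(H + 1) ^ D] polynomials with coefficients in [[0, H]] and at most
    [H ^ D] pairs of residues. The witness is the difference of two polynomials with the same
    residues. *)
Lemma small_poly_dvd (D H a b : nat) (r s : int) :
    (0 < D)%N -> (0 < a)%N -> (0 < b)%N -> (a * b <= H ^ D)%N ->
  exists h : {poly int}, [/\ h != 0, (size h <= D)%N, forall i, `|h`_i| <= H%:Z,
    (a %| h.[r])%Z & (b %| h.[s])%Z].
Proof.
case: a b => [|a] // [|b] // D0 _ _ abH.
pose P (u : {ffun 'I_D -> 'I_H.+1}) : {poly int} :=
  \poly_(i < D) (oapp (fun j => (u j : nat)%:Z) 0 (insub i)).
have PE u (i : 'I_D) : (P u)`_i = u i.
  by rewrite coef_poly ltn_ord valK.
pose f u : 'I_a.+1 * 'I_b.+1 :=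
  (inord `|((P u).[r] %% a.+1)%Z|, inord `|((P u).[s] %% b.+1)%Z|).
have [/injectiveP/leq_card|/injectivePn[u [v uv fuv]]] := boolP (injectiveb f).
  rewrite card_prod card_ffun !card_ord => le; have := leq_trans le abH.
  by rewrite leqNgt ltn_exp2r ?ltnSn.
have mod_inj (m : nat) (x y : int) : inord `|(x %% m.+1)%Z| = inord `|(y %% m.+1)%Z| :> 'I_m.+1 ->
    (m.+1 %| x - y)%Z.
  have lt z : (`|(z %% m.+1)%Z| < m.+1)%N by have := ltz_pmod z (isT : 0 < m.+1%:Z);
    have := modz_ge0 z (isT : m.+1%:Z != 0); lia.
  move=> /(congr1 val); rewrite /= !inordK // => e.
  rewrite -eqz_mod_dvd; apply/eqP.
  by have := modz_ge0 x (isT : m.+1%:Z != 0); have := modz_ge0 y (isT : m.+1%:Z != 0); lia.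
exists (P u - P v); split.
- apply: contraNneq uv => /eqP; rewrite subr_eq0 => /eqP e; apply/eqP/ffunP => i.
  by apply/val_inj/eqP; rewrite -eqz_nat -!PE e.
- by rewrite (leq_trans (size_polyD _ _)) // geq_max size_polyN !size_poly.
- move=> i; rewrite coefB; have [iD|iD] := ltnP i D; last by rewrite !coef_poly ltnNge iD.
  have /= -> := PE u (Ordinal iD); have /= -> := PE v (Ordinal iD).
  have aux (x y : nat) : (x < H.+1)%N -> (y < H.+1)%N -> (`|x%:Z - y%:Z| <= H)%N by lia.
  by rewrite -abszE lez_nat; apply: aux; apply: ltn_ord.
- by rewrite hornerD hornerN mod_inj //; case: fuv.
- by rewrite hornerD hornerN mod_inj //; case: fuv.
Qed.

(* If [(a, b)] and [(a', b')] share the product [n] and the polynomial [h], then *)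
(* [lcm a a' * lcm b b'] divides the norm [c * n]; its excess over [n] divides   *)
(* both [c] and a power of [n], so it is trivial.                               *)
Lemma factorization_unique d (g h : {poly int}) (r s : int) (a b a' b' c M : nat) :
    g \is monic -> size g = d.+3 -> (a * b = a' * b')%N -> (0 < a * b)%N ->
    ((a * b)%N %| g.[r])%Z -> ((a * b)%N %| g.[s])%Z -> coprimez (s - r) (a * b)%N ->
    (a %| h.[r])%Z -> (b %| h.[s])%Z -> (a' %| h.[r])%Z -> (b' %| h.[s])%Z ->
    `|poly_norm d.+1 g h|%N = (c * (a * b))%N -> (c %| M)%N -> coprime (a * b) M ->
  (a' %| a)%N.
Proof.
move=> gm sg ab ab0 gr gs cop har hbs har' hbs' nc cM copM.
set A := lcmn a a'; set B := lcmn b b'.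
have An : (A %| a * b)%N by rewrite dvdn_lcm dvdn_mulr // ab dvdn_mulr.
have Bn : (B %| a * b)%N by rewrite dvdn_lcm dvdn_mull // ab dvdn_mull.
have hA : (A %| h.[r])%Z by have := dvdz_lcm a a' h.[r]; rewrite har har'.
have hB : (B %| h.[s])%Z by have := dvdz_lcm b b' h.[s]; rewrite hbs hbs'.
have copAB : coprimez (A%:Z * B%:Z) (s - r).
  rewrite coprimezMl !(coprimez_sym _ (s - r)); apply/andP; split.
    exact: (coprimez_dvdr (An : (A%:Z %| (a * b)%N%:Z)%Z) cop).
  exact: (coprimez_dvdr (Bn : (B%:Z %| (a * b)%N%:Z)%Z) cop).
have := @poly_norm_dvd d g h r s A B (a * b)%N gm sg An Bn gr gs hA hB copAB.
rewrite dvdzE abszM /= nc => ABc.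
have [u hu] := dvdnP (dvdn_lcml a a' : (a %| A)%N).
have [v hv] := dvdnP (dvdn_lcml b b' : (b %| B)%N).
have uvc : (u * v %| c)%N.
  by move: ABc; rewrite hu hv mulnACA dvdn_pmul2r.
have : coprime (u * v) M.
  apply: (@coprime_dvdl _ (A * B)); first by rewrite hu hv mulnACA dvdn_mulr.
  by rewrite coprimeMl (coprime_dvdl An copM) (coprime_dvdl Bn copM).
rewrite /coprime (gcdn_idPl (dvdn_trans uvc cM)) muln_eq1 => /andP[/eqP u1 _].
have -> : a = A by rewrite hu u1 mul1n.
exact: dvdn_lcmr.
Qed.

Lemma shift_range (H : nat) (x : int) : `|x| <= H%:Z -> (`|(x + H%:Z)%R|%N < (2 * H).+1)%N.
Proof. by rewrite -abszE lez_nat; lia. Qed.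

Lemma shift_inj (H : nat) (x y : int) : `|x| <= H%:Z -> `|y| <= H%:Z ->
  `|(x + H%:Z)%R|%N = `|(y + H%:Z)%R|%N -> x = y.
Proof. by rewrite -!abszE !lez_nat; lia. Qed.

(* Each pair [(a, b)] with [a], [b] prime to [M] and [a * b] of order [H ^ D] yields *)
(* a polynomial with coefficients at most [H], whose norm is then a bounded multiple *)
(* of [a * b].  There are about [H ^ D * log H] pairs and only [O(H ^ D)] such       *)
(* polynomials.                                                                     *)
Lemma two_roots_absurd d (g : {poly int}) (p1 : nat) : g \is monic -> size g = d.+3 ->
    (forall h : {poly int}, h != 0 -> (size h <= d.+2)%N -> poly_norm d.+1 g h != 0) ->
    (forall n, (0 < n)%N -> (forall p, prime p -> (p %| n)%N -> (p1 <= p)%N) ->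
       exists r s : int, [/\ (n %| g.[r])%Z, (n %| g.[s])%Z & coprimez (s - r) n]) ->
  False.
Proof.
move=> gm sg nz roots.
have [C hC] := poly_norm_bound d.+1 g.
(* An integer prime to [M] has only prime factors above [p1], and every positive integer up to
   [2 * C] divides [M]. The latter applies to the cofactors [c x] below. *)
pose M := (p1 + 2 * C).+1 `!; have M0 : (0 < M)%N by rewrite fact_gt0.
have roots' n : exists rs : int * int, (0 < n)%N -> coprime n M ->
    [/\ (n %| g.[rs.1])%Z, (n %| g.[rs.2])%Z & coprimez (rs.2 - rs.1) n].
  have [[n0 nM]|nn] := pselect ((0 < n)%N /\ coprime n M); last by exists 0; tauto.
  have [|r [s rsP]] := roots n n0; last by exists (r, s).
  move=> p pp pn; rewrite leqNgt; apply/negP => pp1.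
  have := coprime_dvdl pn nM; rewrite prime_coprime // /M dvdn_fact //.
  by rewrite prime_gt0 //=; lia.
have [rs hrs] := choice roots'.
pose D := d.+2.
(* [Q] is the bound that counting will put on the harmonic sum of length [J]; by [harmonic_ge] that
   sum is at least [Q.+1]. *)
pose Q := (2 * M ^ 2 * 3 ^ D * (2 * C).+1)%N.
pose J := (2 ^ (2 * Q.+1))%N.
(* Each [2 * M * (1 + M * i)] divides [H], so that the quotients [X i] are exact. *)
pose H := (2 * M * \prod_(i < J) (1 + M * i))%N.
have H0 : (0 < H)%N by rewrite /H muln_gt0 prodn_gt0 // andbT muln_gt0.
pose X (i : 'I_J) := (H ^ D %/ (2 * M * (1 + M * i)))%N.
have XE i : (X i * (2 * M * (1 + M * i)))%N = (H ^ D)%N.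
  rewrite divnK // (@dvdn_trans H) ?dvdn_exp //.
  by rewrite /H (bigD1 i) //= mulnA dvdn_mulr.
pose I := {i : 'I_J & 'I_(X i)}.
pose a (x : I) := (1 + M * tag x)%N.
(* With the offset running below [X i], [b] lies between [M * X i] and [2 * M * X i], which puts
   [a * b] between [H ^ D / 2] and [H ^ D]. *)
pose b (x : I) := (1 + M * (X (tag x) + tagged x))%N.
have a0 x : (0 < a x)%N by [].
have b0 x : (0 < b x)%N by [].
have ab_le x : (a x * b x <= H ^ D)%N.
  case: x => i l; rewrite -(XE i) /a /b /= mulnA [leqRHS]mulnC leq_mul2l; apply/orP; right.
  by move: (X i) (nat_of_ord l) (ltn_ord l); clear -M0; nia.
have ab_ge x : (H ^ D <= 2 * (a x * b x))%N.
  case: x => i l; rewrite -(XE i) /a /b /= mulnA [leqLHS]mulnC [leqRHS]mulnCA leq_mul2l;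
    apply/orP; right.
  by move: (X i) (nat_of_ord l) (ltn_ord l); clear -M0; nia.
have cop k : coprime (1 + M * k) M.
  by rewrite -coprime_modl addnC mulnC modnMDl coprime_modl coprime1n.
have abM x : coprime (a x * b x) M by rewrite coprimeMl !cop.
have ab0 x : (0 < a x * b x)%N by [].
pose r x := (rs (a x * b x)%N).1; pose s x := (rs (a x * b x)%N).2.
have /choice[h hP] : forall x : I, exists h : {poly int},
    [/\ h != 0, (size h <= D)%N, forall i, `|h`_i| <= H%:Z,
    (a x %| h.[r x])%Z & (b x %| h.[s x])%Z].
  by move=> x; apply: small_poly_dvd.
pose c x := (`|poly_norm d.+1 g (h x)| %/ (a x * b x))%N.
have cE x : `|poly_norm d.+1 g (h x)|%N = (c x * (a x * b x))%N.
  have [_ _ _ ha hb] := hP x; have [gr gs cp] := hrs _ (ab0 x) (abM x).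
  rewrite divnK //; have := @poly_norm_dvd d g (h x) (r x) (s x) (a x) (b x)
    (a x * b x)%N gm sg (dvdn_mulr _ (dvdnn _)) (dvdn_mull _ (dvdnn _)) gr gs ha hb.
  by rewrite -PoszM coprimez_sym dvdzE; apply.
have c0 x : (0 < c x)%N.
  have [hn0 sh _ _ _] := hP x; have := nz _ hn0 sh.
  by rewrite -absz_gt0 cE muln_gt0 => /andP[].
have c_le x : (c x <= 2 * C)%N.
  have [_ sh hH _ _] := hP x; have := hC H (h x) sh hH.
  rewrite -abszE lez_nat cE => le1.
  have := leq_trans le1 (leq_mul (leqnn C) (ab_ge x)).
  by rewrite [leqRHS]mulnA leq_pmul2r // mulnC.
have cM x : (c x %| M)%N by rewrite dvdn_fact // c0 /=; have := c_le x; lia.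
pose F x : {ffun 'I_D -> 'I_(2 * H).+1} * 'I_(2 * C).+1 :=
  ([ffun i : 'I_D => inord `|((h x)`_i + H%:Z)%R|%N], inord (c x)).
have half x y : h x = h y -> (a x * b x = a y * b y)%N -> (a y %| a x)%N.
  move=> hxy nxy; have [_ _ _ har hbs] := hP x; have [_ _ _ har' hbs'] := hP y.
  have [gr gs cp] := hrs _ (ab0 x) (abM x).
  have rxy : r x = r y by rewrite /r nxy.
  have sxy : s x = s y by rewrite /s nxy.
  rewrite -hxy -rxy in har'; rewrite -hxy -sxy in hbs'.
  exact: (factorization_unique gm sg nxy (ab0 x) gr gs cp har hbs har' hbs' (cE x)).
(* Equal polynomials and equal cofactors have equal norms, hence equal products [a * b]; then
   [factorization_unique], used in both directions, gives equal [a]. *)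
have Finj : injective F.
  move=> x y [/ffunP eh /(congr1 val)]; rewrite /= !inordK ?ltnS // => ec.
  have [_ sx hx _ _] := hP x; have [_ sy hy _ _] := hP y.
  have hxy : h x = h y.
    apply/polyP => i; have [iD|iD] := ltnP i D; last first.
      by rewrite !nth_default // (leq_trans _ iD).
    have /(congr1 val) := eh (Ordinal iD); rewrite !ffunE /=.
    by rewrite !inordK ?shift_range //; apply: shift_inj.
  have nxy : (a x * b x = a y * b y)%N.
    have := cE x; rewrite hxy ec cE => /eqP.
    by rewrite eqn_pmul2l ?c0 // => /eqP.
  have axy : a x = a y by apply/eqP; rewrite eqn_dvd !half.
  move: (nxy); rewrite axy => /eqP; rewrite eqn_pmul2l // => /eqP bxy.
  move: axy bxy; clear -M0; case: x => i l; case: y => i' l'.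
  rewrite /a /b /= => /eqP; rewrite !eqn_add2l eqn_pmul2l // => /eqP/val_inj ii.
  case: _ / ii l' => l' /eqP; rewrite !eqn_add2l eqn_pmul2l // eqn_add2l => /eqP/val_inj ->.
  by [].
have := leq_card F Finj; rewrite card_prod card_ffun !card_ord card_tagged.
rewrite sumnE big_map big_enum /=.
under eq_bigr do rewrite card_ord.
move=> le1.
have le2 : (\sum_i X i <= (3 * H) ^ D * (2 * C).+1)%N.
  by apply: leq_trans le1 _; rewrite leq_mul2r leq_exp2r ?orbT //; lia.
have HD : 0 < (H ^ D)%N%:R :> rat by rewrite ltr0n expn_gt0 H0.
(* Since [1 + M * i <= M * i.+1], each [X i] is at least [H ^ D / (2 * M ^ 2 * i.+1)]. *)
have : \sum_(i < J) (i.+1%:R)^-1 <= Q%:R :> rat.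
  have {}le2 : (2 * M ^ 2 * \sum_i X i)%N%:R <= (H ^ D * Q)%N%:R :> rat.
    rewrite ler_nat (_ : (H ^ D * Q = 2 * M ^ 2 * ((3 * H) ^ D * (2 * C).+1))%N).
      by rewrite leq_mul2l le2 orbT.
    by rewrite /Q expnMn; move: (H ^ D)%N (3 ^ D)%N (M ^ 2)%N => u1 u2 u3; ring.
  rewrite -(ler_pM2l HD) -natrM; apply: le_trans le2.
  rewrite natrM natr_sum !mulr_sumr; apply: ler_sum => i _.
  rewrite ler_pdivrMr ?ltr0n // -!natrM ler_nat -(XE i).
  by move: (X i) => x; clear -M0; nia.
apply/negP; rewrite -ltNge; apply: lt_le_trans (harmonic_ge _).
by rewrite natrM [2 * _]mulrC mulfK // ltr_nat.
Qed.

Lemma poly_norm_bad_prime d (g h : {poly int}) (k : closedFieldType) (p : nat) (b : k) :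
    g \is monic -> size g = d.+2 -> poly_norm d g h != 0 -> p \in [pchar k] ->
    (`|poly_norm d g h| < p)%N -> (map_poly intr g).[b] = 0 ->
  (map_poly intr h).[b] != 0.
Proof.
move=> gm sg nz pk lt gb; apply/negP => /eqP hb.
have := poly_norm_pchar gm sg pk gb hb; rewrite dvdzE /= => /dvdn_leq.
by rewrite absz_gt0 nz => /(_ isT); rewrite leqNgt lt.
Qed.

Section Kronecker.
Variables (E : numFieldType) (x : E).
Local Notation zmap k := (map_poly (intmul 1 : int -> k)).

Section Scaling.
Variables (c : int) (f : {poly int}).

(** This is [c ^ m * f] rewritten as a polynomial in the scaled variable [c * y]. Used with [c] the
    leading coefficient of a minimal polynomial of [x], it leads to a monic polynomial with root
    [c * x]. *)
Definition scale_root m : {poly int} := \poly_(i < size f) (f`_i * c ^+ (m - i)).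

Lemma scale_rootE (k : comNzRingType) m (y : k) : (size f <= m.+1)%N ->
  (zmap k (scale_root m)).[c%:~R * y] = c%:~R ^+ m * (zmap k f).[y].
Proof.
move=> sf; rewrite !(@horner_coef_wide _ (size f)) ?(leq_trans (size_poly _ _)) ?size_poly //.
rewrite mulr_sumr; apply: eq_bigr => i _; rewrite !coef_map /= coef_poly ltn_ord.
have im : (i <= m)%N by rewrite -ltnS (leq_trans (ltn_ord i)).
rewrite rmorphM rmorphXn /= exprMn -{2}(subnK im) exprD; ring.
Qed.

End Scaling.

(** If [x] is transcendental, any [a] with [s(a)] nonzero is an admissible specialization, and not
    all of these satisfy [a ^+ p = a]. If [x] has degree at least 2, all large primes give two
    simple roots of the monic polynomial of a multiple of [x], against [two_roots_absurd]. *)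
Theorem kronecker (s : {poly int}) (p0 : nat) : (zmap E s).[x] != 0 ->
    (forall (p : nat) (k : closedFieldType) (a : k), prime p -> (p0 < p)%N -> p \in [pchar k] ->
      (forall f : {poly int}, (zmap E f).[x] = 0 -> (zmap k f).[a] = 0) ->
      (zmap k s).[a] != 0 -> a ^+ p = a) ->
  exists q : rat, x = ratr q.
Proof.
move=> sx hp.
have [[f0 f0P]|tr] := pselect (exists f : {poly int}, f != 0 /\ (zmap E f).[x] = 0); last first.
  have s0 : s != 0 by apply: contraNneq sx => ->; rewrite rmorph0 horner0.
  have [p pgt pp] := prime_above (p0 + `|lead_coef s|)%N.
  have [k pk] := Fp_algebraic_closure pp.
  have sk : zmap k s != 0.
    apply: contraTneq pgt => /(congr1 (fun f : {poly k} => f`_(size s).-1)).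
    rewrite coef0 coef_map -lead_coefE => /eqP; rewrite -(dvdz_pcharf pk) dvdzE /=.
    by move=> /dvdn_leq; rewrite absz_gt0 lead_coef_eq0 s0 => /(_ isT) le;
      rewrite -leqNgt (leq_trans le) ?leq_addl.
  have XpX : 'X^p - 'X != 0 :> {poly k}.
    rewrite -size_poly_gt0 size_polyDl size_polyXn // size_polyN size_polyX ltnS.
    exact: prime_gt1.
  (* A point outside the roots of [X^p - X] and of [s] contradicts the hypothesis. *)
  have /closed_nonrootP[a] : ('X^p - 'X) * zmap k s != 0 by rewrite mulf_neq0.
  rewrite rootM negb_or !rootE !hornerE subr_eq0 => /andP[/negP ap sa].
  case: ap; apply/eqP; apply: hp sa => //; first by lia.
  move=> f fx; have -> : f = 0 by apply: contra_notP tr => /eqP f0; exists f.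
  by rewrite rmorph0 horner0.
have : exists n, `[< exists f : {poly int}, [/\ f != 0, size f = n & (zmap E f).[x] = 0] >].
  by exists (size f0); apply/asboolP; exists f0; case: f0P.
case/ex_minnP => n /asboolP[f [fN0 <- fx]] {f0 f0P} nmin.
have fmin (v : {poly int}) : v != 0 -> (size v < size f)%N -> (zmap E v).[x] != 0.
  move=> v0; rewrite ltnNge; apply: contra => /eqP vx; apply: nmin.
  by apply/asboolP; exists v.
clear n nmin; set c := lead_coef f.
have c0 : c != 0 by rewrite lead_coef_eq0.
have cE : c%:~R != 0 :> E by rewrite intr_eq0.
have [sf|[d sf]] : (size f <= 2)%N \/ (exists d, size f = d.+3).
  by case: (size f) => [|[|[|d]]]; [left|left|left|right; exists d].
  exists (- (f`_0)%:~R / c%:~R).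
  rewrite fmorph_div rmorphN /= !ratr_int; apply: (mulIf cE); rewrite divfK //.
  apply/eqP; rewrite -subr_eq0 opprK -[X in _ == X]fx; apply/eqP.
  have {}sf : size f = 2%N.
    apply/eqP; rewrite eqn_leq sf ltnNge /=; apply/negP => /size1_polyC fc.
    by move: fx c0; rewrite /c fc map_polyC hornerC lead_coefC => /eqP; rewrite intr_eq0 => ->.
  rewrite (@horner_coef_wide _ 2) ?(leq_trans (size_poly _ _)) ?sf //.
  rewrite !big_ord_recl big_ord0 !coef_map /= /c lead_coefE sf /bump /=; ring.
exfalso.
(* The monic polynomial with [g(c y) = c ^+ d.+1 * f(y)]: the leading term is split off because
   scaling it would need the exponent [-1] of [c]. *)
pose g := 'X^(d.+2) + scale_root c (\poly_(i < d.+2) (f`_i)%R) d.+1.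
have sg0 : (size (scale_root c (\poly_(i < d.+2) (f`_i)%R) d.+1) <= d.+2)%N.
  by rewrite (leq_trans (size_poly _ _)) // size_poly.
have sg : size g = d.+3 by rewrite size_polyDl ?size_polyXn // ltnS.
have gm : g \is monic.
  by rewrite monicE lead_coefDl ?lead_coefXn // size_polyXn ltnS.
have fE : f = c *: 'X^(d.+2) + \poly_(i < d.+2) (f`_i)%R.
  apply/polyP => i; rewrite coefD coefZ coefXn coef_poly.
  have [->|iN] := eqVneq i d.+2; first by rewrite ltnn /c lead_coefE sf addr0 mulr1.
  case: ltnP => id; first by rewrite mulr0 add0r.
  by rewrite mulr0 add0r nth_default // sf; lia.
have gE (k : comNzRingType) (y : k) : (zmap k g).[c%:~R * y] = c%:~R ^+ d.+1 * (zmap k f).[y].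
  rewrite rmorphD /= hornerD scale_rootE ?size_poly // {2}fE !rmorphD /= !hornerD.
  by rewrite map_polyZ /= !map_polyXn hornerZ !hornerXn exprMn [in RHS]mulrDr [in RHS]mulrA -exprSr.
pose z := c%:~R * x.
have gz : (zmap E g).[z] = 0 by rewrite gE fx mulr0.
have zmin (v : {poly int}) : v != 0 -> (size v <= d.+2)%N -> (zmap E v).[z] != 0.
  move=> v0 sv; have scX : size (c *: 'X : {poly int}) = 2%N by rewrite size_scale // size_polyX.
  have := fmin (v \Po (c *: 'X)); rewrite -size_poly_eq0 size_comp_poly2 // size_poly_eq0 sf ltnS.
  by move=> /(_ v0 sv); rewrite map_comp_poly horner_comp map_polyZ /= map_polyX hornerZ hornerX.
have nz (h : {poly int}) : h != 0 -> (size h <= d.+2)%N -> poly_norm d.+1 g h != 0.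
  by move=> h0 sh; apply: (@poly_norm_neq0 d.+1 g gm sg E z h) => //; apply: zmin.
have dg0 : poly_norm d.+1 g g^`() != 0.
  apply: nz; last by rewrite -ltnS -sg lt_size_deriv // -size_poly_gt0 sg.
  apply: contraTneq gm => /(congr1 (fun h : {poly int} => h`_d.+1)).
  rewrite coef_deriv coef0 monicE lead_coefE sg => /eqP.
  by rewrite -mulr_natr mulf_eq0 pnatr_eq0 orbF => /eqP ->.
pose S := scale_root c s (size s).
have S0 : poly_norm d.+1 g S != 0.
  apply: (@poly_norm_neq0 d.+1 g gm sg E z S) => //; rewrite scale_rootE //.
  by rewrite mulf_neq0 // expf_neq0.
pose p1 := (p0 + `|c| + `|poly_norm d.+1 g g^`()| + `|poly_norm d.+1 g S|).+1%N.
have roots p : prime p -> (p1 <= p)%N -> exists r r' : int,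
    [/\ simple_root_mod g p r, simple_root_mod g p r' & coprimez (r' - r) p]; last first.
  apply: (@two_roots_absurd d g p1) => // n n0 np.
  by have [r [r' [/andP[gr _] /andP[gr' _] rr']]] := simple_roots_mod roots n0 np; exists r, r'.
move=> pp pgt.
have [p0p cp gp Sp] : [/\ (p0 < p)%N, (`|c| < p)%N, (`|poly_norm d.+1 g g^`()| < p)%N &
    (`|poly_norm d.+1 g S| < p)%N].
  by move: pgt; rewrite /p1; move: `|c|%N `|_|%N `|_|%N => u1 u2 u3; split; lia.
have ndvd (y : int) : y != 0 -> (`|y| < p)%N -> ~~ (p %| y)%Z.
  move=> y0 yp; apply/negP; rewrite dvdzE /= => /dvdn_leq.
  by rewrite absz_gt0 y0 leqNgt yp => /(_ isT).
apply: (simple_roots_mod_prime gm sg pp); first exact: ndvd.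
move=> k b pk gb.
have ck : c%:~R != 0 :> k by rewrite -(dvdz_pcharf pk) ndvd.
have bE : b = c%:~R * (b / c%:~R) by rewrite mulrC divfK.
have fa : (zmap k f).[b / c%:~R] = 0.
  by apply/eqP; move/eqP: gb; rewrite {1}bE gE mulf_eq0 expf_eq0 (negPf ck) andbF.
rewrite bE exprMn -[X in X * _ = _](pFrobenius_autE pk) pFrobenius_aut_int; congr (_ * _).
apply: (hp p k _ pp p0p pk).
  (* By minimality of [f], some power of [c] times [h] is a multiple of [f], and [c] is nonzero in
     [k]. *)
  move=> h hx; apply/eqP; have := Pdiv.Idomain.divp_eq h f.
  have r0 : h %% f = 0.
    apply: contraTeq isT => rN0; have := fmin _ rN0; rewrite ltn_modp fN0 => /(_ isT).
    have := congr1 (fun v => (zmap E v).[x]) (Pdiv.Idomain.divp_eq h f).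
    rewrite /= map_polyZ rmorphD rmorphM /= !hornerE fx hx !mulr0 add0r => <-.
    by rewrite eqxx.
  rewrite r0 addr0 => /(congr1 (fun v => (zmap k v).[b / c%:~R]))/eqP.
  rewrite /= map_polyZ rmorphM /= !hornerE fa mulr0 mulf_eq0 rmorphXn /= expf_eq0.
  by rewrite (negPf ck) andbF.
have := poly_norm_bad_prime gm sg S0 pk Sp gb.
by rewrite {1}bE scale_rootE // mulf_eq0 negb_or => /andP[].
Qed.
End Kronecker.

(** * Chevalley's extension theorem *)

(* [e] embeds [R0] modulo its kernel, so polynomials over [R0] are measured by the *)
(* size of their image under [e].                                                *)
Section ChevalleyStep.
Variables (E : fieldType) (R0 : comNzRingType) (e : {rmorphism R0 -> E}) (x : E).
Implicit Types (f g h s : {poly R0}).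

Lemma truncate_kernel f : exists g,
  map_poly e g = map_poly e f /\ size g = size (map_poly e g).
Proof.
exists (take_poly (size (map_poly e f)) f).
have E1 : map_poly e (take_poly (size (map_poly e f)) f) = map_poly e f.
  apply/polyP => i; rewrite coef_map coef_take_poly /=; case: ltnP => [_|le].
    by rewrite coef_map.
  by rewrite rmorph0 nth_default.
split=> //; apply/eqP; rewrite eqn_leq size_poly andbT.
by rewrite E1 size_take_poly.
Qed.

Lemma pseudo_division g h :
    map_poly e g != 0 -> size g = size (map_poly e g) ->
  exists (k : nat) (q r : {poly R0}), (lead_coef g ^+ k)%:P * h = q * g + r /\
    (size (map_poly e r) < size (map_poly e g))%N.
Proof.
move=> g0 sg; exists (Pdiv.Ring.rscalp h g), (Pdiv.Ring.rdivp h g), (Pdiv.Ring.rmodp h g).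
split; first by rewrite mul_polyC Pdiv.ComRing.rdivp_eq.
rewrite -sg (leq_ltn_trans (size_poly _ _)) // Pdiv.Ring.ltn_rmodp.
by apply: contraNneq g0 => ->; rewrite rmorph0.
Qed.

Lemma lead_coef_neq0 g : map_poly e g != 0 -> size g = size (map_poly e g) ->
  e (lead_coef g) != 0.
Proof. by move=> g0 sg; rewrite lead_coefE sg -coef_map -lead_coefE lead_coef_eq0. Qed.

(** Truncating [h] to [g] makes the leading coefficient nonzero under [e], as pseudo-division
    requires. Since [Q] need not survive truncation, both polynomials are returned. *)
Lemma minimal_size (Q : {poly R0} -> Prop) :
    (exists2 h, Q h & map_poly e h != 0) ->
  exists g h, [/\ Q h, map_poly e g = map_poly e h, map_poly e g != 0,
    size g = size (map_poly e g) &
    forall h', Q h' -> (size (map_poly e h') < size g)%N -> map_poly e h' = 0].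
Proof.
case=> h0 Qh0 h0N0.
have : exists n, `[< exists h, [/\ Q h, map_poly e h != 0 & size (map_poly e h) = n] >].
  by exists (size (map_poly e h0)); apply/asboolP; exists h0.
case/ex_minnP => n /asboolP[h [Qh hN0 <-]] hmin.
have [g [gh sg]] := truncate_kernel h; exists g, h; split=> //; first by rewrite gh.
move=> h' Qh'; rewrite sg gh ltnNge; apply: contraNeq => h'N0.
by apply: hmin; apply/asboolP; exists h'.
Qed.

Lemma map_poly_kernel (k : fieldType) (phi : {rmorphism R0 -> k}) h :
  (forall y, e y = 0 -> phi y = 0) -> map_poly e h = 0 -> map_poly phi h = 0.
Proof.
move=> ke /polyP h0; apply/polyP => i; rewrite coef_map coef0 /=; apply: ke.
by have := h0 i; rewrite coef_map coef0.
Qed.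

(** If [x] is transcendental over the image of [R0], only a leading coefficient of [s] must survive.
    Otherwise let [f] be of minimal degree vanishing at [x]. A Bezout relation [u s + v f = c] with
    [c] a nonzero constant shows that [s] is nonzero at every root [d] of the image of [f], once the
    images of [c] and of the leading coefficient of [f] are nonzero. *)
Lemma chevalley_step s : (map_poly e s).[x] != 0 ->
  exists2 s0, e s0 != 0 & forall (k : closedFieldType) (phi : {rmorphism R0 -> k}),
    (forall y, e y = 0 -> phi y = 0) -> phi s0 != 0 ->
  exists2 d : k, (forall h, (map_poly e h).[x] = 0 -> (map_poly phi h).[d] = 0) &
    (map_poly phi s).[d] != 0.
Proof.
move=> sx; have sN0 : map_poly e s != 0 by apply: contraNneq sx => ->; rewrite horner0.
have [alg|tr] := pselect (exists2 h, (map_poly e h).[x] = 0 & map_poly e h != 0); last first.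
  have [g [gs sg]] := truncate_kernel s; rewrite -gs in sN0.
  exists (lead_coef g); first exact: lead_coef_neq0.
  move=> k phi ke pg.
  have gE : map_poly phi g = map_poly phi s.
    apply/eqP; rewrite -subr_eq0 -rmorphB; apply/eqP/(map_poly_kernel ke).
    by rewrite rmorphB /= gs subrr.
  have /closed_nonrootP[d] : map_poly phi s != 0.
    by rewrite -gE; apply: contraNneq pg => /polyP/(_ (size g).-1);
      rewrite coef_map coef0 lead_coefE => ->.
  rewrite rootE => ds; exists d => // h hx.
  have h0 : map_poly e h = 0 by apply: contra_notP tr => /eqP hN0; exists h.
  by rewrite (map_poly_kernel ke h0) horner0.
have [f [h [hx fh fN0 sf fmin]]] := minimal_size alg.
have fx : (map_poly e f).[x] = 0 by rewrite fh.
have lf := lead_coef_neq0 fN0 sf.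
(* The ideal generated by [s] and [f]; its element [g] of least degree plays the part of their
   gcd. *)
pose Q h := exists u v, h = u * s + v * f.
have [|g [h' [[u [v ->]] gE gN0 sg gmin]]] := @minimal_size Q.
  by exists s => //; exists 1, 0; rewrite mul1r mul0r addr0.
have lg := lead_coef_neq0 gN0 sg.
have gdiv h0 : Q h0 -> exists (k : nat) (q : {poly R0}),
    (e (lead_coef g) ^+ k)%:P * map_poly e h0 = map_poly e q * map_poly e g.
  case=> u0 [v0 h0E]; have [k [q [r [hqr rg]]]] := pseudo_division h0 gN0 sg.
  exists k, q; have := congr1 (map_poly e) hqr.
  rewrite !rmorphM rmorphD rmorphM /= map_polyC /= rmorphXn /= => ->.
  suff -> : map_poly e r = 0 by rewrite addr0.
  pose c := (lead_coef g ^+ k)%:P : {poly R0}.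
  have rE : map_poly e r = map_poly e ((c * u0 - q * u) * s + (c * v0 - q * v) * f).
    have -> : (c * u0 - q * u) * s + (c * v0 - q * v) * f = c * h0 - q * (u * s + v * f).
      by rewrite h0E; ring.
    by rewrite /c hqr rmorphB rmorphD !(rmorphM _ q) /= gE addrAC subrr add0r.
  by rewrite rE; apply: gmin; [exists (c * u0 - q * u), (c * v0 - q * v)|rewrite -rE sg].
have gx : (map_poly e g).[x] != 0.
  apply: contraNneq sx => gx; have [|k [q]] := gdiv s.
    by exists 1, 0; rewrite mul1r mul0r addr0.
  move/(congr1 (horner^~ x))/eqP; rewrite /= !hornerM gx mulr0 hornerC mulf_eq0.
  by rewrite expf_eq0 (negPf lg) andbF.
(* Otherwise [f], up to a constant, is [q g] with [q] of smaller degree. As [g(x)] is nonzero, [q]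
   vanishes at [x], against the minimality of [f]. *)
have sg1 : (size g <= 1)%N.
  rewrite leqNgt; apply/negP => sg2; have [|k [q qg]] := gdiv f.
    by exists 0, 1; rewrite mul1r mul0r add0r.
  have qx : (map_poly e q).[x] = 0.
    have /(congr1 (horner^~ x))/eqP := qg.
    by rewrite /= !hornerM fx mulr0 eq_sym mulf_eq0 (negPf gx) orbF => /eqP.
  have lgk : e (lead_coef g) ^+ k != 0 by rewrite expf_neq0.
  have qN0 : map_poly e q != 0.
    apply: contra_eq_neq qg => ->; rewrite mul0r mulf_eq0 polyC_eq0 (negPf lgk) /=.
    by rewrite (negPf fN0).
  have := congr1 (fun h : {poly E} => size h) qg.
  rewrite /= size_Cmul // size_mul // -sf -sg => szf.
  case/negP: qN0; apply/eqP/fmin => //; move: sg2; rewrite szf.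
  by move: (size g) (size (map_poly e q)) => a b; lia.
have gC := size1_polyC sg1; set c := g`_0 in gC.
exists (lead_coef f * c).
  by rewrite rmorphM mulf_neq0 //; move: lg; rewrite {1}gC lead_coefC.
move=> k phi ke; rewrite rmorphM mulf_eq0 negb_or => /andP[pf pc].
have sf1 : size (map_poly phi f) != 1%N.
  rewrite size_map_poly_id0 //; apply/eqP => /eqP;
    rewrite eq_sym eqn_leq => /andP[_ /size1_polyC fC].
  by move: fx lf; rewrite fC map_polyC hornerC lead_coefC => ->; rewrite eqxx.
have [d /rootP fd] := closed_rootP _ sf1.
exists d.
  move=> h0 h0x; have [m [q [r [hqr rf]]]] := pseudo_division h0 fN0 sf.
  have r0 : map_poly phi r = 0.
    apply: (map_poly_kernel ke); apply: fmin; last by rewrite sf.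
    have := congr1 (fun h => (map_poly e h).[x]) hqr.
    by rewrite /= rmorphD !rmorphM /= hornerD !hornerM h0x fx !mulr0 add0r.
  have := congr1 (fun h => (map_poly phi h).[d]) hqr.
  rewrite /= rmorphD !rmorphM /= r0 addr0 !hornerM fd mulr0 => /eqP.
  by rewrite mulf_eq0 map_polyC hornerC /= rmorphXn /= expf_eq0 (negPf pf) andbF => /eqP.
have : map_poly phi (g - (u * s + v * f)) = 0.
  by apply: (map_poly_kernel ke); rewrite rmorphB /= gE subrr.
move/(congr1 (horner^~ d))/eqP; rewrite rmorphB rmorphD !rmorphM /= horner0.
rewrite hornerD hornerN hornerD !hornerM fd mulr0 addr0 subr_eq0 gC map_polyC hornerC.
by apply: contraTneq => ->; rewrite mulr0.
Qed.
End ChevalleyStep.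

(** [R1] is an iterated polynomial ring over [R0], not its quotient inside [E]; this is why
    homomorphisms are required to kill the kernels of [e0] and [e1]. *)
Lemma chevalley_extension (E : fieldType) (xs : seq E) (R0 : comNzRingType)
    (e0 : {rmorphism R0 -> E}) :
  exists (R1 : comNzRingType) (i : {rmorphism R0 -> R1}) (e1 : {rmorphism R1 -> E}),
    [/\ forall y, e1 (i y) = e0 y, forall y, y \in xs -> exists z, e1 z = y &
      forall s, e1 s != 0 -> exists2 s0, e0 s0 != 0 &
        forall (k : closedFieldType) (phi0 : {rmorphism R0 -> k}),
          (forall y, e0 y = 0 -> phi0 y = 0) -> phi0 s0 != 0 ->
        exists phi1 : {rmorphism R1 -> k}, [/\ forall y, phi1 (i y) = phi0 y,
          forall y, e1 y = 0 -> phi1 y = 0 & phi1 s != 0]].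
Proof.
elim: xs R0 e0 => [|x xs IH] R0 e0.
  exists R0, idfun, e0; split=> // s s0; exists s => // k phi0 ke ps.
  by exists phi0.
pose ex : {rmorphism {poly R0} -> E} := horner_eval x \o map_poly e0.
have [R1 [i [e1 [e1i e1xs e1s]]]] := IH _ ex.
have exC y : ex y%:P = e0 y by rewrite /ex /= horner_evalE map_polyC hornerC.
exists R1, (i \o polyC), e1; split => [y|y|s s1].
- by rewrite /= e1i exC.
- rewrite inE => /predU1P[->|/e1xs //]; exists (i 'X).
  by rewrite e1i /ex /= horner_evalE map_polyX hornerX.
have [s' s'0 s'P] := e1s s s1.
have [s0 s00 s0P] := @chevalley_step _ _ e0 x s' s'0.
exists s0 => // k phi0 ke ps0; have [d kd sd] := s0P k phi0 ke ps0.
pose phi : {rmorphism {poly R0} -> k} := horner_eval d \o map_poly phi0.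
have [phi1 [p1i p1k p1s]] := s'P k phi kd sd.
exists phi1; split=> // y; rewrite /= p1i.
by rewrite /phi /= horner_evalE map_polyC hornerC.
Qed.

(** * Primes avoiding a finite set *)

Section GoodPrimes.
Variables (K : fieldType) (E : numFieldType) (iota : {rmorphism K -> E}).
Variables (S : {pred K}) (Q : set K -> Prop).
Hypotheses (S_fingen : fingen_Zalgebra S) (Q_almost_all : almost_all_primes S Q).

Let S_ring : GRing.subring_closed S := proj1 S_fingen.
Let S1 : 1 \in S. Proof. by case: S_ring. Qed.
Let SB : {in S &, forall x y, x - y \in S}. Proof. by case: S_ring. Qed.
Let SM : {in S &, forall x y, x * y \in S}. Proof. by case: S_ring. Qed.
Let S0 : 0 \in S. Proof. by rewrite -(subrr 1) SB. Qed.
Let SD : {in S &, forall x y, x + y \in S}.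
Proof. by move=> x y xS yS; rewrite -[y]opprK SB // -[- y]sub0r SB. Qed.
Let Snat n : n%:R \in S. Proof. by elim: n => // n IH; rewrite mulrS SD. Qed.

Lemma algebraic_iota (x : K) :
  algebraicOver (ratr : rat -> K) x <-> algebraicOver (ratr : rat -> E) (iota x).
Proof.
have ratr0 (F : unitRingType) : ratr 0 = 0 :> F by rewrite /ratr mul0r.
have E1 (p : {poly rat}) : map_poly iota (map_poly ratr p) = map_poly ratr p.
  apply/polyP => i; rewrite coef_map /= !coef_map_id0 ?ratr0 // /ratr.
  by rewrite fmorph_div !rmorph_int.
by split=> -[p p0 px]; exists p; rewrite // -?E1 ?fmorph_root // -(fmorph_root iota) E1.
Qed.

Lemma algebraic_part_sub (x y : K) :
  algebraic_part S x -> algebraic_part S y -> algebraic_part S (x - y).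
Proof.
move=> [xS /algebraic_iota xa] [yS /algebraic_iota ya]; split; first exact: SB.
by apply/algebraic_iota; rewrite rmorphB; apply: algebraic_sub.
Qed.

Lemma algebraic_part_mul (x y : K) :
  algebraic_part S x -> algebraic_part S y -> algebraic_part S (x * y).
Proof.
move=> [xS /algebraic_iota xa] [yS /algebraic_iota ya]; split; first exact: SM.
by apply/algebraic_iota; rewrite rmorphM; apply: algebraic_mul.
Qed.

Lemma algebraic_part_nat n : algebraic_part S n%:R.
Proof.
split; first exact: Snat.
by apply/algebraic_iota; rewrite rmorph_nat -(rmorph_nat (ratr : rat -> E)); apply: algebraic_id.
Qed.

(** A proper prime contains at most one rational prime, since two would generate 1. The finitely
    many exceptional [P] thus only affect finitely many [p]. *)
Lemma almost_all_large_primes : exists p0 : nat, forall (P : set K) (p : nat),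
  prime p -> (p0 < p)%N -> nonzero_prime (algebraic_part S) P -> P p%:R -> Q P.
Proof.
have /finite_seqP[bad badP] := Q_almost_all.
have /choice[b hb] : forall P : set K, exists b : nat,
    nonzero_prime (algebraic_part S) P -> forall p, prime p -> P p%:R -> (p <= b)%N.
  move=> P; have [[q [qp qP]]|none] := pselect (exists q, prime q /\ P q%:R); last first.
    by exists 0%N => _ p pp pP; case: none; exists p.
  exists q => Pprime p pp pP; rewrite leqNgt; apply/negP => qltp; apply: (prime_proper Pprime).
  have : coprime p q.
    by rewrite prime_coprime //; apply/negP => /dvdn_leq; rewrite prime_gt0 //; lia.
  case: (egcdnP q (prime_gt0 pp)) => u v uv _ /eqP cop.
  have -> : 1 = u%:R * p%:R - v%:R * q%:R :> K.
    by rewrite -!natrM uv cop natrD addrC addKr.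
  apply: (prime_subr Pprime); apply: (prime_mull Pprime) => //; exact: algebraic_part_nat.
exists (\sum_(P <- bad) b P)%N => P p pp p0p Pprime pP; apply: contrapT => nQ.
have Pbad : P \in bad by have : [set` bad] P by rewrite -badP.
by have := hb P Pprime p pp pP; move: p0p; rewrite (big_rem P Pbad) /=; lia.
Qed.

(* A homomorphism from [S] (extended to [x]) to a field of large characteristic, *)
(* whose kernel then meets [algebraic_part S] in a prime satisfying [Q].          *)
Lemma specialization (x : E) (s : K) : s \in S -> s != 0 ->
  exists (s0 : {poly int}) (p0 : nat), (map_poly intr s0).[x] != 0 /\
    forall (p : nat) (k : closedFieldType) (a : k), prime p -> (p0 < p)%N -> p \in [pchar k] ->
      (forall f : {poly int}, (map_poly intr f).[x] = 0 -> (map_poly intr f).[a] = 0) ->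
      (map_poly intr s0).[a] != 0 ->
    exists (P : set K) (R1 : comNzRingType) (e1 : {rmorphism R1 -> E}) (phi : {rmorphism R1 -> k}),
      [/\ Q P, forall y, e1 y = 0 -> phi y = 0,
          {in S, forall z, exists y, e1 y = iota z},
          exists2 y, e1 y = x & phi y = a &
          [/\ forall y, e1 y = iota s -> phi y != 0 &
              forall z, extended_power S P 1 z -> forall y, e1 y = iota z -> phi y = 0]].
Proof.
move=> sS s_neq0; have [_ [g [gS Sg]]] := S_fingen.
pose e0 : {rmorphism {poly int} -> E} := horner_eval x \o map_poly (intmul 1).
have [R1 [i [e1 [e1i e1g e1s]]]] := chevalley_extension (map iota g) e0.
have onto : {in S, forall z, exists y, e1 y = iota z}.
  pose T : {pred K} := [pred z | `[< exists y, e1 y = iota z >]].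
  suff ST : {subset S <= T} by move=> z /ST; rewrite inE.
  apply: Sg; last by move=> z zg; rewrite inE; apply/e1g/map_f.
  split=> [|a b|a b]; rewrite !inE.
  - by exists 1; rewrite !rmorph1.
  - by move=> [y hy] [z hz]; exists (y - z); rewrite !rmorphB hy hz.
  - by move=> [y hy] [z hz]; exists (y * z); rewrite !rmorphM hy hz.
have [st hst] := onto s sS.
have [|s0 s00 s0P] := e1s st; first by rewrite hst fmorph_eq0.
have [p0 p0P] := almost_all_large_primes.
exists s0, p0; split=> // p k a pp p0p pk ka sa.
pose phi0 : {rmorphism {poly int} -> k} := horner_eval a \o map_poly (intmul 1).
have [phi [phi_i ker phis]] := s0P k phi0 ka sa.
have inj y z : e1 y = e1 z -> phi y = phi z.
  by move=> yz; apply/eqP; rewrite -subr_eq0 -rmorphB ker // rmorphB yz subrr.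
(* The kernel of [phi] on [algebraic_part S]; it is nonzero because it contains [p]. *)
pose P : set K := [set z | algebraic_part S z /\ exists2 y, e1 y = iota z & phi y = 0].
have Pp : P p%:R.
  split; first exact: algebraic_part_nat.
  by exists p%:R; rewrite !rmorph_nat // (pcharf0 pk).
have Pprime : nonzero_prime (algebraic_part S) P.
  split.
  - by move=> z [].
  - move=> y z [ya [y' hy py]] [za [z' hz pz]]; split; first exact: algebraic_part_sub.
    by exists (y' - z'); rewrite !rmorphB ?hy ?hz // py pz subrr.
  - move=> y z ya [za [z' hz pz]]; split; first exact: algebraic_part_mul.
    have [y' hy] := onto y (proj1 ya).
    by exists (y' * z'); rewrite !rmorphM ?hy ?hz // pz mulr0.
  - move=> [_ [y hy]]; rewrite (inj y 1) ?rmorph1 ?hy ?rmorph1 //.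
    by move/eqP; rewrite oner_eq0.
  - move=> y z ya za [_ [w hw pw]].
    have [y' hy] := onto y (proj1 ya); have [z' hz] := onto z (proj1 za).
    have /eqP : phi y' * phi z' = 0 by rewrite -pw -rmorphM; apply: inj; rewrite hw !rmorphM hy hz.
    rewrite mulf_eq0 => /orP[/eqP py|/eqP pz]; [left|right]; split=> //.
      by exists y'.
    by exists z'.
  - exists p%:R => //.
    by rewrite -(fmorph_eq0 iota) rmorph_nat pnatr_eq0 -lt0n prime_gt0.
exists P, R1, e1, phi; split=> //; first exact: p0P Pp.
  exists (i 'X); first by rewrite e1i /= horner_evalE map_polyX hornerX.
  by rewrite phi_i /= horner_evalE map_polyX hornerX.
split=> [y hy|z [u [uP ->]] y hy].
  by rewrite (inj y st) // hy hst.
suff [w hw pw] : exists2 w, e1 w = iota (\sum_(v <- u) v.1 * v.2) & phi w = 0.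
  by rewrite -pw; apply: inj; rewrite hw.
elim: u uP {hy} => [|v u IH] uP; first by exists 0; rewrite ?big_nil !rmorph0.
have [|w hw pw] := IH; first by move=> t tu; apply: uP; rewrite inE tu orbT.
have [[_ [y1 hy1 py1]] v2] := uP v (mem_head _ _).
have [y2 hy2] := onto v.2 v2.
exists (y1 * y2 + w); first by rewrite big_cons !rmorphD !rmorphM hy1 hy2 hw.
by rewrite rmorphD rmorphM py1 pw mul0r addr0.
Qed.

(** Specialization with [x = 0]: the auxiliary polynomial then only matters through its constant
    term, a nonzero integer, and any large enough [p] avoids its divisors. *)
Lemma good_prime (s : K) : s \in S -> s != 0 -> exists2 P, Q P & ~ extended_power S P 1 s.
Proof.
move=> sS s0; have [h [p0 [hx hP]]] := specialization 0 sS s0.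
have h00 : h.[0] != 0.
  apply: contraNneq hx => h0; rewrite -[X in _.[X]](rmorph0 (intmul 1 : int -> E)).
  by rewrite horner_map h0 rmorph0.
have [p pgt pp] := prime_above (p0 + `|h.[0]|)%N.
have [k pk] := Fp_algebraic_closure pp.
have eval0 (F : comNzRingType) (f : {poly int}) : (map_poly intr f).[0] = (f.[0])%:~R :> F.
  by rewrite -[X in _.[X]](rmorph0 (intmul 1 : int -> F)) horner_map.
have [|||P [R1 [e1 [phi [QP ker onto _ [snz PS]]]]]] := hP p k 0 pp _ pk.
- by lia.
- by move=> f; rewrite !eval0 => /eqP; rewrite intr_eq0 => /eqP ->.
- rewrite eval0 -(dvdz_pcharf pk) dvdzE /=; apply/negP => /dvdn_leq.
  by rewrite absz_gt0 h00 => /(_ isT); lia.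
exists P => //; have [y hy] := onto s sS => /PS/(_ y hy)/eqP.
by apply/negP/snz.
Qed.

End GoodPrimes.

(** * Functions on the annulus *)

Section AnnulusArithmetic.
Variable F : fieldType.
Local Notation O := (rig_annulus F).
Implicit Types f g : O.

Lemma rcoef0 k j : coef (0 : O) k j = 0.
Proof. by []. Qed.

Lemma rcoefN f k j : coef (- f) k j = - coef f k j. Proof. by []. Qed.

Lemma rcoefB f g k j : coef (f - g) k j = coef f k j - coef g k j. Proof. by []. Qed.

Lemma rcoef1 k j : coef (1 : O) k j = ((k == 0) && (j == 0))%:R. Proof. by []. Qed.

Lemma rcoef_sum (I : Type) (r : seq I) (P : pred I) (f : I -> O) k j :
  coef (\sum_(i <- r | P i) f i) k j = \sum_(i <- r | P i) coef (f i) k j.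
Proof. by elim/big_rec2: _ => // i x y _ <-. Qed.

Lemma fsum_single (G : int * int -> F) (x : int * int) :
  (forall y, G y != 0 -> y = x) -> \sum_(y \in [set: int * int]) G y = G x.
Proof.
by move=> h; rewrite (@fsumE _ [set x]) // fset_set1 finmap.big_seq_fset1.
Qed.

Lemma lowfin_const (c : F) : lowfin (fun k j => c * delta F 0 0 k j).
Proof.
move=> M; apply: sub_finite_set (@lowfin_delta F 0 0 M) => x [xM].
by rewrite mulf_eq0 negb_or => /andP[].
Qed.

Definition rig_const (c : F) : O := rig_mk (lowfin_const c).

Lemma coef_const c k j : coef (rig_const c) k j = c * ((k == 0) && (j == 0))%:R.
Proof. by []. Qed.

Lemma coef_constM c f k j : coef (rig_const c * f) k j = c * coef f k j.
Proof.
rewrite Defs.coefM (@fsum_single _ (0, 0)); first by rewrite coef_const /= mulr1 !subr0.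
move=> [y1 y2]; rewrite coef_const /=.
by have [->|_] := eqVneq y1 0; have [->|_] := eqVneq y2 0; rewrite // mulr0 mul0r eqxx.
Qed.

Lemma coef_monomialM m l f k j : coef (rig_monomial m l * f) k j = coef f (k - m) (j - l).
Proof.
rewrite Defs.coefM (@fsum_single _ (m, l)); first by rewrite coef_monomial /= !eqxx mul1r.
move=> [y1 y2]; rewrite coef_monomial /=.
by have [->|_] := eqVneq y1 m; have [->|_] := eqVneq y2 l; rewrite // mul0r eqxx.
Qed.

Lemma Dt_is_zmod_morphism : zmod_morphism (@Dt F).
Proof. by move=> f g; apply: rig_annulusP => k j; rewrite rcoefB !coef_Dt rcoefB mulrBr. Qed.

HB.instance Definition _ := GRing.isZmodMorphism.Build O O (@Dt F) Dt_is_zmod_morphism.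

Lemma DtM f g : Dt (f * g) = Dt f * g + f * Dt g.
Proof.
apply: rig_annulusP => k j; rewrite coef_Dt Defs.coefD !Defs.coefM mulr_fsumr.
have fin (a b : O) := @conv_finite F _ _ k j (@rig_lowfin F a) (@rig_lowfin F b).
pose A := [set x : int * int | coef f x.1 x.2 * coef g (k - x.1) (j - x.2) != 0] `|`
  [set x : int * int | coef (Dt f) x.1 x.2 * coef g (k - x.1) (j - x.2) != 0] `|`
  [set x : int * int | coef f x.1 x.2 * coef (Dt g) (k - x.1) (j - x.2) != 0].
have fA : finite_set A by rewrite !finite_setU.
rewrite !(@fsumE _ A) //; first last.
- by move=> x; rewrite mulf_eq0 negb_or => /andP[_ ?]; left; left.
- by move=> x ?; left; right.
- by move=> x ?; right.
rewrite -big_split; apply: eq_bigr => x _ /=.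
by rewrite rmorphB /=; ring.
Qed.

Lemma Dt1 : Dt (1 : O) = 0.
Proof. by apply: rig_annulusP => k j; rewrite coef_Dt rcoef1; case: eqP => [->|];
  rewrite ?mul0r ?mulr0. Qed.

Lemma Dt_const c : Dt (rig_const c) = 0.
Proof.
apply: rig_annulusP => k j; rewrite coef_Dt coef_const.
by case: eqP => [->|]; rewrite ?mul0r ?mulr0.
Qed.

Lemma nablaD n (A : 'M[O]_n) (x y : 'rV[O]_n) :
  nabla_along A Dt (x + y) = nabla_along A Dt x + nabla_along A Dt y.
Proof.
rewrite !nabla_along_Dt mulmxDl addrACA; congr (_ + _).
by apply/rowP => i; rewrite !mxE raddfD.
Qed.

Lemma nablaZ n (A : 'M[O]_n) (f : O) (x : 'rV[O]_n) :
  nabla_along A Dt (f *: x) = Dt f *: x + f *: nabla_along A Dt x.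
Proof.
rewrite !nabla_along_Dt -scalemxAl scalerDr addrA; congr (_ + _).
by apply/rowP => i; rewrite !mxE DtM.
Qed.

Lemma nabla0 n (A : 'M[O]_n) : nabla_along A Dt 0 = 0.
Proof. by apply: (addrI (nabla_along A Dt 0)); rewrite -nablaD !addr0. Qed.

Lemma nabla_sum n (A : 'M[O]_n) (I : Type) (r : seq I) (P : pred I) (x : I -> 'rV[O]_n) :
  nabla_along A Dt (\sum_(i <- r | P i) x i) = \sum_(i <- r | P i) nabla_along A Dt (x i).
Proof. by elim/big_rec2: _ => [|i u v _ <-]; rewrite ?nabla0 ?nablaD. Qed.

Lemma iter_nabla_p_curvature n (A : 'M[O]_n) p : p \in [pchar F] ->
    (forall x, p_curvature p A x = 0) ->
  forall x, iter p (nabla_along A Dt) x = nabla_along A Dt x.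
Proof.
move=> pF pc x; have := pc x; rewrite /p_curvature => /eqP; rewrite subr_eq0 => /eqP ->.
suff -> : iter p Dt = Dt :> (O -> O) by [].
apply/funext => f; apply: rig_annulusP => k j.
have -> m : coef (iter m Dt f) k j = k%:~R ^+ m * coef f k j.
  by elim: m => [|m IH]; rewrite ?mul1r // iterS coef_Dt IH exprS mulrA.
by rewrite coef_Dt -(pFrobenius_autE pF) pFrobenius_aut_int.
Qed.

End AnnulusArithmetic.

(** * Differential operators *)

(* Polynomials over [O] stand for differential operators, [\sum_i P_i D^i].       *)
(* [dcomp P] is the composite [D P], and [ocomp Q L] the composite [Q L].          *)
Section DifferentialOperators.
Variable F : fieldType.
Local Notation O := (rig_annulus F).
Implicit Types P Q L : {poly O}.

Definition dcomp P : {poly O} := map_poly Dt P + 'X * P.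

Definition ocomp Q L : {poly O} := \sum_(i < size Q) Q`_i *: iter i dcomp L.

Lemma coef_dcomp P I : (dcomp P)`_I = Dt P`_I + (if I is I'.+1 then P`_I' else 0).
Proof. by rewrite coefD coef_map coefXM; case: I. Qed.

Lemma dcompD P Q : dcomp (P + Q) = dcomp P + dcomp Q.
Proof. by rewrite /dcomp raddfD mulrDr addrACA. Qed.

Lemma dcomp0 : dcomp 0 = 0.
Proof. by rewrite /dcomp raddf0 mulr0 addr0. Qed.

Lemma dcompXn m : dcomp 'X^m = 'X^(m.+1).
Proof.
apply/polyP => I; rewrite coef_dcomp !coefXn.
have -> : Dt (I == m)%:R = 0 :> O by case: eqP => _; rewrite ?Dt1 ?raddf0.
by rewrite add0r; case: I => [|I] //; rewrite coefXn.
Qed.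

Lemma dcompZ f P : dcomp (f *: P) = Dt f *: P + f *: dcomp P.
Proof.
apply/polyP => I; rewrite coef_dcomp coefD !coefZ coef_dcomp DtM.
case: I => [|I]; first by rewrite !addr0.
by rewrite coefZ mulrDr addrA.
Qed.

Lemma dcomp_sum (I : Type) (r : seq I) (p : pred I) (P : I -> {poly O}) :
  dcomp (\sum_(i <- r | p i) P i) = \sum_(i <- r | p i) dcomp (P i).
Proof. by elim/big_rec2: _ => [|i u v _ <-]; rewrite ?dcomp0 ?dcompD. Qed.

Lemma ocomp_wide m Q L : (size Q <= m)%N -> ocomp Q L = \sum_(i < m) Q`_i *: iter i dcomp L.
Proof.
move=> sQ; rewrite /ocomp (big_ord_widen _ (fun i => Q`_i *: iter i dcomp L) sQ) big_mkcond.
by apply: eq_bigr => i _; case: ltnP => // le; rewrite nth_default ?scale0r.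
Qed.

Lemma ocompD P Q L : ocomp (P + Q) L = ocomp P L + ocomp Q L.
Proof.
have le := size_polyD P Q; set m := maxn _ _ in le.
rewrite (ocomp_wide _ le) (@ocomp_wide m P) ?leq_maxl // (@ocomp_wide m Q) ?leq_maxr //.
by rewrite -big_split; apply: eq_bigr => i _; rewrite coefD scalerDl.
Qed.

Lemma ocompZ f Q L : ocomp (f *: Q) L = f *: ocomp Q L.
Proof.
rewrite (ocomp_wide _ (size_scale_leq f Q)) scaler_sumr.
by apply: eq_bigr => i _; rewrite coefZ scalerA.
Qed.

Lemma ocompC f L : ocomp f%:P L = f *: L.
Proof. by rewrite (@ocomp_wide 1) ?size_polyC_leq1 // big_ord1 coefC. Qed.

Lemma dcomp_ocomp Q L : dcomp (ocomp Q L) = ocomp (dcomp Q) L.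
Proof.
have sd : (size (dcomp Q) <= (size Q).+1)%N.
  rewrite (leq_trans (size_polyD _ _)) // geq_max (leq_trans (size_poly _ _)) //=.
  by rewrite (leq_trans (size_polyMleq _ _)) // size_polyX.
rewrite (ocomp_wide _ sd) dcomp_sum.
under eq_bigr do rewrite dcompZ.
under [RHS]eq_bigr do rewrite coef_dcomp scalerDl.
rewrite !big_split /=; congr (_ + _).
  by rewrite big_ord_recr /= nth_default // raddf0 scale0r addr0.
by rewrite big_ord_recl scale0r add0r.
Qed.

Section Division.
Variables (n : nat) (L : {poly O}).
Hypotheses (L_monic : L \is monic) (L_size : size L = n.+1).

(** Euclidean division of [D^(n + m)] by [L] with the quotient on the left. Composing the equation
    for [m] with [D] leaves a remainder of order at most [n], whose top term is removed by a
    multiple of [L]. *)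
Lemma division_Xn m : exists Q R : {poly O}, [/\ Q \is monic, size Q = m.+1, (size R <= n)%N &
  'X^(n + m) = ocomp Q L + R].
Proof.
have split1 (P : {poly O}) : (size P <= n.+1)%N ->
  exists R : {poly O}, (size R <= n)%N /\
    P = P`_n *: L + R.
  move=> sP; exists (P - P`_n *: L); split; last by rewrite addrC subrK.
  apply/leq_sizeP => I; rewrite leq_eqVlt => /predU1P[<-|lt]; rewrite coefB coefZ.
    have -> : L`_n = 1 by move: L_monic; rewrite monicE lead_coefE L_size => /eqP.
    by rewrite mulr1 subrr.
  by rewrite (nth_default 0 (leq_trans sP lt)) [L`_I]nth_default ?L_size // mulr0 subrr.
have Lm : L`_n = 1 by move: L_monic; rewrite monicE lead_coefE L_size => /eqP.
elim: m => [|m [Q [R [Qm sQ sR e]]]].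
  exists 1, ('X^n - L); split; rewrite ?monic1 ?size_poly1 //.
    apply/leq_sizeP => I; rewrite leq_eqVlt => /predU1P[<-|lt]; rewrite coefB coefXn.
      by rewrite eqxx Lm subrr.
    by rewrite gtn_eqF // nth_default ?subrr // L_size.
  by have := ocompC 1 L; rewrite polyC1 scale1r => ->; rewrite addn0 addrC subrK.
have sdR : (size (dcomp R) <= n.+1)%N.
  rewrite (leq_trans (size_polyD _ _)) // geq_max (leq_trans (size_poly _ _)) /=.
    by rewrite (leq_trans (size_polyMleq _ _)) // size_polyX.
  exact: leq_trans sR (leqnSn _).
have [R' [sR' dR]] := split1 _ sdR.
have sX : size ('X * Q) = m.+2 by rewrite size_monicM ?monicX ?monic_neq0 // size_polyX sQ.
have sD : (size (map_poly Dt Q) < size ('X * Q)%R)%N.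
  by rewrite sX ltnS (leq_trans (size_poly _ _)) ?sQ.
have sdQ : size (dcomp Q) = m.+2 by rewrite /dcomp addrC size_polyDl.
have mdQ : dcomp Q \is monic.
  by rewrite monicE /dcomp addrC lead_coefDl // -monicE rpredM ?monicX.
have sC c : (size (c%:P : {poly O}) < size (dcomp Q))%N.
  by rewrite sdQ (leq_ltn_trans (size_polyC_leq1 _)).
exists (dcomp Q + ((dcomp R)`_n)%:P), R'; split=> //.
- by rewrite monicE lead_coefDl // -monicE.
- by rewrite size_polyDl.
have h := congr1 dcomp e; rewrite dcompD dcomp_ocomp {1}dR addrA in h.
rewrite ocompD ocompC -h.
by rewrite addnS dcompXn.
Qed.

End Division.

End DifferentialOperators.

(** * Gauss's lemma for leading terms *)

Lemma seq_minimum (T : eqType) (lt : rel T) (x0 : T) (s : seq T) :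
    transitive lt -> irreflexive lt ->
  exists2 x, x \in x0 :: s & forall y, y \in x0 :: s -> ~~ lt y x.
Proof.
move=> tr irr; elim: s => [|y s [m ms mP]].
  by exists x0; rewrite ?mem_head // => y; rewrite inE => /eqP ->; rewrite irr.
have [ym|ym] := boolP (lt y m).
  exists y; first by rewrite !inE eqxx orbT.
  move=> z; rewrite !inE orbCA => /predU1P[->|zs]; first by rewrite irr.
  by apply: contra (mP z _); rewrite ?inE // => /tr; apply.
exists m; first by move: ms; rewrite !inE => /orP[] ->; rewrite ?orbT.
by move=> z; rewrite !inE orbCA => /predU1P[->|zs] //; apply: mP; rewrite inE.
Qed.

(* The exponents of the terms [t^k q^j D^i] of a differential operator are ordered *)
(* lexicographically by [(j, eps * k, - i)]; as [D] and [t] commute up to terms of  *)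
(* lower order in [D], leading terms are multiplicative.                           *)
Section LeadingTerms.
Variable F : fieldType.
Local Notation O := (rig_annulus F).
Implicit Types P Q L : {poly O}.

Definition ocoef P (k j : int) (i : nat) : F := coef P`_i k j.

Lemma ocoef_dcomp P k j i :
  ocoef (dcomp P) k j i = k%:~R * ocoef P k j i + (if i is i'.+1 then ocoef P k j i' else 0).
Proof. by rewrite /ocoef coef_dcomp Defs.coefD coef_Dt; case: i. Qed.

Lemma ocoef_iter_dcomp_neq0 P m k j i : ocoef (iter m (@dcomp F) P) k j i != 0 ->
  exists i0, [/\ (i0 <= i)%N, (i <= i0 + m)%N & ocoef P k j i0 != 0].
Proof.
elim: m i => [|m IH] i; first by exists i; rewrite addn0.
rewrite iterS ocoef_dcomp; have [e|/IH[i0 [? ? ?]] _] :=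
  eqVneq (ocoef (iter m (@dcomp F) P) k j i) 0.
  rewrite e mulr0 add0r; case: i e => [|i] _; rewrite ?eqxx // => /IH[i0 [? ? ?]].
  by exists i0; split=> //; lia.
by exists i0; split=> //; lia.
Qed.

Lemma ocoef_iter_dcomp_top P m k j i : (forall i', (i < i')%N -> ocoef P k j i' = 0) ->
  ocoef (iter m (@dcomp F) P) k j (i + m) = ocoef P k j i.
Proof.
move=> top; elim: m => [|m IH]; first by rewrite addn0.
rewrite iterS addnS ocoef_dcomp IH [X in _ * X](_ : _ = 0) ?mulr0 ?add0r //.
apply: contrapT => /eqP/ocoef_iter_dcomp_neq0[i0 [_ le]].
by rewrite top ?eqxx //; lia.
Qed.

Lemma ocoef_ocomp Q L k j i : ocoef (ocomp Q L) k j i =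
  \sum_(l < size Q) \sum_(x \in [set: int * int])
    ocoef Q x.1 x.2 l * ocoef (iter l (@dcomp F) L) (k - x.1) (j - x.2) i.
Proof.
rewrite /ocoef /ocomp poly.coef_sum rcoef_sum; apply: eq_bigr => l _.
by rewrite coefZ Defs.coefM.
Qed.

Variable eps : int.
Hypothesis eps_sign : eps = 1 \/ eps = - 1.

Definition precedes (x y : int * int * nat) : bool :=
  (x.1.2 < y.1.2) || ((x.1.2 == y.1.2) &&
    ((eps * x.1.1 < eps * y.1.1) || ((x.1.1 == y.1.1) && (y.2 < x.2)%N))).

Lemma precedes_trans : transitive precedes.
Proof.
move=> [[k1 j1] i1] [[k2 j2] i2] [[k3 j3] i3]; rewrite /precedes /=.
by case: eps_sign => ->; lia.
Qed.

Lemma precedes_irr : irreflexive precedes.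
Proof. by move=> [[k j] i]; rewrite /precedes /= !ltxx ltnn !andbF. Qed.

Definition leads P (k j : int) (i : nat) : Prop := ocoef P k j i != 0 /\
  forall k' j' i', ocoef P k' j' i' != 0 -> ~~ precedes (k', j', i') (k, j, i).

(** The order is not well-founded on all exponents, but only finitely many terms have [q]-exponent
    at most that of a given term. *)
Lemma leads_exists P : P != 0 -> exists k j i, leads P k j i.
Proof.
move=> P0; have [k0 [j0 [i0 c0]]] : exists k j i, ocoef P k j i != 0.
  apply: contrapT => none; case/eqP: P0; apply/polyP => i; rewrite poly.coef0.
  apply: rig_annulusP => k j; apply: contrapT => /eqP c; case: none.
  by exists k, j, i.
have /choice[N hN] : forall i, exists N, low_support (coef P`_i) (j0 + 1) `<=` box N.
  by move=> i; apply/finite_in_box/rig_lowfin.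
have /finite_seqP[s hs] := finite_box (\sum_(i < size P) N i).
have inbox k j i : ocoef P k j i != 0 -> j <= j0 -> (i < size P)%N /\ (k, j) \in s.
  move=> c jj; have iP : (i < size P)%N.
    by rewrite ltnNge; apply: contra c => le; rewrite /ocoef nth_default // rcoef0.
  split=> //; have : [set` s] (k, j); last by [].
  rewrite -hs; have [|/= bk bj] := hN i (k, j); first by split=> //=; lia.
  by rewrite /box /= (bigD1 (Ordinal iP)) //=; split; lia.
pose cand := [seq x <- [seq (y, i) | y <- s, i <- iota 0 (size P)] | ocoef P x.1.1 x.1.2 x.2 != 0].
have candP k j i : ocoef P k j i != 0 -> j <= j0 -> (k, j, i) \in cand.
  move=> c jj; have [iP ks] := inbox k j i c jj.
  by rewrite mem_filter c /=; apply: allpairs_f => //; rewrite mem_iota.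
have x0c := candP k0 j0 i0 c0 (lexx _).
have [[[k j] i] xin xmin] := seq_minimum (k0, j0, i0) cand precedes_trans precedes_irr.
have cx : ocoef P k j i != 0.
  by move: xin; rewrite inE => /predU1P[[-> -> ->] //|]; rewrite mem_filter => /andP[].
exists k, j, i; split=> // k' j' i' c'.
have jj : j <= j0 by have := xmin _ (mem_head _ _); rewrite /precedes /= leNgt; case: ltP.
have [le|lt] := lerP j' j0; first by apply: xmin; rewrite inE candP ?orbT.
by rewrite /precedes /= negb_or -leNgt negb_and gt_eqF ?orTb ?andbT; lia.
Qed.

Lemma leads_ocomp Q L kQ jQ iQ kL jL iL : leads Q kQ jQ iQ -> leads L kL jL iL ->
  ocoef (ocomp Q L) (kQ + kL) (jQ + jL) (iQ + iL) = ocoef Q kQ jQ iQ * ocoef L kL jL iL.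
Proof.
move=> [cQ minQ] [cL minL]; rewrite ocoef_ocomp.
have iQs : (iQ < size Q)%N.
  by rewrite ltnNge; apply: contra cQ => le; rewrite /ocoef nth_default // rcoef0.
have only l x : ocoef Q x.1 x.2 l *
    ocoef (iter l (@dcomp F) L) (kQ + kL - x.1) (jQ + jL - x.2) (iQ + iL) != 0 ->
    x = (kQ, jQ) /\ l = iQ.
  rewrite mulf_eq0 negb_or => /andP[/minQ hQ /ocoef_iter_dcomp_neq0[i0 [_ le /minL hL]]].
  case: x hQ hL => x1 x2; rewrite /precedes /= => hQ hL.
  suff [-> -> ->] : [/\ x1 = kQ, x2 = jQ & l = iQ] by [].
  by case: eps_sign hQ hL => -> hQ hL; split; lia.
rewrite (bigD1 (Ordinal iQs)) //= [X in _ + X]big1 ?addr0.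
  rewrite (@fsum_single _ _ (kQ, jQ)) /=; last by move=> y /only[].
  rewrite ![_ + _ - _]addrAC !subrr !add0r addnC ocoef_iter_dcomp_top // => i' lt.
  apply: contrapT => /eqP/minL; rewrite /precedes /= !eqxx lt.
  by rewrite !orbT.
move=> l lN; apply: fsbig1 => x _; apply: contrapT => /eqP/only[_ e].
by case/eqP: lN; apply/val_inj.
Qed.

(* Gauss's lemma: the leading exponents of [Q] and [L] are at most those of the     *)
(* monomials [D^m] and [D^n], and add up to an exponent of [D^(n + m) - D].         *)
Lemma leads_factor_XpX m n Q L : Q \is monic -> size Q = m.+1 -> L \is monic ->
    size L = n.+1 -> (1 < n + m)%N -> ocomp Q L = 'X^(n + m) - 'X ->
  leads L 0 0 n.
Proof.
move=> Qm sQ Lm sL nm e.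
have [kQ [jQ [iQ leadQ]]] := leads_exists (monic_neq0 Qm).
have [kL [jL [iL leadL]]] := leads_exists (monic_neq0 Lm).
have := leads_ocomp leadQ leadL; rewrite e => prod.
have top P l : P \is monic -> size P = l.+1 -> ocoef P 0 0 l != 0.
  by rewrite monicE lead_coefE /ocoef => /eqP P1 sP; rewrite -[l]/(l.+1.-1) -sP P1 rcoef1 oner_eq0.
have hQ := proj2 leadQ _ _ _ (top _ _ Qm sQ).
have hL := proj2 leadL _ _ _ (top _ _ Lm sL).
have : ocoef ('X^(n + m) - 'X) (kQ + kL) (jQ + jL) (iQ + iL) != 0.
  by rewrite prod mulf_neq0 // ?(proj1 leadQ) ?(proj1 leadL).
rewrite /ocoef poly.coefB coefXn coefX rcoefB => nz.
have nat_coef (b : bool) k j : coef (b%:R : O) k j != 0 -> b /\ (k, j) = (0, 0).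
  case: b; rewrite ?rcoef0 ?eqxx // rcoef1.
  by have [->|_] := eqVneq k 0; have [->|_] := eqVneq j 0; rewrite ?eqxx.
(* Neither exponent exceeds [(0, 0)] in [q] and [t], and they sum to it, so both are there. Then
   [iQ >= m] and [iL >= n], and [1 < n + m] excludes the term [D]. *)
suff [e1 e2 e3] : [/\ kL = 0, jL = 0 & iL = n] by move: leadL; rewrite e1 e2 e3.
have [z|/nat_coef[/eqP e1 [k0 j0]]] :=
    eqVneq (coef ((iQ + iL == n + m)%N%:R : O) (kQ + kL) (jQ + jL)) 0.
  move: nz; rewrite z sub0r oppr_eq0 => /nat_coef[/eqP e1 [k0 j0]].
  by move: hQ hL; rewrite /precedes /=; case: eps_sign => -> hQ hL; lia.
by move: hQ hL; rewrite /precedes /=; case: eps_sign => -> hQ hL; split; lia.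
Qed.

End LeadingTerms.

(** * Cyclic connections in characteristic p *)

Section CyclicModule.
Variables (F : fieldType) (n' : nat).
Local Notation n := n'.+1.
Local Notation O := (rig_annulus F).
Variable B : 'M[O]_n.
Hypothesis B_companion : forall i j : 'I_n, (i.+1 < n)%N -> B i j = (i.+1 == j)%:R.
Local Notation nabla := (nabla_along B Dt).
Local Notation e0 := (delta_mx 0 0 : 'rV[O]_n).
Implicit Types P Q R : {poly O}.

Definition act P : 'rV[O]_n := \sum_(i < size P) P`_i *: iter i nabla e0.

Lemma act_wide m P : (size P <= m)%N -> act P = \sum_(i < m) P`_i *: iter i nabla e0.
Proof.
move=> sP; rewrite /act (big_ord_widen _ (fun i => P`_i *: iter i nabla e0) sP) big_mkcond.
by apply: eq_bigr => i _; case: ltnP => // le; rewrite nth_default ?scale0r.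
Qed.

Lemma actD P Q : act (P + Q) = act P + act Q.
Proof.
have le := size_polyD P Q; set m := maxn _ _ in le.
rewrite (act_wide le) (@act_wide m P) ?leq_maxl // (@act_wide m Q) ?leq_maxr //.
by rewrite -big_split; apply: eq_bigr => i _; rewrite coefD scalerDl.
Qed.

Lemma actZ f P : act (f *: P) = f *: act P.
Proof.
rewrite (act_wide (size_scale_leq f P)) scaler_sumr.
by apply: eq_bigr => i _; rewrite coefZ scalerA.
Qed.

Lemma act0 : act 0 = 0. Proof. by rewrite /act size_poly0 big_ord0. Qed.

Lemma act_sum (I : Type) (r : seq I) (p : pred I) (P : I -> {poly O}) :
  act (\sum_(i <- r | p i) P i) = \sum_(i <- r | p i) act (P i).
Proof. by elim/big_rec2: _ => [|i u v _ <-]; rewrite ?act0 ?actD. Qed.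

Lemma actXn m : act 'X^m = iter m nabla e0.
Proof.
rewrite /act size_polyXn big_ord_recr /= coefXn eqxx scale1r big1 ?add0r // => i _.
by rewrite coefXn ltn_eqF ?ltn_ord // scale0r.
Qed.

Lemma act_dcomp P : act (dcomp P) = nabla (act P).
Proof.
have sd : (size (dcomp P) <= (size P).+1)%N.
  rewrite (leq_trans (size_polyD _ _)) // geq_max (leq_trans (size_poly _ _)) //=.
  by rewrite (leq_trans (size_polyMleq _ _)) // size_polyX.
rewrite (act_wide sd) /act nabla_sum.
under eq_bigr do rewrite coef_dcomp scalerDl.
under [RHS]eq_bigr do rewrite nablaZ.
rewrite !big_split /=; congr (_ + _).
  by rewrite big_ord_recr /= nth_default // raddf0 scale0r addr0.
by rewrite big_ord_recl scale0r add0r.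
Qed.

Lemma nabla_delta (i : 'I_n) : nabla (delta_mx 0 i) = row i B.
Proof.
rewrite nabla_along_Dt -rowE [X in X + _](_ : _ = 0) ?add0r //.
by apply/rowP => j; rewrite !mxE; case: (_ && _); rewrite ?Dt1 ?raddf0.
Qed.

Lemma iter_nabla_e0 (i : 'I_n) : iter i nabla e0 = delta_mx 0 i.
Proof.
case: i; elim=> [|i IH] ilt /=; first by congr delta_mx; apply/val_inj.
rewrite (IH (ltnW ilt)) nabla_delta; apply/rowP => j.
by rewrite !mxE B_companion //= -val_eqE eq_sym.
Qed.

Lemma act_small R : (size R <= n)%N -> act R = poly_rV R.
Proof.
move=> sR; rewrite (act_wide sR) [RHS]row_sum_delta.
by apply: eq_bigr => i _; rewrite iter_nabla_e0 mxE.
Qed.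

Definition minimal_operator : {poly O} := 'X^n - rVpoly (row ord_max B).

Local Notation L := minimal_operator.

Lemma size_minimal_operator : size L = n.+1.
Proof. by rewrite size_polyDl size_polyXn // size_polyN ltnS size_poly. Qed.

Lemma minimal_operator_monic : L \is monic.
Proof.
by rewrite monicE lead_coefDl ?lead_coefXn // size_polyXn size_polyN ltnS size_poly.
Qed.

Lemma act_minimal_operator : act L = 0.
Proof.
rewrite /minimal_operator -[- rVpoly _]scaleN1r actD actZ actXn act_small ?size_poly // rVpolyK.
by rewrite iterS (iter_nabla_e0 ord_max) nabla_delta scaleN1r subrr.
Qed.

Lemma act_ocomp Q : act (ocomp Q L) = 0.
Proof.
rewrite /ocomp act_sum big1 // => i _; rewrite actZ.
suff -> : act (iter i (@dcomp F) L) = 0 by rewrite scaler0.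
elim: {i}(i : nat) => [|i IH]; first exact: act_minimal_operator.
by rewrite iterS act_dcomp IH nabla0.
Qed.

Variable p : nat.
Hypotheses (p_gt1 : (1 < p)%N) (nabla_p : forall x, iter p nabla x = nabla x).

(** If [p < n], then [nabla^p e0] and [nabla e0] are two different basis vectors. *)
Lemma leq_rank_pchar : (n <= p)%N.
Proof.
rewrite leqNgt; apply/negP => pn; have := nabla_p e0.
have n1 : (1 < n)%N by apply: ltn_trans pn.
rewrite (iter_nabla_e0 (Ordinal pn)) -[nabla e0]/(iter 1 nabla e0) (iter_nabla_e0 (Ordinal n1)).
have ne : (Ordinal n1 == Ordinal pn) = false.
  by apply/negP => /eqP/(congr1 val) /= p1; move: p_gt1; rewrite -p1.
by move=> /rowP/(_ (Ordinal n1))/eqP; rewrite !mxE ne !eqxx /= eq_sym oner_eq0.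
Qed.

(** Divide [D^p - D] by [L]. Both kill [e0], so the remainder does too; its order is less than [n],
    so it is zero because [e0] is cyclic. *)
Lemma minimal_operator_factor :
  exists Q : {poly O}, [/\ Q \is monic, size Q = (p - n).+1 & ocomp Q L = 'X^(n + (p - n)) - 'X].
Proof.
have divn m (P : {poly O}) : (size P <= n + m)%N ->
  exists Q R : {poly O}, [/\ (size Q <= m)%N, (size R <= n)%N & P = ocomp Q L + R].
  elim: m P => [|m IH] P sP.
    by exists 0, P; rewrite size_poly0 -(addn0 n) /ocomp size_poly0 big_ord0 add0r.
  have [Q [R [Qm sQ sR e]]] := division_Xn minimal_operator_monic size_minimal_operator m.
  pose P' := P - P`_(n + m) *: 'X^(n + m).
  have [|Q' [R' [sQ' sR' e']]] := IH P'.
    apply/leq_sizeP => i; rewrite leq_eqVlt => /predU1P[<-|lt]; rewrite coefB coefZ coefXn.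
      by rewrite eqxx mulr1 subrr.
    by rewrite gtn_eqF // mulr0 subr0 nth_default // (leq_trans sP) // addnS.
  exists (Q' + P`_(n + m) *: Q), (R' + P`_(n + m) *: R); split.
  - rewrite (leq_trans (size_polyD _ _)) // geq_max (leq_trans sQ') //=.
    by rewrite (leq_trans (size_scale_leq _ _)) // sQ.
  - by rewrite (leq_trans (size_polyD _ _)) // geq_max sR' (leq_trans (size_scale_leq _ _)).
  have hP : P = P' + P`_(n + m) *: 'X^(n + m) by rewrite subrK.
  by rewrite [LHS]hP e' e ocompD ocompZ scalerDr addrACA.
have [Q [R [Qm sQ sR e]]] := division_Xn minimal_operator_monic size_minimal_operator (p - n).
have np := leq_rank_pchar.
have [|Q' [R' [sQ' sR' e']]] := divn (p - n)%N 'X; first by rewrite size_polyX subnKC.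
have sQQ : size (Q - Q') = (p - n).+1.
  by rewrite size_polyDl // size_polyN sQ ltnS.
exists (Q - Q'); split=> //.
  by rewrite monicE lead_coefDl -?monicE // size_polyN sQ ltnS.
have e2 : 'X^(n + (p - n)) - 'X = ocomp (Q - Q') L + (R - R').
  by rewrite e {1}e' -[- Q']scaleN1r ocompD ocompZ scaleN1r opprD addrACA.
have sRR : (size (R - R')%R <= n)%N.
  by rewrite (leq_trans (size_polyD _ _)) // geq_max size_polyN sR.
have : act (R - R') = 0.
  rewrite -[LHS]add0r -(act_ocomp (Q - Q')) -actD -e2 actD -scaleN1r actZ actXn.
  by rewrite subnKC // nabla_p act_ocomp (actXn 1) scaleN1r subrr.
rewrite act_small // => /(congr1 rVpoly); rewrite poly_rV_K // linear0 => RR.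
by rewrite e2 RR addr0.
Qed.

(** For both signs of [eps] the leading exponent of [L] is that of [D^n]. At [l = 0] one sign
    excludes [k < 0] and the other [k > 0]. *)
Lemma companion_coef_p_curvature i j k l : coef (B i j) k l != 0 -> 0 < l \/ l = 0 /\ k = 0.
Proof.
have [ilt|] := ltnP i.+1 n.
  rewrite B_companion //; case: (i.+1 == j); rewrite ?rcoef0 ?eqxx // rcoef1.
  by have [->|_] := eqVneq k 0; have [->|_] := eqVneq l 0; rewrite ?eqxx //; right.
move=> ni; have -> : i = ord_max by apply/val_inj => /=; have := ltn_ord i; lia.
move=> c; have [Q [Qm sQ e]] := minimal_operator_factor.
have cL : ocoef L k l j != 0.
  rewrite /ocoef coefB coefXn ltn_eqF ?ltn_ord // sub0r coef_rVpoly_ord mxE.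
  by rewrite rcoefN oppr_eq0.
have np := leq_rank_pchar.
have lead eps : eps = 1 \/ eps = -1 -> ~~ precedes eps (k, l, j : nat) (0, 0, n).
  have np' : (1 < n + (p - n))%N by rewrite subnKC.
  move=> he; apply: (proj2 (leads_factor_XpX he Qm sQ minimal_operator_monic _ np' e)) => //.
  exact: size_minimal_operator.
have := lead 1 (or_introl erefl); have := lead (-1) (or_intror erefl).
by rewrite /precedes /=; have := ltn_ord j; lia.
Qed.

End CyclicModule.

(** * Expansion in powers of q *)

Section Layers.
Variables (F : fieldType) (n : nat).
Local Notation O := (rig_annulus F).

Definition layer (k j : int) (x : 'rV[O]_n) : 'rV[F]_n := \row_i coef (x 0 i) k j.

Definition low (j : int) (x : 'rV[O]_n) : Prop := forall k l, l < j -> layer k l x = 0.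

Definition constant_term (B : 'M[O]_n) : 'M[F]_n := map_mx (fun f => coef f 0 0) B.

Lemma layerD k j x y : layer k j (x + y) = layer k j x + layer k j y.
Proof. by apply/rowP => i; rewrite !mxE Defs.coefD. Qed.

Lemma layer_constZ k j c x : layer k j (rig_const c *: x) = c *: layer k j x.
Proof. by apply/rowP => i; rewrite !mxE coef_constM. Qed.

Lemma layer0 k j : layer k j 0 = 0. Proof. by apply/rowP => i; rewrite !mxE. Qed.

Lemma layerP x y : (forall k j, layer k j x = layer k j y) -> x = y.
Proof.
move=> xy; apply/rowP => i; apply: rig_annulusP => k j.
by have /rowP/(_ i) := xy k j; rewrite !mxE.
Qed.

Lemma lowD j x y : low j x -> low j y -> low j (x + y).
Proof. by move=> lx ly k l lj; rewrite layerD lx ?ly ?addr0. Qed.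

Lemma low_constZ j c x : low j x -> low j (rig_const c *: x).
Proof. by move=> lx k l lj; rewrite layer_constZ lx ?scaler0. Qed.

Lemma low0 j : low j 0. Proof. by move=> k l _; apply: layer0. Qed.

Section Nabla.
Variable B : 'M[O]_n.
Hypothesis B_coef : forall i j k l, coef (B i j) k l != 0 -> 0 < l \/ l = 0 /\ k = 0.
Local Notation nabla := (nabla_along B Dt).
Local Notation C := (constant_term B).

(** On the lowest layer in [q] only the constant term of [B] is visible, and [nabla] acts on the
    part in [t^k] as [k + C]. *)
Lemma layer_nabla_low j x k l : low j x -> l <= j ->
  layer k l (nabla x) = k%:~R *: layer k l x + layer k l x *m C.
Proof.
move=> lx lj; rewrite nabla_along_Dt; apply/rowP => i; rewrite !mxE Defs.coefD coef_Dt.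
congr (_ + _); rewrite rcoef_sum; apply: eq_bigr => m _; rewrite !mxE Defs.coefM.
rewrite (@fsum_single _ _ (k, l)) /= ?subrr // => -[y1 y2] /=.
rewrite mulf_eq0 negb_or => /andP[hx /B_coef hB].
have : ~ (y2 < j) by move=> /(lx y1)/rowP/(_ m); rewrite !mxE => e; rewrite e eqxx in hx.
by move=> hj; congr pair; lia.
Qed.

Lemma low_nabla j x : low j x -> low j (nabla x).
Proof.
move=> lx k l lj; rewrite (layer_nabla_low k lx (ltW lj)) lx // scaler0 mul0mx addr0.
by [].
Qed.

Lemma nabla_shift_low j lam x : low j x -> low j (nabla x + rig_const lam *: x).
Proof. by move=> lx; apply: lowD; [apply: low_nabla|apply: low_constZ]. Qed.

Lemma nabla_const c x : nabla (rig_const c *: x) = rig_const c *: nabla x.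
Proof. by rewrite nablaZ Dt_const scale0r add0r. Qed.

Variable p : nat.
Hypotheses (pF : p \in [pchar F]) (nabla_p : forall x, iter p nabla x = nabla x).

Lemma constant_term_pchar (v : 'rV[F]_n) : iter p (mulmx^~ C) v = v *m C.
Proof.
pose x : 'rV[O]_n := map_mx (@rig_const F) v.
have lx : low 0 x.
  move=> k l l0; apply/rowP => i; rewrite !mxE coef_const [l == 0]lt_eqF // andbF.
  by rewrite mulr0.
have it m : low 0 (iter m nabla x) /\ layer 0 0 (iter m nabla x) = iter m (mulmx^~ C) v.
  elim: m => [|m [lm em]].
    by split=> //; apply/rowP => i; rewrite !mxE coef_const !eqxx mulr1.
  split; first exact: low_nabla.
  by rewrite iterS (layer_nabla_low _ lm) // scale0r add0r em.
have := proj2 (it p); rewrite nabla_p -[nabla x]/(iter 1 nabla x) (proj2 (it 1%N)) => <-.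
by [].
Qed.

(* Writing [nabla^m y = (- lam)^m y + z_m], the functional [u |-> layer k j u * xi] *)
(* takes [z_m] to [m (- lam)^(m-1)] times its value on [w]; and [z_p = w].          *)
Lemma unobstructed_pchar lam y j k (xi : 'cV[F]_n) (w := nabla y + rig_const lam *: y) :
    lam ^+ p = lam -> low j w -> C *m xi = - (k%:~R + lam) *: xi ->
  layer k j w *m xi = 0.
Proof.
move=> lamp lw Cxi.
have step z : low j z -> layer k j (nabla z) *m xi = - lam *: (layer k j z *m xi).
  move=> lz; rewrite (layer_nabla_low _ lz) // mulmxDl -mulmxA Cxi -scalemxAl -scalemxAr.
  by rewrite -scalerDl opprD addrA subrr add0r.
have ny : nabla y = rig_const (- lam) *: y + w.
  rewrite /w addrC -addrA -scalerDl [X in X *: _](_ : _ = 0) ?scale0r ?addr0 //.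
  by apply: rig_annulusP => k' j'; rewrite Defs.coefD !coef_const -mulrDl subrr mul0r.
have [z [ze [lz ez]]] : exists z, iter p nabla y = rig_const ((- lam) ^+ p) *: y + z /\
    low j z /\ layer k j z *m xi = (p%:R * (- lam) ^+ p.-1) *: (layer k j w *m xi).
  elim: p => [|m [z [hz [lz ez]]]].
    exists 0; split; last by split; [apply: low0|rewrite layer0 mul0mx mul0r scale0r].
    rewrite addr0 /= [X in X *: _](_ : _ = 1) ?scale1r //.
    by apply: rig_annulusP => k' j'; rewrite coef_const mul1r.
  exists (rig_const ((- lam) ^+ m) *: w + nabla z); split.
    have cE : rig_const ((- lam) ^+ m) * rig_const (- lam) = rig_const ((- lam) ^+ m.+1).
      by apply: rig_annulusP => k' j'; rewrite coef_constM !coef_const exprSr mulrA.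
    by rewrite iterS hz nablaD nabla_const {1}ny scalerDr scalerA cE -addrA.
  split; first by apply: lowD; [apply: low_constZ|apply: low_nabla].
  rewrite layerD layer_constZ mulmxDl step // ez scalerA -scalemxAl -scalerDl.
  congr (_ *: _); case: m {hz ez} => [|m] /=; first by rewrite mul0r mulr0 addr0 mul1r.
  by rewrite exprS -[m.+2]addn1 natrD; ring.
have wz : w = z.
  apply: (addrI (rig_const (- lam) *: y)); rewrite -ny -nabla_p ze.
  by rewrite (_ : (- lam) ^+ p = - lam) // -(pFrobenius_autE pF) rmorphN /= pFrobenius_autE lamp.
by rewrite {1}wz ez (pcharf0 pF) mul0r scale0r.
Qed.

End Nabla.
End Layers.

(** * Reduction modulo a prime *)

Section Reduction.
Variables (K : fieldType) (S : {pred K}) (S_ring : GRing.subring_closed S).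
Variables (P : set K) (F : fieldType) (r : K -> F) (rP : residue_field S P r).
Local Notation red := (reduces_to S r).

Let S1 : 1 \in S. Proof. by case: S_ring. Qed.
Let SB : {in S &, forall x y, x - y \in S}. Proof. by case: S_ring. Qed.
Let SM : {in S &, forall x y, x * y \in S}. Proof. by case: S_ring. Qed.
Let S0 : 0 \in S. Proof. by rewrite -(subrr 1) SB. Qed.
Let SN : {in S, forall x, - x \in S}. Proof. by move=> x xS; rewrite -sub0r SB. Qed.
Let SD : {in S &, forall x y, x + y \in S}.
Proof. by move=> x y xS yS; rewrite -[y]opprK SB ?SN. Qed.

Lemma residue0 : r 0 = 0.
Proof. by rewrite -(subrr 1) (residueB rP) // subrr. Qed.

Lemma residueN : {in S, forall x, r (- x) = - r x}.
Proof. by move=> x xS; rewrite -sub0r (residueB rP) // residue0 sub0r. Qed.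

Lemma residueD : {in S &, forall x y, r (x + y) = r x + r y}.
Proof.
by move=> x y xS yS; rewrite -[y]opprK (residueB rP) ?SN // residueN ?SN // !opprK.
Qed.

Lemma residue_neq0 x : r x != 0 -> x != 0.
Proof. by apply: contraNneq => ->; rewrite residue0. Qed.

Lemma reduces_to_S x : x \in S -> red x (r x).
Proof. by move=> xS; exists x, 1; rewrite (residue1 rP) !divr1 oner_eq0; split. Qed.

Lemma reduces_to_unique a b b' : red a b -> red a b' -> b = b'.
Proof.
move=> [x [y [xS yS ry -> ->]]] [x' [y' [xS' yS' ry' e ->]]].
have := residue_neq0 ry; have := residue_neq0 ry' => y0' y0.
apply/eqP; rewrite eqr_div // -!(residueM rP) //; apply/eqP; congr r.
by apply/eqP; rewrite -eqr_div // e.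
Qed.

Lemma reduces_toD a b a' b' : red a b -> red a' b' -> red (a + a') (b + b').
Proof.
move=> [x [y [xS yS ry -> ->]]] [x' [y' [xS' yS' ry' -> ->]]].
have := residue_neq0 ry; have := residue_neq0 ry' => y0' y0.
exists (x * y' + x' * y), (y * y'); split; rewrite ?SD ?SM // ?(residueM rP) ?mulf_neq0 //.
  by rewrite addf_div.
by rewrite residueD ?SM // !(residueM rP) // addf_div.
Qed.

Lemma reduces_toN a b : red a b -> red (- a) (- b).
Proof.
move=> [x [y [xS yS ry -> ->]]]; exists (- x), y; split; rewrite ?SN ?mulNr //.
by rewrite residueN // mulNr.
Qed.

Lemma reduces_toM a b a' b' : red a b -> red a' b' -> red (a * a') (b * b').
Proof.
move=> [x [y [xS yS ry -> ->]]] [x' [y' [xS' yS' ry' -> ->]]].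
exists (x * x'), (y * y'); split; rewrite ?SM ?(residueM rP) ?mulf_neq0 //.
  by rewrite mulf_div.
by rewrite mulf_div.
Qed.

Lemma reduces_toV a b : red a b -> b != 0 -> red a^-1 b^-1.
Proof.
move=> [x [y [xS yS ry -> ->]]]; rewrite mulf_eq0 negb_or => /andP[rx _].
by exists y, x; rewrite !invf_div; split.
Qed.

Lemma reduces_to0 : red 0 0. Proof. by have := reduces_to_S S0; rewrite residue0. Qed.

Lemma reduces_to1 : red 1 1. Proof. by have := reduces_to_S S1; rewrite (residue1 rP). Qed.

Lemma reduces_to_nat m : red m%:R m%:R.
Proof.
elim: m => [|m IH]; first exact: reduces_to0.
by rewrite !mulrS; apply: reduces_toD IH; apply: reduces_to1.
Qed.

Lemma reduces_to_int z : red z%:~R z%:~R.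
Proof.
case: z => m; first exact: reduces_to_nat.
by rewrite NegzE !mulrNz; apply/reduces_toN/reduces_to_nat.
Qed.

Lemma reduces_to_ratr q : (denq q)%:~R != 0 :> F -> red (ratr q) (ratr q).
Proof.
move=> dq; apply: reduces_toM; first exact: reduces_to_int.
by apply: reduces_toV => //; apply: reduces_to_int.
Qed.

Lemma reduces_to_sum (I : Type) (s : seq I) (p : pred I) (a : I -> K) (b : I -> F) :
  (forall i, red (a i) (b i)) -> red (\sum_(i <- s | p i) a i) (\sum_(i <- s | p i) b i).
Proof.
by move=> ab; elim/big_rec2: _ => [|i x y _]; [apply: reduces_to0|apply: reduces_toD].
Qed.

Definition reduces_fun (f : rig_annulus K) (g : rig_annulus F) : Prop :=
  forall k l, red (coef f k l) (coef g k l).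

Lemma reduces_funD f g f' g' : reduces_fun f g -> reduces_fun f' g' ->
  reduces_fun (f + f') (g + g').
Proof. by move=> fg fg' k l; rewrite !Defs.coefD; apply: reduces_toD. Qed.

Lemma reduces_funM f g f' g' : reduces_fun f g -> reduces_fun f' g' ->
  reduces_fun (f * f') (g * g').
Proof.
move=> fg fg' k l; rewrite !Defs.coefM.
have fin (T : fieldType) (a b : rig_annulus T) :=
  @conv_finite T _ _ k l (rig_lowfin a) (rig_lowfin b).
have fA : finite_set ([set x : int * int | coef f x.1 x.2 * coef f' (k - x.1) (l - x.2) != 0] `|`
  [set x : int * int | coef g x.1 x.2 * coef g' (k - x.1) (l - x.2) != 0]).
  by rewrite finite_setU.
rewrite !(fsumE fA); [|by move=> x ?; right|by move=> x ?; left].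
by apply: reduces_to_sum => x; apply: reduces_toM.
Qed.

Lemma reduces_fun_Dt f g : reduces_fun f g -> reduces_fun (Dt f) (Dt g).
Proof. by move=> fg k l; rewrite !coef_Dt; apply: reduces_toM => //; apply: reduces_to_int. Qed.

Lemma reduces_fun_const a b : red a b -> reduces_fun (rig_const a) (rig_const b).
Proof. by move=> ab k l; rewrite !coef_const; apply: reduces_toM => //; apply: reduces_to_nat. Qed.

Lemma reduces_fun_sum (I : Type) (s : seq I) (p : pred I) f g :
  (forall i : I, reduces_fun (f i) (g i)) ->
  reduces_fun (\sum_(i <- s | p i) f i) (\sum_(i <- s | p i) g i).
Proof. by move=> fg k l; rewrite !rcoef_sum; apply: reduces_to_sum => i; apply: fg. Qed.

Lemma reduces_nabla n (A : 'M[rig_annulus K]_n) (B : 'M[rig_annulus F]_n)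
    (x : 'rV[rig_annulus K]_n) (y : 'rV[rig_annulus F]_n) :
    reduces_to_mx S r A B -> (forall i, reduces_fun (x 0 i) (y 0 i)) ->
  forall i, reduces_fun (nabla_along A Dt x 0 i) (nabla_along B Dt y 0 i).
Proof.
move=> AB xy i; rewrite !nabla_along_Dt !mxE; apply: reduces_funD.
  exact: reduces_fun_Dt.
by apply: reduces_fun_sum => j; apply: reduces_funM.
Qed.

Lemma reduces_mulmx m n q (A : 'M[K]_(m, n)) (B : 'M[K]_(n, q))
    (A' : 'M[F]_(m, n)) (B' : 'M[F]_(n, q)) :
    (forall i j, red (A i j) (A' i j)) -> (forall i j, red (B i j) (B' i j)) ->
  forall i j, red ((A *m B) i j) ((A' *m B') i j).
Proof.
by move=> hA hB i j; rewrite !mxE; apply: reduces_to_sum => l; apply: reduces_toM.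
Qed.

End Reduction.

(** [s] is the product of the numerators and denominators of the nonzero elements of [l]. *)
Lemma avoid_finite (K : fieldType) (S : {pred K}) : fingen_Zalgebra S -> has_fraction_field S ->
  forall l : seq K, exists s, [/\ s \in S, s != 0 &
    forall (P : set K) (F : fieldType) (r : K -> F), residue_field S P r -> r s != 0 ->
      forall a, a \in l -> exists2 b, reduces_to S r a b & a != 0 -> b != 0].
Proof.
move=> [S_ring _] S_frac; have [S1 SB SM] := S_ring.
elim=> [|a l [s [sS s0 sP]]].
  by exists 1; rewrite oner_eq0; split.
have [x [y [xS yS y0 axy]]] := S_frac a.
have [a0|a0] := eqVneq a 0.
  exists s; split=> // P F r rP rs b; rewrite inE => /predU1P[->|bl]; last exact: sP rP rs b bl.
  by exists 0; rewrite ?a0 ?eqxx //; apply: (reduces_to0 S_ring rP).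
have x0 : x != 0 by apply: contraNneq a0 => x0; rewrite axy x0 mul0r.
exists (x * y * s); split; rewrite ?SM ?mulf_neq0 // => P F r rP.
rewrite !(residueM rP) ?SM // !mulf_eq0 !negb_or => /andP[/andP[rx ry] rs] b.
rewrite inE => /predU1P[->|bl]; last exact: sP rP rs b bl.
exists (r x / r y); first by exists x, y.
by move=> _; rewrite mulf_neq0 ?invr_eq0.
Qed.

(** * q-adic limits *)

Section QAdic.
Variable F : fieldType.
Local Notation O := (rig_annulus F).
Implicit Types f g : O.

Definition vanishes_below (a : int) f : Prop := forall k l, l < a -> coef f k l = 0.

Lemma vanishes_belowM a b f g : vanishes_below a f -> vanishes_below b g ->
  vanishes_below (a + b) (f * g).
Proof.
move=> fa gb k l lab; rewrite Defs.coefM; apply: fsbig1 => -[x1 x2] _ /=.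
have [lt|le] := ltrP x2 a; first by rewrite fa ?mul0r.
by rewrite gb ?mulr0 //; lia.
Qed.

(** Completeness for the [q]-adic topology: the coefficients at [q^l] are final from [f l] on. *)
Lemma rig_limit (f : nat -> O) :
    (forall m, rig_le1 (f m)) ->
    (forall m k (l : nat), (l <= m)%N -> coef (f m.+1) k l = coef (f m) k l) ->
  exists g, rig_le1 g /\ forall m, vanishes_below m.+1%:Z (g - f m).
Proof.
move=> f0 fs.
pose a (k l : int) : F := if l < 0 then 0 else coef (f `|l|%N) k l.
have la : lowfin a.
  move=> M.
  apply: (@sub_finite_set _ _ (\bigcup_(i in `I_`|M|) low_support (coef (f i)) M)).
    move=> [k l] /= [lM]; rewrite /a; case: ltP => [|l0 c]; first by rewrite eqxx.
    exists `|l|%N; last by split.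
    by move: lM l0; rewrite /mkset /=; lia.
  by apply: bigcup_finite; [apply: finite_II|move=> i _; apply: rig_lowfin].
have stable m k (l : nat) : (l <= m)%N -> coef (f m) k l = coef (f l) k l.
  elim: m => [|m IH]; first by rewrite leqn0 => /eqP ->.
  by rewrite leq_eqVlt => /predU1P[->//|lm]; rewrite fs // IH.
exists (rig_mk la); split=> [k l l0|m k l lm]; first by rewrite /= /a l0.
rewrite rcoefB /= /a; case: ltP => [l0|]; first by rewrite (f0 m) // subr0.
by case: l lm => // l lm _; rewrite (stable m) ?subrr //; lia.
Qed.

Definition reduces_mod_q f (c : F) : Prop :=
  rig_le1 f /\ forall k, coef f k 0 = c * (k == 0)%:R.

Lemma reduces_mod_q_const c : reduces_mod_q (rig_const c) c.
Proof.
split=> [k l l0|k]; rewrite coef_const; first by rewrite [l == 0]lt_eqF // andbF mulr0.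
by rewrite eqxx andbT.
Qed.

Lemma reduces_mod_qD f g c d : reduces_mod_q f c -> reduces_mod_q g d ->
  reduces_mod_q (f + g) (c + d).
Proof.
move=> [f0 fc] [g0 gd]; split=> [k l l0|k]; rewrite Defs.coefD; first by rewrite f0 ?g0 ?addr0.
by rewrite fc gd mulrDl.
Qed.

Lemma reduces_mod_qM f g c d : reduces_mod_q f c -> reduces_mod_q g d ->
  reduces_mod_q (f * g) (c * d).
Proof.
move=> [f0 fc] [g0 gd]; split=> [|k].
  by have := vanishes_belowM f0 g0; rewrite addr0.
rewrite Defs.coefM (@fsum_single _ _ (0, 0)).
  by rewrite /= fc eqxx mulr1 !subr0 gd mulrA.
move=> [y1 y2] /=; rewrite mulf_eq0 negb_or => /andP[fy gy].
have hf : ~ (y2 < 0) by move=> h; rewrite f0 ?eqxx // in fy.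
have hg : ~ (0 - y2 < 0) by move=> h; rewrite g0 ?eqxx // in gy.
have y20 : y2 = 0 by lia.
rewrite y20; congr pair; apply/eqP; apply: contraNT fy => y1N.
by rewrite y20 fc (negPf y1N) mulr0.
Qed.

Lemma reduces_mod_q_sum (I : Type) (s : seq I) (p : pred I) (f : I -> O) c :
  (forall i, reduces_mod_q (f i) (c i)) ->
  reduces_mod_q (\sum_(i <- s | p i) f i) (\sum_(i <- s | p i) c i).
Proof.
move=> fc; elim/big_rec2: _ => [|i x y _]; last by move=> h; apply: reduces_mod_qD.
by split=> [k l l0|k] //; rewrite mul0r.
Qed.

Lemma reduces_mod_q1 : reduces_mod_q 1 1.
Proof.
split=> [k l l0|k]; rewrite rcoef1; first by rewrite [l == 0]lt_eqF // andbF.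
by rewrite eqxx andbT mul1r.
Qed.

Lemma reduces_mod_q_prod (I : Type) (s : seq I) (p : pred I) (f : I -> O) c :
  (forall i, reduces_mod_q (f i) (c i)) ->
  reduces_mod_q (\prod_(i <- s | p i) f i) (\prod_(i <- s | p i) c i).
Proof.
move=> fc; elim/big_rec2: _ => [|i x y _]; first exact: reduces_mod_q1.
by move=> h; apply: reduces_mod_qM.
Qed.

Lemma reduces_mod_q_sign (b : nat) : reduces_mod_q ((-1) ^+ b) ((-1) ^+ b).
Proof.
elim: b => [|b IH]; first exact: reduces_mod_q1.
rewrite !exprS; apply: reduces_mod_qM => //; split=> [k l l0|k].
  by rewrite rcoefN (proj1 reduces_mod_q1) ?oppr0.
by rewrite rcoefN (proj2 reduces_mod_q1) mulN1r mul1r.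
Qed.

Lemma reduces_mod_q_det n (A : 'M[O]_n) (C : 'M[F]_n) :
  (forall i j, reduces_mod_q (A i j) (C i j)) -> reduces_mod_q (\det A) (\det C).
Proof.
move=> AC; apply: reduces_mod_q_sum => s; apply: reduces_mod_qM.
  exact: reduces_mod_q_sign.
by apply: reduces_mod_q_prod => i.
Qed.

(** Geometric series: [1 - f / c] is divisible by [q]. *)
Lemma reduces_mod_q_unit f c : reduces_mod_q f c -> c != 0 ->
  exists2 g, rig_le1 g & f * g = 1.
Proof.
move=> [f0 fc] c0; pose h := 1 - rig_const c^-1 * f.
have h1 : vanishes_below 1 h.
  move=> k l l1; rewrite rcoefB rcoef1 coef_constM.
  have [->|lN] := eqVneq l 0; first by rewrite fc mulKf // andbT subrr.
  by rewrite f0 ?mulr0 ?subr0 ?andbF //; move: l1 lN; clear; lia.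
have hX i : vanishes_below i%:Z (h ^+ i).
  elim: i => [|i IH]; first by move=> k l l0; rewrite rcoef1 [l == 0]lt_eqF // andbF.
  by rewrite exprS -(_ : 1 + i%:Z = i.+1%:Z) //; apply: vanishes_belowM.
pose s m := (\sum_(i < m.+1) h ^+ i) * rig_const c^-1.
have s0 m : rig_le1 (s m).
  have hs : vanishes_below 0 (\sum_(i < m.+1) h ^+ i).
    move=> k l l0; rewrite rcoef_sum big1 // => i _; apply: hX; lia.
  by have := vanishes_belowM hs (proj1 (reduces_mod_q_const c^-1)); rewrite addr0.
have [|g [g0 gP]] := rig_limit s0.
  move=> m k l lm; rewrite /s big_ord_recr mulrDl Defs.coefD.
  have := vanishes_belowM (hX m.+1) (proj1 (reduces_mod_q_const c^-1)).
  by rewrite addr0 => ->; rewrite ?addr0 //; lia.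
exists g => //; apply/eqP; rewrite -subr_eq0; apply/eqP/rig_annulusP => k l.
have cc : rig_const c * rig_const c^-1 = 1.
  by apply: rig_annulusP => k' l'; rewrite coef_constM coef_const mulrA divff ?mul1r.
have fE : f = rig_const c * (1 - h) by rewrite /h opprB addrC subrK mulrA cc mul1r.
have fs m : f * s m = 1 - h ^+ m.+1.
  rewrite -[in RHS](expr1n _ m.+1) subrXX fE /s.
  under [in RHS]eq_bigr do rewrite expr1n mul1r.
  by rewrite [_ * rig_const c^-1]mulrC mulrACA cc mul1r.
have [l0|] := ltP l 0.
  by rewrite rcoefB rcoef1 [l == 0]lt_eqF // andbF subr0; have := vanishes_belowM f0 g0;
    rewrite addr0 => ->.
case: l => // l _.
have -> : f * g - 1 = f * (g - s l) - h ^+ l.+1 by rewrite mulrBr fs;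
  move: (h ^+ _) (f * g) => u v; ring.
rewrite rcoefB (hX l.+1) ?subr0 ?rcoef0; last by lia.
by have := vanishes_belowM f0 (gP l); rewrite add0r => ->; rewrite // ltz_nat.
Qed.

End QAdic.

(** * Pullback along t = s^m *)

Section PullbackMorphism.
Variables (K : fieldType) (L : fieldExtType K) (m e : nat).
Hypotheses (m_gt0 : (0 < m)%N) (e_gt0 : (0 < e)%N).
Local Notation pb := (pullback L m e).
Implicit Types f g : rig_annulus K.

Let m0 : m%:Z != 0. Proof. by rewrite -lt0n. Qed.
Let e0 : e%:Z != 0. Proof. by rewrite -lt0n. Qed.

Lemma coef_pullback f k l : coef (pb f) (m%:Z * k) (e%:Z * l) = (coef f k l)%:A.
Proof. by rewrite /= /pullback_coef !dvdz_mulr // ![_%:Z * _]mulrC !mulzK. Qed.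

Lemma coef_pullback0 f k l : ~ (exists k' l', k = m%:Z * k' /\ l = e%:Z * l') ->
  coef (pb f) k l = 0.
Proof.
move=> h; rewrite /= /pullback_coef; case: ifP => // /andP[/dvdzP[k' hk] /dvdzP[l' hl]].
by case: h; exists k', l'; rewrite hk hl ![_%:Z * _]mulrC.
Qed.

Lemma pullbackP (f : rig_annulus L) g :
    (forall k l, coef f (m%:Z * k) (e%:Z * l) = (coef g k l)%:A) ->
    (forall k l, ~ (exists k' l', k = m%:Z * k' /\ l = e%:Z * l') -> coef f k l = 0) ->
  f = pb g.
Proof.
move=> h1 h2; apply: rig_annulusP => k l.
have [[k' [l' [-> ->]]]|no] := pselect (exists k' l', k = m%:Z * k' /\ l = e%:Z * l').
  by rewrite h1 coef_pullback.
by rewrite h2 // coef_pullback0.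
Qed.

Lemma pullbackD f g : pb f + pb g = pb (f + g).
Proof.
apply: pullbackP => k l; first by rewrite !Defs.coefD !coef_pullback scalerDl.
by move=> no; rewrite Defs.coefD !coef_pullback0 ?addr0.
Qed.

Lemma pullback0 : pb 0 = 0.
Proof. by apply: (addrI (pb 0)); rewrite pullbackD !addr0. Qed.

Lemma pullback_sum (I : Type) (s : seq I) (p : pred I) (f : I -> rig_annulus K) :
  pb (\sum_(i <- s | p i) f i) = \sum_(i <- s | p i) pb (f i).
Proof. by elim/big_rec2: _ => [|i x y _ <-]; rewrite ?pullback0 ?pullbackD. Qed.

Lemma pullback1 : pb 1 = 1.
Proof.
apply/esym/pullbackP => k l.
  rewrite !rcoef1 !mulf_eq0 (negPf m0) (negPf e0) /=.
  by case: (_ && _); rewrite ?scale1r ?scale0r.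
move=> no; rewrite rcoef1; have [k0|//] := eqVneq k 0; have [l0|//] := eqVneq l 0.
by case: no; exists 0, 0; rewrite !mulr0.
Qed.

Lemma pullbackM f g : pb f * pb g = pb (f * g).
Proof.
have supp (f' : rig_annulus K) k l : coef (pb f') k l != 0 -> exists k' l', k =
  m%:Z * k' /\ l = e%:Z * l'.
  by move=> c; apply: contrapT => /(coef_pullback0 f') z; rewrite z eqxx in c.
pose h (x : int * int) := (m%:Z * x.1, e%:Z * x.2).
apply: pullbackP => k l; last first.
  move=> no; rewrite Defs.coefM; apply: fsbig1 => -[x1 x2] _; apply: contrapT => /eqP.
  rewrite mulf_eq0 negb_or => /andP[/supp[y1 [y2 [e1 e2]]] /supp[z1 [z2 [f1 f2]]]].
  by apply: no; exists (y1 + z1), (y2 + z2); rewrite !mulrDr -e1 -e2 -f1 -f2 !subrKC.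
rewrite !Defs.coefM.
pose A := [set x : int * int | coef f x.1 x.2 * coef g (k - x.1) (l - x.2) != 0].
have fA : finite_set A by apply: conv_finite; apply: rig_lowfin.
have prodE x : coef (pb f) (h x).1 (h x).2 * coef (pb g) (m%:Z * k - (h x).1) (e%:Z * l - (h x).2) =
    (coef f x.1 x.2 * coef g (k - x.1) (l - x.2))%:A.
  by rewrite -!mulrBr !coef_pullback -scalerAl mul1r scalerA.
rewrite -(@fsbig_widen _ _ _ _ (h @` A) setT) //=; last first.
  move=> [x1 x2] [_ /= nA]; apply: contrapT => /eqP c.
  move: (c); rewrite mulf_eq0 negb_or => /andP[/supp[y1 [y2 [e1 e2]]] _].
  apply: nA; exists (y1, y2); last by rewrite /h -e1 -e2.
  move: c; rewrite e1 e2 (prodE (y1, y2)); apply: contraNN => /eqP ->.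
  by rewrite scale0r.
rewrite (reindex_fsbig h A) /=; last first.
  by apply: inj_bij => -[x1 x2] [y1 y2] _ _ [/(mulfI m0) -> /(mulfI e0) ->].
under eq_fsbigr do rewrite prodE.
rewrite (fsumE fA) // fsbig_finite // scaler_suml.
by [].
Qed.

Lemma Dt_pullback f : Dt (pb f) = m%:R * pb (Dt f).
Proof.
have -> : m%:R * pb (Dt f) = rig_const m%:R * pb (Dt f).
  by congr (_ * _); elim: (m) => [|n IH]; apply: rig_annulusP => k l; rewrite ?coef_const ?mul0r //;
  rewrite mulrS Defs.coefD IH rcoef1 !coef_const mulrS mulrDl mul1r.
apply: rig_annulusP => k l; rewrite coef_Dt coef_constM.
have [[k' [l' [-> ->]]]|no] := pselect (exists k' l', k = m%:Z * k' /\ l = e%:Z * l').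
  by rewrite !coef_pullback coef_Dt intrM -scalerA scaler_int -[_%:A *~ k']mulrzl mulrA.
by rewrite !coef_pullback0 ?mulr0.
Qed.

Lemma pullback_le1 f : rig_le1 f -> rig_le1 (pb f).
Proof.
move=> f0 k l l0.
have [[k' [l' [hk hl]]]|no] := pselect (exists k' l', k = m%:Z * k' /\ l = e%:Z * l').
  by rewrite hk hl coef_pullback f0 ?scale0r //; nia.
by rewrite coef_pullback0.
Qed.

End PullbackMorphism.

(** * The constant term *)

Definition good_reduction (K : fieldType) (S : {pred K}) n (A : 'M[rig_annulus K]_n)
    (P : set K) : Prop :=
  exists (F : fieldType) (r : K -> F) (B : 'M[rig_annulus F]_n) (p : nat),
    [/\ residue_field S P r, reduces_to_mx S r A B, p \in [pchar F] &
        forall x, p_curvature p B x = 0].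

Section GoodReduction.
Variables (K : fieldType) (E : numClosedFieldType) (iota : {rmorphism K -> E}).
Variables (S : {pred K}) (S_fingen : fingen_Zalgebra S) (S_frac : has_fraction_field S).
Variables (n' : nat).
Local Notation n := n'.+1.
Variable A : 'M[rig_annulus K]_n.
Hypothesis A_companion : forall i j : 'I_n, (i.+1 < n)%N -> A i j = (i.+1 == j)%:R.
Hypothesis A_good : almost_all_primes S (good_reduction S A).
Local Notation C := (constant_term A).

Let S_ring : GRing.subring_closed S := proj1 S_fingen.

(** The transfer principle from characteristic [p] to [K]: finitely many elements reduce at one good
    prime, and those that are nonzero stay nonzero. *)
Lemma avoid_good_reduction (l : seq K) :
  exists (P : set K) (F : fieldType) (r : K -> F) (B : 'M[rig_annulus F]_n) (p : nat),
    [/\ residue_field S P r, reduces_to_mx S r A B, p \in [pchar F],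
      forall x, iter p (nabla_along B Dt) x = nabla_along B Dt x &
      forall a, a \in l -> exists2 b, reduces_to S r a b & a != 0 -> b != 0].
Proof.
have [s [sS s0 sP]] := avoid_finite S_fingen S_frac l.
have [P [F [r [B [p [rP AB pF pc]]]]] Ps] := good_prime iota S_fingen A_good sS s0.
exists P, F, r, B, p; split=> //; first exact: iter_nabla_p_curvature.
by apply: (sP _ _ _ rP); apply/eqP => /(residue_ker rP sS).
Qed.

Section Fibre.
Variables (P : set K) (F : fieldType) (r : K -> F) (B : 'M[rig_annulus F]_n) (p : nat).
Hypotheses (rP : residue_field S P r) (AB : reduces_to_mx S r A B) (pF : p \in [pchar F]).
Hypothesis nabla_p : forall x, iter p (nabla_along B Dt) x = nabla_along B Dt x.

Lemma fibre_companion (i j : 'I_n) : (i.+1 < n)%N -> B i j = (i.+1 == j)%:R.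
Proof.
move=> ilt; apply: rig_annulusP => k l; apply: (reduces_to_unique S_ring rP (AB i j k l)).
rewrite A_companion //; case: (_ == _); rewrite ?rcoef1 ?rcoef0.
  exact: (reduces_to_nat S_ring rP).
exact: (reduces_to0 S_ring rP).
Qed.

Lemma fibre_coef i j k l : coef (B i j) k l != 0 -> 0 < l \/ l = 0 /\ k = 0.
Proof.
apply: (companion_coef_p_curvature fibre_companion (prime_gt1 (pcharf_prime pF)) nabla_p).
Qed.

Lemma fibre_constant_term i j : reduces_to S r (C i j) (constant_term B i j).
Proof. by rewrite !mxE. Qed.

Lemma fibre_constant_term_pchar : constant_term B ^+ p = constant_term B.
Proof.
have it m (v : 'rV[F]_n) : iter m (mulmx^~ (constant_term B)) v = v *m constant_term B ^+ m.
  elim: m => [|m IH]; first by rewrite mulmx1.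
  by rewrite iterS IH exprSr mulmxA.
apply/row_matrixP => i; rewrite !rowE -it.
exact: (constant_term_pchar fibre_coef nabla_p).
Qed.

End Fibre.

(** A nonzero coefficient stays nonzero at some good prime, where its position is constrained by
    [fibre_coef]. *)
Lemma generic_coef i j k l : coef (A i j) k l != 0 -> 0 < l \/ l = 0 /\ k = 0.
Proof.
move=> a0; have [P [F [r [B [p [rP AB pF nabla_p al]]]]]] :=
  avoid_good_reduction [:: coef (A i j) k l].
have [b hb /(_ a0) b0] := al _ (mem_head _ _).
apply: (fibre_coef rP AB pF nabla_p (i := i) (j := j)).
by rewrite (reduces_to_unique S_ring rP (AB i j k l) hb).
Qed.

Lemma common_denominator : exists s, [/\ s \in S, s != 0 & forall i j, s * C i j \in S].
Proof.
have [S1 SB SM] := S_ring.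
have [s [sS s0 sP]] : exists s, [/\ s \in S, s != 0 &
    forall a, a \in [seq C i j | i <- enum 'I_n, j <- enum 'I_n] -> s * a \in S].
  elim: [seq C i j | i <- enum 'I_n, j <- enum 'I_n] => [|a l [s [sS s0 sP]]];
    first by exists 1; rewrite oner_eq0; split.
  have [x [y [xS yS y0 ->]]] := S_frac a.
  exists (s * y); split; rewrite ?SM ?mulf_neq0 // => b.
  rewrite inE => /predU1P[->|/sP bS]; first by rewrite mulrACA mulrA mulfK // SM.
  by rewrite mulrAC SM.
exists s; split=> // i j; apply: sP; apply: allpairs_f; exact: mem_enum.
Qed.

(** Kronecker's theorem applies because a specialization [a] of [x] is an eigenvalue of the reduced
    [C], and [C^p = C] there. The matrix is scaled by a common denominator [s], as [phi] is only
    controlled on elements of [S]. *)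
Lemma rational_eigenvalue (x : E) : root (char_poly (map_mx iota C)) x -> exists q : rat, x =
  ratr q.
Proof.
move=> xroot; have [S1 SB SM] := S_ring.
have [s [sS s0 sC]] := common_denominator.
have [s' [p0 [s'x hP]]] := specialization iota S_fingen A_good x sS s0.
apply: (kronecker s'x (p0 := p0)) => q k a qp p0q qk ka s'a.
have [P [R1 [e1 [phi [[F [r [B [p [rP AB pF pc]]]]] ker onto [y hy py] [snz PS]]]]]] :=
  hP q k a qp p0q qk ka s'a.
have nabla_p := iter_nabla_p_curvature pF pc.
have Cp := fibre_constant_term_pchar rP AB pF nabla_p.
have [st hst] := onto s sS; have sigma0 := snz st hst.
have inj u v : e1 u = e1 v -> phi u = phi v.
  by move=> uv; apply/eqP; rewrite -subr_eq0 -rmorphB ker // rmorphB uv subrr.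
have S0 : 0 \in S by rewrite -(subrr (1 : K)) SB.
have SD u v : u \in S -> v \in S -> u + v \in S.
  by move=> uS vS; rewrite -[v]opprK SB // -sub0r SB.
have Snat m : m%:R \in S by elim: m => [|m IH]; rewrite // mulrS SD.
have residue_phi z : z \in S -> r z = 0 -> forall u, e1 u = iota z -> phi u = 0.
  by move=> zS rz; apply: PS; apply/(residue_ker rP zS).
(* Since [p] vanishes in the residue field it lies in [P S], so [phi] kills it. *)
have qE : q = p.
  have /eqP : phi p%:R = 0.
    apply: (residue_phi p%:R); rewrite ?rmorph_nat //.
    rewrite -(pcharf0 pF); apply: (reduces_to_unique S_ring rP).
      exact: (reduces_to_S S_ring rP (Snat p)).
    exact: (reduces_to_nat S_ring rP p).
  rewrite rmorph_nat -(dvdn_pcharf qk) dvdn_prime2 ?(pcharf_prime pF) //.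
  by move=> /eqP.
have [M ME] : exists M : 'M[K]_n, M = s *: C by exists (s *: C).
have MS i j : M i j \in S by rewrite ME mxE.
have /choice[Mt0 hMt0] : forall ij : 'I_n * 'I_n, exists u, e1 u = iota (M ij.1 ij.2).
  by move=> [i j]; apply: onto.
pose Mt : 'M[R1]_n := \matrix_(i, j) Mt0 (i, j).
have hMt : map_mx e1 Mt = map_mx iota M by apply/matrixP => i j;
  rewrite [LHS]mxE [Mt _ _]mxE hMt0 [RHS]mxE.
have Ssum (f : 'I_n -> K) : (forall i, f i \in S) -> \sum_i f i \in S.
  by move=> fS; elim/big_rec: _ => // i u _ uS; rewrite SD.
have MXS m i j : (M ^+ m) i j \in S.
  elim: m i j => [|m IH] i j; first by rewrite expr0 mxE Snat.
  by rewrite exprS mxE Ssum // => l; rewrite SM.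
have SX m : s ^+ m \in S by elim: m => [|m IH]; rewrite ?exprS ?SM.
have redM i j : reduces_to S r (M i j) ((r s *: constant_term B) i j).
  rewrite ME !mxE; apply: (reduces_toM S_ring rP); first exact: (reduces_to_S S_ring rP).
  exact: AB.
have redX m i j : reduces_to S r ((M ^+ m) i j) (((r s *: constant_term B) ^+ m) i j).
  elim: m i j => [|m IH] i j.
    by rewrite !expr0 !mxE; apply: (reduces_to_nat S_ring rP).
  by rewrite !exprS; apply: (reduces_mulmx S_ring rP).
have p_gt0 : (0 < p)%N by rewrite prime_gt0 // (pcharf_prime pF).
(* The relation [C^p = C] multiplied by [s ^+ p]. *)
have phiM : map_mx phi Mt ^+ p = phi st ^+ p.-1 *: map_mx phi Mt.
  pose D i j := (M ^+ p) i j - s ^+ p.-1 * M i j.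
  have DS i j : D i j \in S by rewrite SB // SM ?SX.
  have rD i j : r (D i j) = 0.
    have h1 : reduces_to S r (D i j) (((r s *: constant_term B) ^+ p) i j -
        r (s ^+ p.-1) * (r s *: constant_term B) i j).
      apply: (reduces_toD S_ring rP) => //; apply: (reduces_toN S_ring rP).
      by apply: (reduces_toM S_ring rP) => //; apply: (reduces_to_S S_ring rP).
    rewrite (reduces_to_unique S_ring rP (reduces_to_S S_ring rP (DS i j)) h1).
    have -> : r (s ^+ p.-1) = r s ^+ p.-1.
      elim: p.-1 => [|m IH]; first by rewrite (residue1 rP).
      by rewrite !exprS (residueM rP) ?SX // IH.
    by rewrite exprZn Cp !mxE mulrA -exprSr prednK // subrr.
  have -> : map_mx phi Mt ^+ p = map_mx phi (Mt ^+ p) by rewrite rmorphXn.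
  apply/matrixP => i j; rewrite [LHS]mxE [RHS]mxE [X in _ * X]mxE.
  apply/eqP; rewrite -subr_eq0 -rmorphXn -rmorphM -rmorphB; apply/eqP.
  apply: (residue_phi _ (DS i j) (rD i j)); rewrite /D rmorphB !rmorphM !rmorphXn /= hst.
  have -> : e1 ((Mt ^+ p) i j) = iota ((M ^+ p) i j).
    have : map_mx e1 (Mt ^+ p) = map_mx iota (M ^+ p) by rewrite !rmorphXn /= hMt.
    by move/matrixP/(_ i j); rewrite [LHS]mxE [RHS]mxE.
  have -> : e1 (Mt i j) = iota (M i j); last by rewrite rmorphB rmorphM rmorphXn.
  by move/matrixP/(_ i j): hMt; rewrite [LHS]mxE [RHS]mxE.
(* The characteristic equation of [x] holds in [E], so its lift to [R1] lies in the kernel of [e1],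
   which [phi] kills. *)
have detM : \det ((a * phi st)%:M - map_mx phi Mt) = 0.
  have -> : (a * phi st)%:M - map_mx phi Mt = map_mx phi ((y * st)%:M - Mt).
    by rewrite raddfB /= map_scalar_mx rmorphM py.
  rewrite det_map_mx; apply: ker.
  rewrite -det_map_mx raddfB /= map_scalar_mx /= rmorphM hy hst hMt ME.
  have -> : (x * iota s)%:M - map_mx iota (s *: C) = iota s *: (x%:M - map_mx iota C).
    by rewrite map_mxZ scalerBr scale_scalar_mx mulrC.
  rewrite detZ; move: xroot; rewrite rootE -(horner_evalE x) /char_poly -det_map_mx => /eqP.
  rewrite raddfB /= map_scalar_mx /= horner_evalE hornerX -map_mx_comp.
  rewrite (_ : map_mx _ _ = map_mx iota C) => [->|]; first by rewrite mulr0.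
  by apply/matrixP => i j; rewrite !mxE /= horner_evalE hornerC.
have /eqP/det0P[v v0 vM] := detM.
have {}vM : v *m map_mx phi Mt = (a * phi st) *: v.
  by apply/eqP; rewrite -subr_eq0 -mul_mx_scalar -mulmxBr -oppr_eq0 -mulmxN opprB vM.
have vMX m : v *m map_mx phi Mt ^+ m = (a * phi st) ^+ m *: v.
  elim: m => [|m IH]; first by rewrite mulmx1 scale1r.
  by rewrite exprS mulmxA vM -scalemxAl IH scalerA exprS.
have := vMX p; rewrite phiM -scalemxAr vM scalerA => /eqP.
rewrite -subr_eq0 -scalerBl scaler_eq0 (negPf v0) orbF subr_eq0 mulrCA -exprSr prednK //.
by rewrite exprMn qE => /eqP/(mulIf (expf_neq0 p sigma0)) <-.
Qed.

End GoodReduction.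

(** * Diagonalizing the constant term over the rationals *)

Section Diagonalization.
Variables (K : fieldType) (E : numClosedFieldType) (iota : {rmorphism K -> E}).
Variables (S : {pred K}) (S_fingen : fingen_Zalgebra S) (S_frac : has_fraction_field S).
Variables (n' : nat).
Local Notation n := n'.+1.
Variable A : 'M[rig_annulus K]_n.
Hypothesis A_companion : forall i j : 'I_n, (i.+1 < n)%N -> A i j = (i.+1 == j)%:R.
Hypothesis A_good : almost_all_primes S (good_reduction S A).
Local Notation C := (constant_term A).

Let S_ring : GRing.subring_closed S := proj1 S_fingen.

Lemma ratr_iota (q : rat) : iota (ratr q) = ratr q.
Proof. by rewrite /ratr fmorph_div !rmorph_int. Qed.

Definition rational_prod (F : fieldType) (qs : seq rat) : {poly F} :=
  \prod_(q <- qs) ('X - (ratr q)%:P).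

Lemma char_poly_rational : exists qs : seq rat, char_poly C = rational_prod K qs.
Proof.
have [xs xsE] := closed_field_poly_normal (char_poly (map_mx iota C)).
rewrite (monicP (char_poly_monic _)) scale1r in xsE.
have [qs qsE] : exists qs : seq rat, xs = [seq ratr q : E | q <- qs].
  have : {in xs, forall x, exists q : rat, x = ratr q}.
    move=> x xxs; apply: (rational_eigenvalue (iota := iota) S_fingen S_frac A_companion A_good).
    by rewrite xsE root_prod_XsubC.
  elim: (xs) => [|x s IH] h; first by exists [::].
  have [|qs ->] := IH; first by move=> y ys; apply: h; rewrite inE ys orbT.
  by have [q ->] := h x (mem_head _ _); exists (q :: qs).
exists qs; apply: (map_poly_inj iota); rewrite map_char_poly xsE qsE.
rewrite rmorph_prod big_map; apply: eq_bigr => q _.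
by rewrite rmorphB /= map_polyX map_polyC /= ratr_iota.
Qed.

(* The coefficients of [w = rational_prod F qs] lie in the prime field, so that      *)
(* [w(M)^p = w(M^p)].                                                              *)
Lemma rational_prod_pchar (F : fieldType) (M : 'M[F]_n) p qs : p \in [pchar F] ->
  M ^+ p = M -> horner_mx M (rational_prod F qs) ^+ p = horner_mx M (rational_prod F qs).
Proof.
move=> pF Mp; have pP : p \in [pchar {poly F}] by rewrite pchar_poly.
rewrite -rmorphXn /= -(pFrobenius_autE pP) /rational_prod !rmorph_prod.
apply: eq_bigr => q _; rewrite rmorphB /= !pFrobenius_autE -polyC_exp.
rewrite !rmorphB /= rmorphXn /= horner_mx_X Mp !horner_mx_C; congr (_ - _%:M).
by rewrite -(pFrobenius_autE pF) fmorph_div /= !pFrobenius_aut_int.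
Qed.

(** [W] is nilpotent by Cayley-Hamilton, while [W^p = W] modulo [P]. Hence [W] is zero modulo [P],
    and a nonzero entry of [W] would survive at some [P]. *)
Lemma rational_semisimple qs : char_poly C = rational_prod K qs ->
  horner_mx C (rational_prod K (undup qs)) = 0.
Proof.
move=> Cqs; set W := horner_mx _ _.
have WN : W ^+ (size qs) = 0.
  have /dvdpP[u hu] : char_poly C %| rational_prod K (undup qs) ^+ (size qs).
    have dvd q : q \in qs -> 'X - (ratr q)%:P %| rational_prod K (undup qs).
      by rewrite -mem_undup => qq; rewrite /rational_prod (big_rem q qq) dvdp_mulr.
    have gen s : {subset s <= qs} ->
        rational_prod K s %| rational_prod K (undup qs) ^+ (size s).
      elim: s => [|q s IH] sub; first by rewrite /rational_prod big_nil dvd1p.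
      rewrite /rational_prod big_cons exprS dvdp_mul ?dvd ?sub ?mem_head // IH // => q' q's.
      by apply: sub; rewrite inE q's orbT.
    by rewrite Cqs gen.
  by rewrite /W -rmorphXn /= hu rmorphM /= Cayley_Hamilton mulr0.
apply/matrixP => i j; rewrite [RHS]mxE; apply/eqP; apply: contraT => Wij.
have [P [F [r [B [p [rP AB pF nabla_p al]]]]]] :=
  avoid_good_reduction iota S_fingen S_frac A_good (W i j :: [seq (denq q)%:~R | q <- qs]).
have ratr_red q : q \in qs -> reduces_to S r (ratr q) (ratr q).
  move=> qq; apply: (reduces_to_ratr S_ring rP).
  have [|b hb b0] := al (denq q)%:~R;
    first by rewrite inE (map_f (fun q => (denq q)%:~R : K)) ?orbT.
  rewrite (reduces_to_unique S_ring rP (reduces_to_int S_ring rP _) hb) b0 //.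
  by rewrite -(fmorph_eq0 iota) rmorph_int intr_eq0 denq_eq0.
have Cp := fibre_constant_term_pchar S_fingen A_companion rP AB pF nabla_p.
set Cb := constant_term B in Cp.
pose Wb := horner_mx Cb (rational_prod F (undup qs)).
have Wbp : Wb ^+ p = Wb by apply: rational_prod_pchar.
have redW a b : reduces_to S r (W a b) (Wb a b).
  rewrite /W /Wb /rational_prod !rmorph_prod.
  have sub : {subset undup qs <= qs} by move=> q; rewrite mem_undup.
  elim: (undup qs) sub a b => [|q s IH] sub a b.
    by rewrite !big_nil !mxE; apply: (reduces_to_nat S_ring rP).
  rewrite !big_cons; apply: (reduces_mulmx S_ring rP) => [c d|]; last first.
    by apply: IH => q' q's; apply: sub; rewrite inE q's orbT.
  rewrite !rmorphB /= !horner_mx_X !horner_mx_C !mxE.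
  apply: (reduces_toD S_ring rP); first exact: AB.
  apply: (reduces_toN S_ring rP); case: eqP => _; rewrite ?mulr1n ?mulr0n.
    by apply: ratr_red; apply: sub; rewrite mem_head.
  exact: (reduces_to0 S_ring rP).
have redWX m a b : reduces_to S r ((W ^+ m) a b) ((Wb ^+ m) a b).
  elim: m a b => [|m IH] a b.
    by rewrite !expr0 !mxE; apply: (reduces_to_nat S_ring rP).
  by rewrite !exprS; apply: (reduces_mulmx S_ring rP).
have WbN : Wb ^+ (size qs) = 0.
  apply/matrixP => a b; have := redWX (size qs) a b; rewrite WN mxE => h; rewrite [RHS]mxE.
  exact: (reduces_to_unique S_ring rP h (reduces_to0 S_ring rP)).
have Wb0 : Wb = 0.
  have WbX m : Wb ^+ (p ^ m) = Wb.
    by elim: m => [|m IH]; rewrite ?expr1 // expnS exprM Wbp IH.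
  have /subnK le : (size qs <= p ^ size qs)%N.
    by rewrite ltnW // ltn_expl // prime_gt1 // (pcharf_prime pF).
  by rewrite -(WbX (size qs)) -le exprD WbN mulr0.
have [b hb /(_ Wij)] := al _ (mem_head _ _).
by rewrite (reduces_to_unique S_ring rP hb (redW i j)) Wb0 mxE eqxx.
Qed.

Lemma rational_diagonalization : exists (U : 'M[K]_n) (d : 'I_n -> rat),
  U \in unitmx /\ forall i, row i U *m C = ratr (d i) *: row i U.
Proof.
have [qs Cqs] := char_poly_rational.
have /diagonalizableP[U Uu /diagonalizable_forPex[D /(simmxRL Uu) UD]] : exists2 rs, uniq rs &
    mxminpoly C %| \prod_(x <- rs) ('X - x%:P).
  exists [seq ratr q : K | q <- undup qs].
    rewrite map_inj_uniq ?undup_uniq // => q q' /(congr1 iota).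
    by rewrite !ratr_iota => /fmorph_inj.
  by rewrite big_map; apply: mxminpoly_min; apply: rational_semisimple.
have UC : U *m C = diag_mx D *m U by rewrite UD mulmxKV.
have rowC i : row i U *m C = D 0 i *: row i U.
  by rewrite -row_mul UC row_mul row_diag_mx -scalemxAl -rowE.
have /choice[d hd] : forall i, exists q : rat, D 0 i = ratr q.
  move=> i; have : root (char_poly C) (D 0 i).
    rewrite -eigenvalue_root_char; apply/eigenvalueP; exists (row i U); first exact: rowC.
    apply/negP => /eqP Ui0; have : row i U *m invmx U = row i 1%:M by rewrite -row_mul mulmxV.
    by rewrite Ui0 mul0mx => /rowP/(_ i)/eqP; rewrite !mxE eqxx eq_sym oner_eq0.
  rewrite Cqs /rational_prod -(big_map (fun q => ratr q : K) xpredT (fun x => 'X - x%:P)).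
  by rewrite root_prod_XsubC => /mapP[q _ ->]; exists q.
by exists U, d; split=> // i; rewrite rowC hd.
Qed.

End Diagonalization.

(** * The obstruction over K *)

Lemma ratr_pchar (F : fieldType) p (q : rat) : p \in [pchar F] -> ratr q ^+ p = ratr q :> F.
Proof. by move=> pF; rewrite -(pFrobenius_autE pF) fmorph_div /= !pFrobenius_aut_int. Qed.

Section HorizontalSections.
Variables (K : fieldType) (E : numClosedFieldType) (iota : {rmorphism K -> E}).
Variables (S : {pred K}) (S_fingen : fingen_Zalgebra S) (S_frac : has_fraction_field S).
Variables (n' : nat).
Local Notation n := n'.+1.
Local Notation O := (rig_annulus K).
Variable A : 'M[O]_n.
Hypothesis A_companion : forall i j : 'I_n, (i.+1 < n)%N -> A i j = (i.+1 == j)%:R.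
Hypothesis A_good : almost_all_primes S (good_reduction S A).
Local Notation C := (constant_term A).
Local Notation nabla := (nabla_along A Dt).

Let S_ring : GRing.subring_closed S := proj1 S_fingen.
Let A_coef := generic_coef iota S_fingen S_frac A_companion A_good.

(** Only finitely many coefficients can be reduced at one prime, so approximate solutions are kept
    to Laurent polynomials in [q] and [t]. *)
Definition finite_support (y : 'rV[O]_n) : Prop :=
  finite_set [set x : int * int | exists i, coef (y 0 i) x.1 x.2 != 0].

(** Were the value nonzero, it would survive at a good prime where [y], [xi] and [q] also reduce,
    against [unobstructed_pchar]. *)
Lemma unobstructed (q : rat) (y : 'rV[O]_n) j k (xi : 'cV[K]_n)
    (w := nabla y + rig_const (ratr q) *: y) :
    finite_support y -> low j w -> C *m xi = - (k%:~R + ratr q) *: xi ->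
  layer k j w *m xi = 0.
Proof.
move=> /finite_seqP[s ys] lw Cxi; apply/matrixP => i0 j0; rewrite !ord1 [RHS]mxE {i0 j0}.
apply/eqP; apply: contraT => obs.
pose l := [seq xi i 0 | i <- enum 'I_n] ++
  [seq coef (y 0 ix.1) ix.2.1 ix.2.2 | ix <- [seq (i, x) | i <- enum 'I_n, x <- s]].
have [P [F [r [B [p [rP AB pF nabla_p al]]]]]] := avoid_good_reduction iota S_fingen S_frac A_good
  ((layer k j w *m xi) 0 0 :: (denq q)%:~R :: l).
have /choice[g hg] : forall a, exists b, a \in l -> reduces_to S r a b.
  move=> a; have [al'|_] := boolP (a \in l); last by exists 0.
  by have [|b hb _] := al a; [rewrite !inE al' !orbT|exists b].
have qred : reduces_to S r (ratr q) (ratr q).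
  apply: (reduces_to_ratr S_ring rP).
  have [|b hb b0] := al (denq q)%:~R; first by rewrite !inE eqxx orbT.
  rewrite (reduces_to_unique S_ring rP (reduces_to_int S_ring rP _) hb) b0 //.
  by rewrite -(fmorph_eq0 iota) rmorph_int intr_eq0 denq_eq0.
pose c i k' l' : F := if coef (y 0 i) k' l' == 0 then 0 else g (coef (y 0 i) k' l').
have cfin i : lowfin (c i).
  move=> M; apply: sub_finite_set (rig_lowfin (y 0 i) M) => x [xM cx]; split=> //.
  by apply: contraNneq cx => y0; rewrite /c y0 eqxx.
pose yb : 'rV[rig_annulus F]_n := \row_i rig_mk (cfin i).
have red_y i : reduces_fun S r (y 0 i) (yb 0 i).
  move=> k' l'; rewrite [yb 0 i]mxE /= /c; case: eqP => [->|/eqP y0].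
    exact: (reduces_to0 S_ring rP).
  apply: hg; rewrite mem_cat; apply/orP; right.
  apply/mapP; exists (i, (k', l')) => //; apply: allpairs_f; first exact: mem_enum.
  by have : [set` s] (k', l'); [rewrite -ys; exists i|].
pose wb := nabla_along B Dt yb + rig_const (ratr q) *: yb.
have red_w i : reduces_fun S r (w 0 i) (wb 0 i).
  have -> : w 0 i = nabla y 0 i + rig_const (ratr q) * y 0 i by rewrite [LHS]mxE [X in _ + X]mxE.
  have -> : wb 0 i = nabla_along B Dt yb 0 i + rig_const (ratr q) * yb 0 i.
    by rewrite [LHS]mxE [X in _ + X]mxE.
  apply: (reduces_funD S_ring rP); first exact: (reduces_nabla S_ring rP AB red_y).
  apply: (reduces_funM S_ring rP); last exact: red_y.
  exact: (reduces_fun_const S_ring rP).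
have red_layer k' l' i : reduces_to S r (layer k' l' w 0 i) (layer k' l' wb 0 i).
  by rewrite [layer k' l' w]/layer [layer k' l' wb]/layer 2!mxE; apply: red_w.
have lwb : low j wb.
  move=> k' l' lj; apply/rowP => i.
  apply: (reduces_to_unique S_ring rP (red_layer k' l' i)); rewrite lw // !mxE.
  exact: (reduces_to0 S_ring rP).
pose xib : 'cV[F]_n := \col_i g (xi i 0).
have red_xi i j' : reduces_to S r (xi i j') (xib i j').
  rewrite [j']ord1 mxE; apply: hg; rewrite mem_cat; apply/orP; left.
  by apply: map_f; apply: mem_enum.
have Cxib : constant_term B *m xib = - (k%:~R + ratr q) *: xib.
  apply/matrixP => i j'.
  have h := reduces_mulmx S_ring rP (fibre_constant_term AB) red_xi i j'.
  apply: (reduces_to_unique S_ring rP h); rewrite Cxi !mxE.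
  apply: (reduces_toM S_ring rP); last by have := red_xi i j'; rewrite [xib _ _]mxE.
  apply: (reduces_toN S_ring rP); apply: (reduces_toD S_ring rP) => //.
  exact: (reduces_to_int S_ring rP).
have B_coef := fibre_coef S_fingen A_companion rP AB pF nabla_p.
have z : layer k j wb *m xib = 0.
  by apply: (unobstructed_pchar B_coef pF nabla_p (lam := ratr q)); rewrite ?ratr_pchar.
have [b hb /(_ obs)] := al _ (mem_head _ _).
have h : reduces_to S r ((layer k j w *m xi) 0 0) ((layer k j wb *m xib) 0 0).
  by apply: (reduces_mulmx S_ring rP) => // i j'; rewrite (ord1 i).
by rewrite (reduces_to_unique S_ring rP hb h) z mxE eqxx.
Qed.

End HorizontalSections.

(** * Horizontal sections *)

Section Solutions.
Variables (K : fieldType) (E : numClosedFieldType) (iota : {rmorphism K -> E}).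
Variables (S : {pred K}) (S_fingen : fingen_Zalgebra S) (S_frac : has_fraction_field S).
Variables (n' : nat).
Local Notation n := n'.+1.
Local Notation O := (rig_annulus K).
Variable A : 'M[O]_n.
Hypothesis A_companion : forall i j : 'I_n, (i.+1 < n)%N -> A i j = (i.+1 == j)%:R.
Hypothesis A_good : almost_all_primes S (good_reduction S A).
Local Notation C := (constant_term A).
Local Notation nabla := (nabla_along A Dt).
Local Notation shift q := (fun y => nabla y + rig_const (ratr q) *: y).

Let A_coef := generic_coef iota S_fingen S_frac A_companion A_good.

Variables (U : 'M[K]_n) (d : 'I_n -> rat).
Hypotheses (U_unit : U \in unitmx) (UC : forall i, row i U *m C = ratr (d i) *: row i U).

Lemma shiftD q x y : shift q (x + y) = shift q x + shift q y.
Proof. by rewrite /= nablaD scalerDr addrACA. Qed.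

Lemma eigen_diag : U *m C = diag_mx (\row_i ratr (d i)) *m U.
Proof.
apply/row_matrixP => i; rewrite !row_mul UC row_diag_mx -scalemxAl -rowE.
by rewrite mxE.
Qed.

(** In the eigenbasis [U] the operator [k + q + C] is diagonal with entries [a i]. Where [a i = 0],
    column [i] of [invmx U] is an admissible [xi], so the component of [rho] vanishes and the
    convention [0^-1 = 0] does no harm. The clause on [rho = 0] keeps later corrections finite. *)
Lemma solve_layer (k : int) (q : rat) (rho : 'rV[K]_n) :
    (forall xi : 'cV[K]_n, C *m xi = - (k%:~R + ratr q) *: xi -> rho *m xi = 0) ->
  exists tau, (k%:~R + ratr q) *: tau + tau *m C = - rho /\ (rho = 0 -> tau = 0).
Proof.
move=> h; pose a i : K := k%:~R + ratr q + ratr (d i).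
pose b := rho *m invmx U; pose g := b *m diag_mx (\row_i (a i)^-1).
pose tau := - (g *m U).
exists tau; split; last by move=> r0; rewrite /tau /g /b r0 !mul0mx oppr0.
have gC : g *m U *m C = g *m diag_mx (\row_i ratr (d i)) *m U by rewrite -mulmxA eigen_diag mulmxA.
rewrite /tau mulNmx scalerN -opprD gC scalemxAl -mulmxDl.
rewrite -[rho in RHS](mulmxKV U_unit) -/b; congr (- (_ *m U)).
apply/rowP => i; rewrite [LHS]mxE mul_mx_diag [X in X + _]mxE [X in _ + X]mxE [(\row_i _) _ _]mxE.
have -> : g 0 i = b 0 i * (a i)^-1 by rewrite /g mul_mx_diag !mxE.
have -> : (k%:~R + ratr q) * (b 0 i * (a i)^-1) + b 0 i * (a i)^-1 * ratr (d i) =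
  b 0 i * (a i / a i).
  by rewrite {3}/a; ring.
have [ai0|ai0] := eqVneq (a i) 0; last by rewrite divff ?mulr1.
rewrite ai0 mul0r mulr0; apply/esym.
have e : C *m col i (invmx U) = - (k%:~R + ratr q) *: col i (invmx U).
  have -> : - (k%:~R + ratr q) = ratr (d i) :> K.
    by apply/eqP; rewrite eq_sym -subr_eq0 opprK addrC; apply/eqP.
  rewrite !colE mulmxA.
  have -> : C *m invmx U = invmx U *m diag_mx (\row_i ratr (d i)).
    by apply: (can_inj (mulKmx U_unit)); rewrite mulmxA eigen_diag mulmxK // mulKVmx.
  rewrite -!colE; apply/colP => l.
  rewrite [LHS]mxE mul_mx_diag [in LHS]mxE [RHS]mxE [col _ _ _ _]mxE.
  by rewrite [X in _ * X]mxE mulrC.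
have /matrixP/(_ 0 0) := h _ e; rewrite [RHS]mxE => <-.
by rewrite /b !mxE; apply: eq_bigr => l _; rewrite [in RHS]mxE.
Qed.

Section Eigenvector.
Variables (q : rat) (v0 : 'rV[K]_n).
Hypothesis v0C : v0 *m C = - ratr q *: v0.

Definition approx_solution (m : nat) (y : 'rV[O]_n) : Prop :=
  [/\ finite_support y, low 0 y, forall k, layer k 0 y = (k == 0)%:R *: v0 &
      low m.+1%:Z (shift q y)].

Lemma approx_solution0 : approx_solution 0 (map_mx (@rig_const K) v0).
Proof.
have lay k l : layer k l (map_mx (@rig_const K) v0) = ((k == 0) && (l == 0))%:R *: v0.
  by apply/rowP => i; rewrite !mxE coef_const mulrC.
have l0 : low 0 (map_mx (@rig_const K) v0).
  by move=> k l l0; rewrite lay [l == 0]lt_eqF // andbF scale0r.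
split=> //.
- apply: (@sub_finite_set _ _ [set (0, 0)]); last exact: finite_set1.
  move=> [k l] [i /=]; rewrite mxE coef_const.
  by have [->|_] := eqVneq k 0; have [->|_] := eqVneq l 0 => //; rewrite mulr0 eqxx.
- by move=> k; rewrite lay eqxx andbT.
move=> k l l1; have [lneg|] := ltP l 0; first exact: (nabla_shift_low A_coef _ l0).
move=> lpos; have -> : l = 0 by lia.
rewrite layerD layer_constZ (layer_nabla_low A_coef _ l0) // lay eqxx andbT.
have [->|_] := eqVneq k 0; last by rewrite mulr0n !(scale0r, scaler0, mul0mx, addr0).
by rewrite mulr1n !scale1r scale0r add0r v0C -scalerDl addNr scale0r.
Qed.

(** The correction is [q^(m+1)] times the sum of the [tau k t^k]; it is finite because the layer of
    the error [w] at [q^(m+1)] is. *)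
Lemma approx_solution_step m y : approx_solution m y ->
  exists y', approx_solution m.+1 y' /\ low m.+1%:Z (y' - y).
Proof.
move=> [fy ly y0 lw]; set w := shift q y in lw.
have /choice[tau htau] : forall k, exists tau,
    (k%:~R + ratr q) *: tau + tau *m C = - layer k m.+1%:Z w /\ (layer k m.+1%:Z w = 0 -> tau = 0).
  move=> k; apply: solve_layer => xi Cxi.
  exact: (unobstructed iota S_fingen S_frac A_companion A_good fy lw Cxi).
pose c i k l : K := if l == m.+1%:Z then tau k 0 i else 0.
pose X := \bigcup_(i in [set: 'I_n]) low_support (coef (w 0 i)) (m.+1%:Z + 1).
have fX : finite_set X by apply: bigcup_finite => // i _; apply: rig_lowfin.
have cX i k l : c i k l != 0 -> X (k, l).
  rewrite /c; have [->|_] := eqVneq l m.+1%:Z; last by rewrite eqxx.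
  move=> t0; have wk : layer k m.+1%:Z w != 0.
    by apply: contraNneq t0 => /(proj2 (htau k)) ->; rewrite mxE.
  have [i' wi] : exists i', layer k m.+1%:Z w 0 i' != 0.
    apply: contrapT => none; case/eqP: wk; apply/rowP => i'; rewrite [RHS]mxE.
    by apply: contrapT => /eqP wi; case: none; exists i'.
  by exists i' => //; split=> /=; [rewrite ltrDl|move: wi; rewrite mxE].
have cfin i : lowfin (c i).
  by move=> M; apply: sub_finite_set fX => -[k l] [_ /cX].
pose t : 'rV[O]_n := \row_i rig_mk (cfin i).
have layt k l : layer k l t = if l == m.+1%:Z then tau k else 0.
  by apply/rowP => i; rewrite 2!mxE /= /c; have [_|_] := eqVneq l m.+1%:Z; rewrite ?mxE.
have lt : low m.+1%:Z t by move=> k l lm; rewrite layt lt_eqF.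
exists (y + t); split; last by rewrite addrC addKr.
split.
- apply: (@sub_finite_set _ _ ([set x | exists i, coef (y 0 i) x.1 x.2 != 0] `|` X)); last first.
    by rewrite finite_setU.
  move=> [k l] [i h]; rewrite !mxE /= in h.
  have [yz|] := eqVneq (coef (y 0 i) k l) 0; last by left; exists i.
  by right; apply: (cX i); rewrite yz add0r in h.
- apply: lowD => // k l l0; apply: lt; exact: lt_trans l0 _.
- by move=> k; rewrite layerD y0 lt ?addr0.
rewrite shiftD -/w => k l lm; have [lm'|lm'] := ltP l m.+1%:Z.
  by rewrite layerD lw // (nabla_shift_low A_coef _ lt) ?addr0.
have -> : l = m.+1%:Z by lia.
rewrite layerD layerD layer_constZ (layer_nabla_low A_coef _ lt) // layt eqxx.
by rewrite addrAC -scalerDl (proj1 (htau k)) addrN.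
Qed.

Lemma solution_exists : exists z : 'rV[O]_n,
  [/\ forall i, reduces_mod_q (z 0 i) (v0 0 i) & shift q z = 0].
Proof.
have /choice[f hf] : forall my : nat * 'rV[O]_n, exists y', approx_solution my.1 my.2 ->
    approx_solution my.1.+1 y' /\ low my.1.+1%:Z (y' - my.2).
  move=> [m y]; have [/approx_solution_step[y' ?]|no] := pselect (approx_solution m y).
    by exists y'.
  by exists 0.
have [Y [Y0 YE]] : exists Y : nat -> 'rV[O]_n,
    Y 0%N = map_mx (@rig_const K) v0 /\ forall m, Y m.+1 = f (m, Y m).
  by exists (fix Y m := if m is m'.+1 then f (m', Y m') else map_mx (@rig_const K) v0).
have YP m : approx_solution m (Y m).
  elim: m => [|m IH]; first by rewrite Y0; apply: approx_solution0.
  by rewrite YE; apply: (proj1 (hf (m, Y m) IH)).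
have YS m : low m.+1%:Z (Y m.+1 - Y m) by rewrite YE; apply: (proj2 (hf (m, Y m) (YP m))).
have /choice[z hz] : forall i, exists g : O, rig_le1 g /\
    forall m, vanishes_below m.+1%:Z (g - Y m 0 i).
  move=> i; apply: rig_limit.
    by move=> m k l l0; have [_ lY _ _] := YP m; have /rowP/(_ i) := lY k l l0; rewrite !mxE.
  move=> m k l lm; have /rowP/(_ i) := YS m k l lm; rewrite !mxE => /eqP.
  by rewrite rcoefB subr_eq0 => /eqP.
have zY m : low m.+1%:Z ((\row_i z i) - Y m).
  by move=> k l lm; apply/rowP => i; rewrite !mxE; apply: (proj2 (hz i)).
exists (\row_i z i); split=> [i|].
  rewrite mxE; split=> [|k]; first exact: (proj1 (hz i)).
  have /rowP/(_ i) := zY 0%N k 0 isT; rewrite !mxE => /eqP; rewrite rcoefB subr_eq0 => /eqP ->.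
  have [_ _ Yk _] := YP 0%N; have /rowP/(_ i) := Yk k.
  by rewrite mxE => ->; rewrite mxE mulrC.
apply: layerP => k l; rewrite layer0; have [l0|] := ltP l 0.
  apply: (nabla_shift_low A_coef) l0 => k' l' l0; apply/rowP => i; rewrite !mxE.
  exact: (proj1 (hz i)).
case: l => // m _.
have -> : \row_i z i = (\row_i z i - Y m) + Y m by rewrite subrK.
have [_ _ _ lY] := YP m.
have := shiftD q (\row_i z i - Y m) (Y m) => /= ->.
by rewrite layerD lY ?ltz_nat // (nabla_shift_low A_coef _ (zY m)) ?ltz_nat // addr0.
Qed.

End Eigenvector.
End Solutions.

(** * Solutions on the cover t = s^m *)

Lemma natr_const (F : fieldType) m : m%:R = rig_const m%:R :> rig_annulus F.
Proof.
elim: m => [|m IH]; apply: rig_annulusP => k l; first by rewrite coef_const mul0r.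
by rewrite mulrS Defs.coefD IH rcoef1 !coef_const mulrS mulrDl mul1r.
Qed.

Lemma constM (F : fieldType) (a b : F) : rig_const a * rig_const b = rig_const (a * b).
Proof. by apply: rig_annulusP => k l; rewrite coef_constM !coef_const mulrA. Qed.

Lemma Dt_monomial (F : fieldType) k : Dt (rig_monomial k 0 : rig_annulus F) =
  rig_const k%:~R * rig_monomial k 0.
Proof.
apply: rig_annulusP => k' l; rewrite coef_Dt coef_constM coef_monomial.
by case: eqP => [->|] //=; rewrite !mulr0.
Qed.

Lemma pullback_const (K : fieldType) (L : fieldExtType K) m e (a : K) : (0 < m)%N -> (0 < e)%N ->
  pullback L m e (rig_const a) = rig_const a%:A.
Proof.
move=> m0 e0; have eq0 (u : nat) (k : int) : (0 < u)%N -> (u%:Z * k == 0) = (k == 0).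
  by move=> u0; rewrite mulf_eq0 -[u%:Z == 0]/(u == 0%N) gtn_eqF.
apply/esym/pullbackP => // k l; first rewrite !coef_const !eq0 //.
  by case: (_ && _); rewrite ?mulr1 // !mulr0 scale0r.
rewrite coef_const => no; have [k0|_] := eqVneq k 0; last by rewrite mulr0.
have [l0|_] := eqVneq l 0; last by rewrite mulr0.
by case: no; exists 0, 0; rewrite !mulr0.
Qed.

Lemma ratrN (F : fieldType) q : ratr (- q) = - ratr q :> F.
Proof. by rewrite /ratr numqN denqN rmorphN mulNr. Qed.

Lemma common_denominator_rat n (d : 'I_n -> rat) :
  exists (m : nat) (c : 'I_n -> int), (0 < m)%N /\ forall i, m%:R * d i = (c i)%:~R.
Proof.
pose m := (\prod_i `|denq (d i)|)%N.
exists m, (fun i => (\prod_(j | j != i) `|denq (d j)|)%N%:Z * numq (d i)); split.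
  by apply: prodn_gt0 => i; rewrite absz_gt0 denq_eq0.
move=> i; rewrite /m (bigD1 i) //= natrM rmorphM /= -pmulrn mulrAC mulrC; congr (_ * _).
by rewrite numqE mulrC; congr (_ * _); rewrite pmulrn absz_denq.
Qed.

Section Pullback.
Variables (K : fieldType) (L : fieldExtType K) (n' m e : nat).
Hypotheses (m_gt0 : (0 < m)%N) (e_gt0 : (0 < e)%N).
Local Notation n := n'.+1.
Local Notation pb := (pullback L m e).
Variables (A Z : 'M[rig_annulus K]_n) (U : 'M[K]_n) (d : 'I_n -> rat) (c : 'I_n -> int).
Hypothesis cd : forall i, m%:R * d i = (c i)%:~R.
Hypothesis pchar0 : forall k : nat, k != 0%N -> k%:R != 0 :> K.
Hypotheses (U_unit : U \in unitmx) (ZU : forall i j, reduces_mod_q (Z i j) (U i j)).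
Hypothesis Z_horizontal : forall i,
  nabla_along A Dt (row i Z) + rig_const (ratr (- d i)) *: row i Z = 0.

Lemma pullback_mulmx (X Y : 'M[rig_annulus K]_n) : map_mx pb X *m map_mx pb Y = map_mx pb (X *m Y).
Proof.
apply/matrixP => i j; rewrite !mxE pullback_sum //; apply: eq_bigr => l _.
by rewrite !mxE pullbackM.
Qed.

Lemma monomial_inv (k : int) :
  rig_monomial (- k) 0 * rig_monomial k 0 = 1 :> rig_annulus L.
Proof. by rewrite rig_monomialM addNr addr0. Qed.

(** The determinant of [Z] reduces modulo [q] to [\det U], a nonzero constant, so its inverse is
    bounded by 1. *)
Lemma bounded_inverse : exists W : 'M[rig_annulus K]_n,
  [/\ le1_mx W, Z *m W = 1%:M & W *m Z = 1%:M].
Proof.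
have detU : \det U != 0 by rewrite -unitfE -unitmxE.
have [g g1 gZ] := reduces_mod_q_unit (reduces_mod_q_det ZU) detU.
exists (g *: \adj Z); split.
- move=> i j; rewrite !mxE.
  have h : reduces_mod_q (cofactor Z j i) (cofactor U j i).
    apply: reduces_mod_qM; first exact: reduces_mod_q_sign.
    by apply: reduces_mod_q_det => k l; rewrite !mxE.
  by have := vanishes_belowM g1 (proj1 h); rewrite addr0.
- by rewrite -scalemxAr mul_mx_adj scale_scalar_mx mulrC gZ.
- by rewrite -scalemxAl mul_adj_mx scale_scalar_mx mulrC gZ.
Qed.

Lemma const_denominator i : m%:R * pb (rig_const (ratr (- d i))) = rig_const (- c i)%:~R.
Proof.
rewrite pullback_const // natr_const constM; congr rig_const.
rewrite -[m%:R * _]/(m%:R * (ratr (- d i) *: 1)) mulr_natl -scaler_nat scalerA.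
have -> : m%:R * ratr (- d i) = (- c i)%:~R :> K.
  have dn : (denq (d i))%:~R != 0 :> K.
    rewrite -[denq _]absz_denq -pmulrn pchar0 //.
    by rewrite absz_eq0 denq_eq0.
  have e2 : m%:Z * numq (d i) = c i * denq (d i).
    by apply/eqP; rewrite -(eqr_int rat) !intrM -cd numqE -pmulrn mulrA.
  rewrite ratrN mulrN rmorphN /=; congr (- _); apply: (mulIf dn).
  by rewrite /ratr -mulrA mulfVK // -intrM -e2 intrM -pmulrn.
by rewrite scaler_int.
Qed.

(** Row [i] of [Z] satisfies [nabla z = d_i z]. On the cover the eigenvalue becomes [m d_i = c_i],
    and the factor [s^(- c_i)], a unit bounded by 1, cancels it. *)
Lemma pullback_solution : exists Y, solution_basis_le1 (pullback_mx L m e A) Y.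
Proof.
have [W [W1 ZW WZ]] := bounded_inverse.
pose mono i : rig_annulus L := rig_monomial (- c i) 0.
pose Y := \matrix_(i, j) (mono i * pb (Z i j)).
have YE : Y = diag_mx (\row_i mono i) *m map_mx pb Z.
  by apply/matrixP => i j; rewrite mul_diag_mx !mxE.
have mono_le1 k f : rig_le1 f -> rig_le1 (rig_monomial k 0 * f : rig_annulus L).
  by move=> f1 k' l l0; rewrite coef_monomialM f1 ?subr0.
exists Y; split.
- move=> i; rewrite nabla_along_Dt; apply/rowP => j.
  have h1 : Dt (Z i j) + \sum_l Z i l * A l j + rig_const (ratr (- d i)) * Z i j = 0.
    have -> : \sum_l Z i l * A l j = (row i Z *m A) 0 j.
      by rewrite mxE; apply: eq_bigr => l _; rewrite mxE.
    have := Z_horizontal i; rewrite nabla_along_Dt => /rowP/(_ j).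
    rewrite [LHS]mxE [X in X + _]mxE [X in X + _ + _]mxE [X in Dt X]mxE.
    by rewrite [X in _ + _ + X]mxE [X in _ * X]mxE [RHS]mxE.
  have h2 : m%:R * pb (Dt (Z i j)) + \sum_l pb (Z i l) * (m%:R * pb (A l j)) +
      rig_const (- c i)%:~R * pb (Z i j) = 0.
    have := congr1 (fun f => m%:R * pb f) h1.
    rewrite pullback0 // mulr0 -!pullbackD // pullback_sum // -pullbackM // => h.
    apply: etrans h; rewrite !mulrDr -const_denominator mulr_sumr mulrA; congr (_ + _ + _).
    by apply: eq_bigr => l _; rewrite -pullbackM // mulrCA.
  transitivity (Dt (Y i j) + \sum_l Y i l * (m%:R * pb (A l j))).
    rewrite [LHS]mxE [X in X + _]mxE [X in Dt X]mxE [X in _ + X]mxE; congr (_ + _).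
    by apply: eq_bigr => l _; rewrite [row i Y _ _]mxE [pullback_mx _ _ _ _ _ _]mxE.
  rewrite mxE DtM Dt_monomial Dt_pullback // [RHS]mxE -[RHS](mulr0 (mono i)) -[in RHS]h2.
  under eq_bigr do rewrite mxE -mulrA.
  rewrite -mulr_sumr; set u := \sum_l _; rewrite /mono; ring.
- by move=> i j; rewrite mxE; apply: mono_le1; apply: pullback_le1 => //; apply: (proj1 (ZU i j)).
pose V := map_mx pb W *m diag_mx (\row_i rig_monomial (c i) 0).
have pb1 : map_mx pb (1%:M : 'M_n) = 1%:M :> 'M_n.
  by apply/matrixP => i j; rewrite !mxE; case: eqP; rewrite ?pullback1 ?pullback0.
exists V; split.
- move=> i j; rewrite /V mul_mx_diag !mxE mulrC; apply: mono_le1.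
  by apply: pullback_le1 => //; apply: W1.
- rewrite YE /V -mulmxA [map_mx pb Z *m _]mulmxA pullback_mulmx ZW pb1 mul1mx mulmx_diag.
  apply/matrixP => i j; rewrite !mxE; case: eqP => // _.
  by rewrite monomial_inv.
- rewrite YE /V -mulmxA [diag_mx _ *m (_ *m _)]mulmxA mulmx_diag.
  have -> : diag_mx (\row_j ((\row_i rig_monomial (c i) 0) 0 j * (\row_i mono i) 0 j)) =
    1%:M :> 'M[rig_annulus L]_n.
    by apply/matrixP => i j; rewrite !mxE; case: eqP => // _; rewrite mulrC monomial_inv.
  by rewrite mul1mx pullback_mulmx WZ pb1.
Qed.

End Pullback.

(** * Assembling the theorem *)

Lemma companion_of_cyclic (F : fieldType) (V : lmodType (rig_annulus F)) (nabla : V -> V) n (v : V)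
    (A : 'M[rig_annulus F]_n) : cyclic_vector nabla n v -> connection_matrix nabla v A ->
  forall i j : 'I_n, (i.+1 < n)%N -> A i j = (i.+1 == j)%:R.
Proof.
move=> v_cyclic A_mx i j ilt; have [c [_ c_uniq]] := v_cyclic (nabla (iter i nabla v)).
have c1 : c = row i A.
  by apply: c_uniq; rewrite A_mx; apply: eq_bigr => l _; rewrite mxE.
have c2 : c = delta_mx 0 (Ordinal ilt).
  apply: c_uniq; rewrite (bigD1 (Ordinal ilt)) //= mxE !eqxx scale1r big1 ?addr0 // => l lN.
  by rewrite mxE (negPf lN) andbF scale0r.
by move: c2; rewrite c1 => /rowP/(_ j); rewrite !mxE => ->; rewrite -val_eqE eq_sym.
Qed.

Theorem theorem3p2 (R : realType) (K : fieldType) (iota : {rmorphism K -> R[i]})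
  (S : {pred K})
  (S_fingen : fingen_Zalgebra S)
  (S_frac : has_fraction_field S)
  (S_alg : localized_ring_of_integers (algebraic_part S))
  (V : lmodType (rig_annulus K)) (nabla : V -> V)
  (nabla_conn : is_connection nabla)
  (n : nat) (v : V) (v_cyclic : cyclic_vector nabla n v)
  (A : 'M[rig_annulus K]_n) (A_mx : connection_matrix nabla v A)
  (A_red : almost_all_primes S (fun P => reducible_mx S P A))
  (A_pcurv : almost_all_primes S (fun P =>
     exists (F : fieldType) (r : K -> F) (B : 'M[rig_annulus F]_n) (p : nat),
       [/\ residue_field S P r, reduces_to_mx S r A B, p \in [pchar F] &
           forall x, p_curvature p B x = 0])) :
  le1_mx A /\
  exists (L : fieldExtType K) (m e : nat) (Y : 'M[rig_annulus L]_n),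
    [/\ (0 < m)%N, (0 < e)%N & solution_basis_le1 (pullback_mx L m e A) Y].

Proof.
have A_companion := companion_of_cyclic v_cyclic A_mx.
(* Rank 0 is handled separately by empty matrices; the lemmas above are stated in rank [n'.+1]. *)
case: n A v_cyclic A_mx A_red A_pcurv A_companion => [|n'] A' _ _ _ A_good A_companion.
  split=> [[]//|]; exists K^o, 1%N, 1%N, 1%:M; split=> //; split=> [[]//|[]//|].
  exists 1%:M; split=> [[]//||]; by apply/matrixP => -[].
have coefA := generic_coef iota S_fingen S_frac A_companion A_good.
split.
  by move=> i j k l l0; apply: contrapT => /eqP/coefA; lia.
have [U [d [U_unit UC]]] := rational_diagonalization iota S_fingen S_frac A_companion A_good.
have /choice[z hz] : forall i, exists z : 'rV[rig_annulus K]_n'.+1,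
    [/\ forall j, reduces_mod_q (z 0 j) (row i U 0 j) &
      nabla_along A' Dt z + rig_const (ratr (- d i)) *: z = 0].
  move=> i; apply: (solution_exists iota S_fingen S_frac A_companion A_good U_unit UC).
  by rewrite UC ratrN opprK.
have [m [c [m_gt0 cd]]] := common_denominator_rat d.
pose Z := \matrix_(i, j) z i 0 j.
have rowZ i : row i Z = z i by apply/rowP => j; rewrite !mxE.
(* The exponents are rational, so the cover [t = s^m] is taken with scalars [K^o] and [e = 1]. *)
have [|i j|i|Y hY] := @pullback_solution K K^o n' m 1 m_gt0 isT A' Z U d c cd _ U_unit.
- by move=> k k0; rewrite -(fmorph_eq0 iota) rmorph_nat pnatr_eq0.
- by have := proj1 (hz i) j; rewrite !mxE.
- by rewrite rowZ; case: (hz i).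
by exists K^o, m, 1%N, Y.
Qed.
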